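(* Let $\mathcal{K}$ be a (separable) Hilbert space of any dimension, let $\mathcal{H}=L^2(0,\infty)\otimes\mathcal{K}$, and let $R\in\mathcal{B}(\mathcal{H})$ be an operator satisfying: $0\le R\le1$; $R$ and $1-R$ are invertible; and, for all $t\ge0$, $\mathrm{Tr}(R|_{S_t\mathcal{H}}-R|_{S_t\mathcal{H}}^2)=\infty$, $S_t^*RS_t=R$ and $RS_t\mathcal{H}\subseteq S_t\mathcal{H}$. Let $\alpha$ be the corresponding CAR flow on $M_R$. Then for positive integers $k\ne\ell$, $\alpha^{\otimes k}$ and $\alpha^{\otimes\ell}$ are not cocycle conjugate when considered as $E_0$-semigroups on $M_R$ (via isomorphisms $M_R^{\bar\otimes k}\cong M_R\cong M_R^{\bar\otimes\ell}$).
   Context: Inner products are linear in the first coordinate; $S_t$ is the shift on $\mathcal{H}$: $(S_tf)(s)=0$ for $s<t$, $(S_tf)(s)=f(s-t)$ for $s\ge t$. $\mathcal{A}(\mathcal{H})$ is the CAR algebra: the unital $C^*$-algebra generated by the creation operators $c(f)$, $f\in\mathcal{H}$, on the antisymmetric Fock space ($c$ is linear, $c(f)c(g)+c(g)c(f)=0$, $c(f)c(g)^*+c(g)^*c(f)=\langle f,g\rangle1$); write $c^*(f)=c(f)^*$. For $0\le R\le1$ in $\mathcal{B}(\mathcal{H})$, the quasi-free state $\omega_R$ on $\mathcal{A}(\mathcal{H})$ is determined by $\omega_R(c^*(f_m)\cdots c^*(f_1)c(g_1)\cdots c(g_n))=\delta_{mn}\det(\langle g_i,Rf_j\rangle)$;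 $\pi_R$ is its GNS representation and $M_R=\pi_R(\mathcal{A}(\mathcal{H}))''$, a hyperfinite factor. If $S_t^*RS_t=R$ for all $t\ge0$, the CAR flow associated to $R$ is the unique $E_0$-semigroup $\alpha=\alpha^R$ on $M_R$ with $\alpha_t(\pi_R(c(f)))=\pi_R(c(S_tf))$, $f\in\mathcal{H}$, $t\ge0$. The tensor power $\alpha^{\otimes k}=\{\alpha_t^{\otimes k}\}_{t\ge0}$ acts on $M_R^{\bar\otimes k}$, which under the hypotheses of the claim is isomorphic to $M_R$. An $E_0$-semigroup on a von Neumann algebra $M$ is a weak$^*$-continuous semigroup $\{\alpha_t\}_{t\ge0}$ of normal unital $*$-endomorphisms with $\alpha_0=\mathrm{id}$. An $\alpha$-cocycle is a strongly continuous family of unitaries $\{U_t\}_{t\ge0}$ in $M$ with $U_{s+t}=U_t\alpha_t(U_s)$. $E_0$-semigroups $\beta$ and $\alpha$ on $M$ are cocycle conjugate if there exist an automorphism $\gamma$ of $M$ and an $\alpha$-cocycle $U$ with $\gamma(\beta_t(\gamma^{-1}(x)))=U_t\alpha_t(x)U_t^*$ for all $t\ge0$, $x\in M$. *)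

(* Defs.v *)
From HB Require Import structures.
From mathcomp Require Import all_boot all_order all_algebra.
From mathcomp Require Import sesquilinear.
From mathcomp Require Import complex.
From mathcomp Require Import all_classical all_reals all_analysis.

Set Implicit Arguments.
Unset Strict Implicit.
Unset Printing Implicit Defensive.

Import Order.TTheory GRing.Theory Num.Theory.
Import numFieldNormedType.Exports.

Local Open Scope classical_set_scope.
Local Open Scope complex_scope.
Local Open Scope ring_scope.

(* The inner product is linear in the first and conjugate-linear in the second
   argument; completeness is that of the norm. *)
Record hilbert (R : realType) := Hilbert {
  hilbert_sort :> completeNormedModType R[i];
  inner : {dot hilbert_sort for (@Num.conj R[i])};
  innerE : forall x, inner x x = `|x| ^+ 2 }.

Section HilbertSpace.
Context {R : realType}.
Implicit Types H : hilbert R.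

Definition separable H := exists D : set H, countable D /\ dense D.

Definition lin_span H (E : set H) : set H :=
  [set v | exists n (a : 'I_n -> R[i]) (u : 'I_n -> H),
     (forall i, E (u i)) /\ v = \sum_(i < n) a i *: u i].

Definition bounded H : set (H -> H) := [set T | linear T /\ continuous T].
Arguments bounded : clear implicits.


Definition adj H (T : H -> H) : H -> H :=
  get [set S | bounded H S /\ forall x y, inner H (T x) y = inner H x (S y)].

Definition positive H (T : H -> H) := forall x, 0 <= inner H (T x) x.

Definition invertible H (T : H -> H) :=
  exists2 S, bounded H S & S \o T = idfun /\ T \o S = idfun.

Definition unitary H (U : H -> H) :=
  [/\ bounded H U, adj U \o U = idfun & U \o adj U = idfun].

Definition orthonormal_basis H (V E : set H) :=
  [/\ E `<=` V,
      forall x y, E x -> E y -> inner H x y = (x == y)%:R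
    & V `<=` closure (lin_span E)].

(* Trace, on the closed subspace V, of an operator P leaving V invariant and
   positive on V. *)
Definition trace H (V : set H) (P : H -> H) : \bar R :=
  \esum_(e in get (orthonormal_basis V)) (complex.Re (inner H (P e) e))%:E.

End HilbertSpace.
Arguments bounded {R} H.

Section OperatorAlgebras.
Context {R : realType}.

Definition Cstar_algebra (H : hilbert R) (A : set (H -> H)) :=
  [/\ A `<=` bounded H /\ A idfun,
      forall a x y, A x -> A y -> A (a *: x + y),
      forall x y, A x -> A y -> A (x \o y),
      forall x, A x -> A (adj x)
    & forall x, bounded H x ->
        (forall e : R[i], 0 < e ->
          exists2 y, A y & forall v, `|x v - y v| <= e * `|v|) ->
        A x].

Definition commutant (H : hilbert R) (X : set (H -> H)) : set (H -> H) :=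
  [set y | bounded H y /\ forall x, X x -> x \o y = y \o x].

Definition bicommutant (H : hilbert R) (X : set (H -> H)) :=
  commutant (commutant X).

Definition star_hom (H L : hilbert R) (A : set (H -> H)) (B : set (L -> L))
    (f : (H -> H) -> (L -> L)) :=
  [/\ forall x, A x -> B (f x),
      f idfun = idfun,
      forall a x y, A x -> A y -> f (a *: x + y) = a *: f x + f y,
      forall x y, A x -> A y -> f (x \o y) = f x \o f y
    & forall x, A x -> f (adj x) = adj (f x)].

Definition star_iso (H L : hilbert R) (A : set (H -> H)) (B : set (L -> L))
    (f : (H -> H) -> (L -> L)) (g : (L -> L) -> (H -> H)) :=
  [/\ star_hom A B f, star_hom B A g,
      forall x, A x -> g (f x) = x
    & forall y, B y -> f (g y) = y].

(* The elements of the predual of M: rho(x) = \sum_n <x v_n, w_n> on M for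
   square-summable sequences v and w. *)
Definition normal_functional (H : hilbert R) (M : set (H -> H))
    (rho : (H -> H) -> R[i]) :=
  exists v w : nat -> H,
    [/\ (\sum_(0 <= n <oo) (complex.Re `|v n| ^+ 2)%:E < +oo)%E,
        (\sum_(0 <= n <oo) (complex.Re `|w n| ^+ 2)%:E < +oo)%E
      & forall x, M x ->
          (fun N => \sum_(0 <= n < N) inner H (x (v n)) (w n)) @ \oo
            --> (rho x : R[i]^o)].

Definition normal_map (H : hilbert R) (M : set (H -> H))
    (f : (H -> H) -> (H -> H)) :=
  forall rho, normal_functional M rho -> normal_functional M (rho \o f).

Record E0_semigroup (H : hilbert R) (M : set (H -> H))
    (alpha : R -> (H -> H) -> (H -> H)) : Prop := {
  E0_hom : forall t : R, 0 <= t -> star_hom M M (alpha t);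
  E0_normal : forall t : R, 0 <= t -> normal_map M (alpha t);
  E0_0 : forall x, M x -> alpha 0 x = x;
  E0_add : forall (s t : R) x, 0 <= s -> 0 <= t -> M x ->
    alpha (s + t) x = alpha s (alpha t x);
  E0_continuous : forall rho x, normal_functional M rho -> M x ->
    {within [set t : R | 0 <= t],
      continuous (fun t => rho (alpha t x) : R[i]^o)} }.

Record cocycle (H : hilbert R) (M : set (H -> H))
    (alpha : R -> (H -> H) -> (H -> H)) (U : R -> H -> H) : Prop := {
  cocycle_unitary : forall t : R, 0 <= t -> M (U t) /\ unitary (U t);
  cocycle_continuous : forall v,
    {within [set t : R | 0 <= t], continuous (fun t => U t v)};
  cocycle_add : forall s t : R, 0 <= s -> 0 <= t ->
    U (s + t) = U t \o alpha t (U s) }.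

Definition cocycle_conjugate (H : hilbert R) (M : set (H -> H))
    (beta alpha : R -> (H -> H) -> (H -> H)) :=
  exists gamma gamma' U,
    [/\ star_iso M M gamma gamma', cocycle M alpha U
      & forall (t : R) x, 0 <= t -> M x ->
          gamma (beta t (gamma' x)) = U t \o alpha t x \o adj (U t)].

End OperatorAlgebras.

Section TensorPower.
Context {R : realType}.

(* The k-th Hilbert space tensor power, as a Hilbert space with elementary
   tensors; multilinearity of the latter follows from the inner product. *)
Record tensor_power (L : hilbert R) (k : nat) := TensorPower {
  tensor_space :> hilbert R;
  tensor : ('I_k -> L) -> tensor_space;
  tensorE : forall v w,
    inner _ (tensor v) (tensor w) = \prod_(i < k) inner L (v i) (w i);
  tensor_total : dense (lin_span (range tensor)) }.

Definition tensor_op (L : hilbert R) (k : nat) (P : tensor_power L k)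
    (x : 'I_k -> L -> L) : P -> P :=
  get [set X | bounded P X /\
    forall v, X (tensor P v) = tensor P (fun i => x i (v i))].
Arguments tensor_op {L k} P x.

Definition tensor_algebra (L : hilbert R) (M : set (L -> L)) (k : nat)
    (P : tensor_power L k) : set (P -> P) :=
  bicommutant [set tensor_op P x | x in [set x | forall i, M (x i)]].
Arguments tensor_algebra {L} M {k} P.

Definition tensor_semigroup (L : hilbert R) (M : set (L -> L))
    (alpha : R -> (L -> L) -> (L -> L)) (k : nat) (P : tensor_power L k)
    (beta : R -> (P -> P) -> (P -> P)) :=
  E0_semigroup (tensor_algebra M P) beta /\
  forall (t : R) x, 0 <= t -> (forall i, M (x i)) ->
    beta t (tensor_op P x) = tensor_op P (fun i => alpha t (x i)).

(* beta is the semigroup on M obtained from the k-th tensor power of alpha by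
   some isomorphism of the k-th tensor power of M with M. *)
Definition tensor_semigroup_on (L : hilbert R) (M : set (L -> L))
    (alpha : R -> (L -> L) -> (L -> L)) (k : nat)
    (beta : R -> (L -> L) -> (L -> L)) :=
  exists (P : tensor_power L k) alphak theta theta',
    [/\ tensor_semigroup M alpha alphak,
        star_iso (tensor_algebra M P) M theta theta'
      & beta = fun t x => theta (alphak t (theta' x))].

End TensorPower.
Arguments tensor_op {R L k} P x.
Arguments tensor_algebra {R L} M {k} P.

Section CAR.
Context {R : realType}.

(* The antisymmetric Fock space, normalised by
   <f_1 /\ .. /\ f_n, g_1 /\ .. /\ g_n> = det <f_i, g_j>;
   the empty wedge is the vacuum vector. *)
Record fock (H : hilbert R) := Fock {
  fock_space :> hilbert R;
  wedge : seq H -> fock_space;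
  wedgeE : forall f g, inner _ (wedge f) (wedge g) =
    if size f == size g
    then \det (\matrix_(i < size f, j < size f) inner H f`_i g`_j)
    else 0;
  wedge_total : dense (lin_span (range wedge)) }.

Definition creation (H : hilbert R) (F : fock H) (f : H) : F -> F :=
  get [set X | bounded F X /\ forall s, X (wedge F s) = wedge F (f :: s)].
Arguments creation {H} F f.

Definition CAR_algebra (H : hilbert R) (F : fock H) : set (F -> F) :=
  smallest (@Cstar_algebra R F) (range (creation F)).
Arguments CAR_algebra {H} F.

Definition state (F : hilbert R) (A : set (F -> F)) (w : (F -> F) -> R[i]) :=
  [/\ forall a x y, A x -> A y -> w (a *: x + y) = a * w x + w y,
      forall x, A x -> 0 <= w (adj x \o x)
    & w idfun = 1].

Definition opprod (F : hilbert R) (s : seq (F -> F)) : F -> F :=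
  foldr (fun x y => x \o y) idfun s.

Definition quasi_free (H : hilbert R) (F : fock H) (T : H -> H)
    (w : (F -> F) -> R[i]) :=
  state (CAR_algebra F) w /\
  forall f g : seq H,
    w (opprod ([seq adj (creation F v) | v <- rev f]
               ++ [seq creation F v | v <- g])) =
    if size f == size g
    then \det (\matrix_(i < size f, j < size f) inner H g`_i (T f`_j))
    else 0.

Definition GNS (F L : hilbert R) (A : set (F -> F)) (w : (F -> F) -> R[i])
    (pi : (F -> F) -> (L -> L)) (Omega : L) :=
  [/\ star_hom A (bounded L) pi,
      dense [set pi x Omega | x in A]
    & forall x, A x -> inner L (pi x Omega) Omega = w x].

End CAR.
Arguments creation {R H} F f.
Arguments CAR_algebra {R H} F.

Section L2.
Context {R : realType}.

Definition half_line : set R := `]0, +oo[.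

Definition square_integrable (f : R -> R[i]) :=
  [/\ measurable_fun half_line (fun s => complex.Re (f s)),
      measurable_fun half_line (fun s => complex.Im (f s))
    & (@lebesgue_measure R).-integrable half_line
        (fun s => (complex.Re `|f s| ^+ 2)%:E)].

Definition cintegral (f : R -> R[i]) : R[i] :=
  (Rintegral (@lebesgue_measure R) half_line (fun s => complex.Re (f s))) +i*
  (Rintegral (@lebesgue_measure R) half_line (fun s => complex.Im (f s))).

(* The Hilbert space tensor product of L^2(0,oo) and K, as a Hilbert space with
   elementary tensors; the square-integrable functions stand for their classes
   modulo equality almost everywhere, and bilinearity and independence of
   representatives follow from the inner product. *)
Record L2_tensor (K : hilbert R) := L2Tensor {
  L2_space :> hilbert R;
  tens : (R -> R[i]) -> K -> L2_space;
  tensE : forall f g x y, square_integrable f -> square_integrable g ->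
    inner _ (tens f x) (tens g y) =
    cintegral (fun s => f s * (g s)^*) * inner K x y;
  tens_total : dense (lin_span
    [set tens f x | f in square_integrable & x in [set: K]]) }.

Definition shift_fun (t : R) (f : R -> R[i]) : R -> R[i] :=
  fun s => if s < t then 0 else f (s - t).

Definition shift_op (K : hilbert R) (H : L2_tensor K) (t : R) : H -> H :=
  get [set S | bounded H S /\ forall f x, square_integrable f ->
    S (tens H f x) = tens H (shift_fun t f) x].
Arguments shift_op {K} H t.

Definition CAR_flow (K : hilbert R) (H : L2_tensor K) (F : fock H)
    (L : hilbert R) (pi : (F -> F) -> (L -> L)) (M : set (L -> L))
    (alpha : R -> (L -> L) -> (L -> L)) :=
  E0_semigroup M alpha /\
  forall (t : R) f, 0 <= t ->
    alpha t (pi (creation F f)) = pi (creation F (shift_op H t f)).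

End L2.
Arguments shift_op {R K} H t.

(* Main.v *)
(* Only time t = 1 is used.  Write M for the k-th tensor power of M_R, generated by k commuting
   species a_1, ..., a_k of fermions, and B for the image of M under the flow.  The relative
   commutant N = B' /\ M is fixed by the gradings that change the sign of the letters a_i(f) with f
   in the cokernel of the shift S: the a_i(e_n), for an orthonormal sequence e_n in that cokernel,
   graded-commute asymptotically with every x in M, which makes x in N even in each species, and
   the KMS condition then shows that the vector x Omega has no component along words in the range
   of S of odd parity.  The same two tools
   show that N has trivial centre, so a unitary w of M that normalises B is homogeneous: the i-th
   grading multiplies it by a sign d_i(w).  If all these signs are 1, some nonzero y in B satisfies
   y b = w b w^* y for all b in B.  With f a unit vector in the cokernel of S, the unitaries
   a_i(f) + a_i(f)^* and their products realise all 2^k degrees.  An isomorphism onto the l-th tensor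
   power with l < k would send two of these products, u and v, with different degrees to the same
   degree, so such a y exists for w = u^* v.  But w^* y lies in N, hence is even in every species,
   while y is even and w is odd in some species: a contradiction. *)
Require Import Defs.
From HB Require Import structures.
From mathcomp Require Import all_boot all_order all_algebra.
From mathcomp Require Import sesquilinear.
From mathcomp Require Import complex.
From mathcomp Require Import all_classical all_reals all_analysis.
From mathcomp Require Import measurable_realfun.
From mathcomp Require Import ring lra zify.

Set Implicit Arguments.
Unset Strict Implicit.
Unset Printing Implicit Defensive.

Import Order.TTheory GRing.Theory Num.Theory.
Import numFieldNormedType.Exports.
Import Normc.

Local Open Scope classical_set_scope.
Local Open Scope ring_scope.

Local Notation "''[' x , y ]" := (inner _ x y) : ring_scope.

(** * Hilbert space preliminaries *)

(** Each tensor power is treated as one system of species that anticommute internally and commute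
    with one another, so the same statements serve both powers. Invertibility of [T] and [1 - T]
    makes right multiplication by a letter a bounded operator in the commutant; hence [Om] is
    separating, and the KMS identity on words takes the place of modular theory. The invariance
    hypotheses make [T] commute with the shift, so the shift can be second quantised, and so can the
    signs attached to its range or its cokernel. The obstacle is that the degrees on the two sides
    of an isomorphism come from unrelated gradings, and that the isomorphism is only known to match
    the two image algebras, not to intertwine the flows. This is why unitaries whose images have
    equal degree are compared through an intertwiner inside the image algebra: such an element can
    be carried back. The cocycle enters through its unitary at time 1, which is absorbed into the
    isomorphism. *)

Section Inner.
Context {R : realType}.
Implicit Types H : hilbert R.
Local Open Scope complex_scope.

Definition nrm H (x : H) : R := complex.Re `|x|.

Lemma ipDl H (x y z : H) : '[x + y, z] = '[x, z] + '[y, z].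
Proof. exact: linearDl. Qed.
Lemma ipDr H (x y z : H) : '[x, y + z] = '[x, y] + '[x, z].
Proof. exact: linearDr. Qed.
Lemma ipNl H (x z : H) : '[- x, z] = - '[x, z].
Proof. exact: linearNl. Qed.
Lemma ipNr H (x z : H) : '[x, - z] = - '[x, z].
Proof. exact: linearNr. Qed.
Lemma ipBl H (x y z : H) : '[x - y, z] = '[x, z] - '[y, z].
Proof. exact: linearBl. Qed.
Lemma ipBr H (x y z : H) : '[x, y - z] = '[x, y] - '[x, z].
Proof. exact: linearBr. Qed.
Lemma ip0l H (z : H) : '[0, z] = 0.
Proof. exact: linear0l. Qed.
Lemma ip0r H (z : H) : '[z, 0] = 0.
Proof. exact: linear0r. Qed.
Lemma ipZl H a (x y : H) : '[a *: x, y] = a * '[x, y].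
Proof. exact: linearZl_LR. Qed.
Lemma ipZr H a (x y : H) : '[x, a *: y] = conjc a * '[x, y].
Proof. exact: linearZr_LR. Qed.
Lemma ipC H (x y : H) : '[x, y] = conjc '[y, x].
Proof. by rewrite (@hermC _ _ _ _ (inner H)) expr0 mul1r. Qed.
Lemma ip_suml H I r (P : pred I) (F : I -> H) y :
  '[\sum_(i <- r | P i) F i, y] = \sum_(i <- r | P i) '[F i, y].
Proof. exact: linear_sumlz. Qed.
Lemma ip_sumr H I r (P : pred I) (F : I -> H) y :
  '[y, \sum_(i <- r | P i) F i] = \sum_(i <- r | P i) '[y, F i].
Proof. exact: linear_sumr. Qed.

Lemma nrmE H (x : H) : `|x| = (nrm x)%:C.
Proof. by rewrite /nrm RRe_real // ger0_real. Qed.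

Lemma nrm_ge0 H (x : H) : 0 <= nrm x.
Proof. by rewrite -ler0c -nrmE. Qed.
Hint Extern 0 (is_true (0 <= nrm _)) => solve [apply: nrm_ge0] : core.

Lemma ipxx H (x : H) : '[x, x] = (nrm x ^+ 2)%:C.
Proof. by rewrite innerE nrmE -rmorphXn. Qed.

Lemma Re_ipxx H (x : H) : complex.Re '[x, x] = nrm x ^+ 2.
Proof. by rewrite ipxx. Qed.

Lemma nrm0 H : nrm (0 : H) = 0.
Proof. by rewrite /nrm normr0. Qed.

Lemma nrm_eq0 H (x : H) : nrm x = 0 -> x = 0.
Proof. by move=> h; apply/normr0_eq0; rewrite nrmE h. Qed.

Lemma nrmD H (x y : H) : nrm (x + y) <= nrm x + nrm y.
Proof. by rewrite -lecR rmorphD /= -!nrmE ler_normD. Qed.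

Lemma nrmN H (x : H) : nrm (- x) = nrm x.
Proof. by rewrite /nrm normrN. Qed.

Lemma nrmBC H (x y : H) : nrm (x - y) = nrm (y - x).
Proof. by rewrite -nrmN opprB. Qed.

Lemma nrmZ H a (x : H) : nrm (a *: x) = normc a * nrm x.
Proof.
by apply: complexI; rewrite -nrmE normrZ nrmE normc_def; case: a => a b; rewrite -rmorphM.
Qed.

Lemma nrm_triB H (x y z : H) : nrm (x - z) <= nrm (x - y) + nrm (y - z).
Proof. by apply: le_trans (nrmD _ _); rewrite addrA subrK. Qed.

Lemma nrm_sum H I r (P : pred I) (F : I -> H) :
  nrm (\sum_(i <- r | P i) F i) <= \sum_(i <- r | P i) nrm (F i).
Proof.
elim/big_rec2: _ => [|i y x _ h]; first by rewrite nrm0.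
by apply: le_trans (nrmD _ _) _; rewrite lerD2l.
Qed.

Lemma normc_ge0 (a : R[i]) : 0 <= normc a.
Proof. by case: a => a b; apply: sqrtr_ge0. Qed.
Hint Extern 0 (is_true (0 <= normc _)) => solve [apply: normc_ge0] : core.

Lemma normcR (a : R) : normc a%:C = `|a|.
Proof. by rewrite /normc /= expr0n addr0 sqrtr_sqr. Qed.

Lemma normcJr (a : R[i]) : normc (conjc a) = normc a.
Proof. by case: a => a b; rewrite /= sqrrN. Qed.

Lemma mulcJr (a : R[i]) : a * conjc a = (normc a ^+ 2)%:C.
Proof. by rewrite -sqr_normc normc_def rmorphXn /=; case: a. Qed.

Lemma Re_le_normc (a : R[i]) : complex.Re a <= normc a.
Proof.
by case: a => a b; rewrite /= (le_trans (ler_norm _)) // -sqrtr_sqr ler_wsqrtr // lerDl sqr_ge0.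
Qed.

Lemma nrmD_sq H (x y : H) :
  nrm (x + y) ^+ 2 = nrm x ^+ 2 + nrm y ^+ 2 + 2 * complex.Re '[x, y].
Proof.
rewrite -!Re_ipxx ipDl !ipDr [ '[y, x] ]ipC.
by case: '[x, x] '[y, y] '[x, y] => [a b] [c d] [e f] /=; ring.
Qed.

Lemma nrmB_sq H (x y : H) :
  nrm (x - y) ^+ 2 = nrm x ^+ 2 + nrm y ^+ 2 - 2 * complex.Re '[x, y].
Proof. by rewrite nrmD_sq nrmN ipNr; case: '[x, y] => a b /=; ring. Qed.

Lemma parallelogram H (x y : H) :
  nrm (x + y) ^+ 2 + nrm (x - y) ^+ 2 = 2 * nrm x ^+ 2 + 2 * nrm y ^+ 2.
Proof. by rewrite nrmB_sq nrmD_sq; ring. Qed.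

Lemma cauchy_schwarz H (x y : H) : normc '[x, y] <= nrm x * nrm y.
Proof.
have [->|y0] := eqVneq y 0; first by rewrite ip0r nrm0 mulr0 normc0.
have ny : 0 < nrm y.
  rewrite lt_neqAle nrm_ge0 andbT eq_sym; apply/eqP => /nrm_eq0 h.
  by rewrite h eqxx in y0.
pose r := nrm y ^- 2.
have := sqr_ge0 (nrm (x - ('[x, y] * r%:C) *: y)).
rewrite nrmB_sq nrmZ ipZr normcM normcR.
have -> : complex.Re (conjc ('[x, y] * r%:C) * '[x, y]) = normc '[x, y] ^+ 2 * r.
  case: '[x, y] => c d; rewrite /= sqr_sqrtr ?addr_ge0 ?sqr_ge0 //.
  ring.
rewrite /r.
rewrite ger0_norm ?invr_ge0 ?exprn_ge0 // !exprMn.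
set n := normc _; set m := nrm y => h.
have n0 : 0 <= n := normc_ge0 _.
have h2 : n ^+ 2 <= (nrm x * m) ^+ 2.
  have : 0 <= (nrm x ^+ 2 + n ^+ 2 * (m ^- 2) ^+ 2 * m ^+ 2 - 2 * (n ^+ 2 * m ^- 2)) * m ^+ 2.
    by rewrite mulr_ge0 // sqr_ge0.
  have -> : (nrm x ^+ 2 + n ^+ 2 * (m ^- 2) ^+ 2 * m ^+ 2 - 2 * (n ^+ 2 * m ^- 2)) * m ^+ 2
    = (nrm x * m) ^+ 2 - n ^+ 2.
    by field; move: ny; rewrite -/m lt0r => /andP[].
  by rewrite subr_ge0.
by rewrite -(@ler_pXn2r _ 2) ?nnegrE ?mulr_ge0 ?nrm_ge0.
Qed.

Lemma ip_eq0 H (x : H) : (forall y, '[x, y] = 0) -> x = 0.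
Proof.
by move=> h; apply: nrm_eq0; apply/eqP; rewrite -sqrf_eq0 -Re_ipxx h.
Qed.

Lemma ip_inj H (x y : H) : (forall z, '[x, z] = '[y, z]) -> x = y.
Proof.
by move=> h; apply/eqP; rewrite -subr_eq0; apply/eqP/ip_eq0 => z; rewrite ipBl h subrr.
Qed.

End Inner.
#[export] Hint Extern 0 (is_true (0 <= nrm _)) => solve [apply: nrm_ge0] : core.
#[export] Hint Extern 0 (is_true (0 <= normc _)) => solve [apply: normc_ge0] : core.

(** * Bounded operators, total families and limits *)

Section Limits.
Context {R : realType}.
Implicit Types H : hilbert R.

Definition tends H (u : nat -> H) (l : H) :=
  forall e : R, 0 < e -> exists N, forall n, (N <= n)%N -> nrm (u n - l) < e.

(** Boundedness by a constant is the working notion: it makes sense between different spaces and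
    composes with explicit estimates. [bounded_bdd] links it to continuity. *)
Definition bdd H1 H2 (T : H1 -> H2) :=
  linear T /\ exists2 C : R, 0 <= C & forall x, nrm (T x) <= C * nrm x.

Definition closed_sub H (Q : set H) :=
  [/\ Q 0, forall a x y, Q x -> Q y -> Q (a *: x + y)
    & forall x, (forall e : R, 0 < e -> exists2 y, Q y & nrm (x - y) < e) -> Q x].

(** Combinations are indexed by lists of pairs, so repetitions are harmless and addition is
    concatenation. *)
Definition lsum H I (E : I -> H) (l : seq (R[i] * I)) := \sum_(p <- l) p.1 *: E p.2.

Definition total_fam H I (E : I -> H) :=
  forall x (e : R), 0 < e -> exists l, nrm (x - lsum E l) < e.

Lemma complex_gt0 (e : R[i]) : 0 < e -> exists2 d : R, 0 < d & e = (real_complex R d).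
Proof.
case: e => a b; rewrite ltcE /= => /andP[/eqP -> h]; by exists a.
Qed.

Lemma nrm_lt H (x : H) (e : R) : (`|x| < real_complex R e) = (nrm x < e).
Proof. by rewrite nrmE ltcR. Qed.

Lemma tends_cvg H (u : nat -> H) l : u @ \oo --> l -> tends u l.
Proof.
move=> /cvgrPdist_lt h e e0.
have e0' : 0 < real_complex R e by rewrite ltcR.
have [N _ hN] := h _ e0'.
by exists N => n nN; rewrite nrmBC -nrm_lt; apply: hN.
Qed.

Lemma complete H (u : nat -> H) :
  (forall e : R, 0 < e -> exists N, forall n m, (N <= n)%N -> (N <= m)%N ->
     nrm (u n - u m) < e) -> exists l, tends u l.
Proof.
move=> h; have cu : cauchy (u @ \oo).
  apply: cauchy_exP => e /complex_gt0[d d0 ->].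
  have [N hN] := h _ d0; exists (u N); exists N => // n /= nN.
  by rewrite -ball_normE /ball_ /= nrm_lt; apply: hN.
have /cvg_ex[l ul] : cvg (u @ \oo); first exact: (cauchy_cvg (u @ \oo)) cu.
by exists l; apply: tends_cvg.
Qed.

(** Limiting arguments repeatedly end here; [K] may have any sign, so it is enough that an estimate
    be linear in [e]. *)
Lemma le0_eps (x K : R) : (forall e, 0 < e -> x <= K * e) -> x <= 0.
Proof.
move=> h; rewrite leNgt; apply/negP => x0.
have K1 : 0 < `|K| + 1 by rewrite ltr_wpDl.
have := h (x / (`|K| + 1) / 2) _; rewrite !divr_gt0 // => /(_ isT).
apply/negP; rewrite -ltNge.
have h1 : K * (x / (`|K| + 1) / 2) <= (`|K| + 1) * (x / (`|K| + 1) / 2).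
  by rewrite ler_wpM2r ?divr_ge0 ?(ltW x0) ?(ltW K1) // (le_trans (ler_norm K)) // lerDl.
apply: le_lt_trans h1 _.
have -> : (`|K| + 1) * (x / (`|K| + 1) / 2) = x / 2 by field; rewrite gt_eqF.
lra.
Qed.

Lemma nrm_eps H (x : H) K : (forall e, 0 < e -> nrm x <= K * e) -> x = 0.
Proof.
by move=> h; apply: nrm_eq0; apply/eqP; rewrite eq_le nrm_ge0 andbT; exact: le0_eps h.
Qed.

Lemma bdd_lin H1 H2 (T : H1 -> H2) a x y : bdd T -> T (a *: x + y) = a *: T x + T y.
Proof. by case=> h _; exact: h. Qed.
Lemma bdd0 H1 H2 (T : H1 -> H2) : bdd T -> T 0 = 0.
Proof. by move=> hT; have := bdd_lin (-1) 0 0 hT; rewrite !scaleN1r addr0 oppr0 => ->; rewrite addNr. Qed.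
Lemma bddD H1 H2 (T : H1 -> H2) x y : bdd T -> T (x + y) = T x + T y.
Proof. by move=> hT; have := bdd_lin 1 x y hT; rewrite !scale1r. Qed.
Lemma bddZ H1 H2 (T : H1 -> H2) a x : bdd T -> T (a *: x) = a *: T x.
Proof. by move=> hT; have := bdd_lin a x 0 hT; rewrite (bdd0 hT) !addr0. Qed.
Lemma bddN H1 H2 (T : H1 -> H2) x : bdd T -> T (- x) = - T x.
Proof. by move=> hT; rewrite -scaleN1r bddZ // scaleN1r. Qed.
Lemma bddB H1 H2 (T : H1 -> H2) x y : bdd T -> T (x - y) = T x - T y.
Proof. by move=> hT; rewrite bddD // bddN. Qed.
Lemma bdd_lsum H1 H2 (T : H1 -> H2) I (E : I -> H1) l : bdd T ->
  T (lsum E l) = lsum (T \o E) l.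
Proof.
move=> hT; rewrite /lsum; elim: l => [|p l ih]; first by rewrite !big_nil bdd0.
by rewrite !big_cons bdd_lin // ih.
Qed.
Lemma bdd_sum H1 H2 (T : H1 -> H2) I r (P : pred I) (F : I -> H1) : bdd T ->
  T (\sum_(i <- r | P i) F i) = \sum_(i <- r | P i) T (F i).
Proof.
move=> hT; elim: r => [|p l ih]; first by rewrite !big_nil bdd0.
by rewrite !big_cons; case: ifP => // _; rewrite bddD // ih.
Qed.

Lemma bdd_id H : bdd (@idfun H).
Proof. by split=> //; exists 1 => // x; rewrite mul1r. Qed.

Lemma bdd_zero H1 H2 : bdd (fun _ : H1 => 0 : H2).
Proof.
split=> [c x y|]; first by rewrite scaler0 addr0.
by exists 0 => // x; rewrite nrm0 mul0r.
Qed.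

Lemma bdd_comp H1 H2 H3 (T : H2 -> H3) (S : H1 -> H2) : bdd T -> bdd S -> bdd (T \o S).
Proof.
move=> [lT [C C0 hC]] [lS [D D0 hD]]; split=> [a x y|] /=; first by rewrite lS lT.
exists (C * D); first by rewrite mulr_ge0.
by move=> x; rewrite -mulrA; apply: le_trans (hC _) _; rewrite ler_wpM2l.
Qed.

Lemma bdd_add H1 H2 (T S : H1 -> H2) a : bdd T -> bdd S -> bdd (a *: T + S).
Proof.
move=> [lT [C C0 hC]] [lS [D D0 hD]]; split=> [b x y|].
  change (a *: T (b *: x + y) + S (b *: x + y) =
    b *: (a *: T x + S x) + (a *: T y + S y)).
  by rewrite lT lS !scalerDr !scalerA mulrC addrACA.
exists (normc a * C + D); first by rewrite addr_ge0 ?mulr_ge0.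
move=> x; change (nrm (a *: T x + S x) <= (normc a * C + D) * nrm x).
by apply: le_trans (nrmD _ _) _; rewrite mulrDl lerD // nrmZ -mulrA ler_wpM2l.
Qed.

Lemma bdd_near H1 H2 (T : H1 -> H2) : bdd T -> exists2 C, 0 < C &
  forall x y, nrm (T x - T y) <= C * nrm (x - y).
Proof.
move=> hT; case: (hT) => _ [C C0 hC]; exists (C + 1); first by rewrite ltr_wpDl.
move=> x y; rewrite -bddB //; apply: le_trans (hC _) _.
by rewrite ler_wpM2r // lerDl.
Qed.

Lemma bounded_bdd H (T : H -> H) : bounded H T <-> bdd T.
Proof.
split=> [[lT cT]|hT].
  split=> //.
  have T0 : T 0 = 0 by have := lT (-1) 0 0; rewrite !scaleN1r addr0 oppr0 => ->; rewrite addNr.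
  have TZ a x : T (a *: x) = a *: T x by have := lT a x 0; rewrite T0 !addr0.
  have /cvgrPdist_lt := cT 0; rewrite T0 => /(_ 1 ltr01) /nbhs_ballP[e /= /complex_gt0[d d0 ->]] hd.
  have hd' x : nrm x < d -> nrm (T x) < 1.
    move=> xd; have := hd x; rewrite -ball_normE /ball_ /= !sub0r !normrN nrm_lt => /(_ xd).
    by rewrite -[1]/(real_complex R 1) nrm_lt.
  (* Continuity at 0 maps the ball of radius [d] into the unit ball; a nonzero vector is scaled to
     norm [d / 2], which lies inside. *)
  exists (2 / d) => [|x]; first by rewrite divr_ge0 // ltW.
  have [->|x0] := eqVneq x 0; first by rewrite T0 !nrm0 mulr0.
  have nx : 0 < nrm x.
    rewrite lt_neqAle nrm_ge0 andbT eq_sym; apply/eqP => /nrm_eq0 h.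
    by rewrite h eqxx in x0.
  pose c := real_complex R (d / 2 / nrm x).
  have hc : normc c = d / 2 / nrm x by rewrite normcR ger0_norm // !divr_ge0 // ltW.
  have := hd' (c *: x); rewrite TZ !nrmZ hc divfK ?gt_eqF // => /(_ _)/ltW h.
  have {}h : d / 2 / nrm x * nrm (T x) <= 1 by apply: h; lra.
  have -> : nrm (T x) = (2 / d * nrm x) * (d / 2 / nrm x * nrm (T x)).
    by field; rewrite !gt_eqF.
  by rewrite ler_piMr // !mulr_ge0 // ?invr_ge0 ltW.
split; first by case: hT.
have [C C0 hC] := bdd_near hT.
move=> x; apply/cvgrPdist_lt => e /complex_gt0[d d0 ->].
have dC : 0 < d / C by rewrite divr_gt0.
apply/nbhs_ballP; exists (real_complex R (d / C)) => /=; first by rewrite ltcR.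
move=> y; rewrite -ball_normE /ball_ /= !nrm_lt => xy.
apply: le_lt_trans (hC _ _) _; by rewrite mulrC -ltr_pdivlMr.
Qed.

Lemma totalP H I (E : I -> H) : dense (lin_span (range E)) <-> total_fam E.
Proof.
split=> [dE x e e0|tE O [x Ox] oO].
  have [||y /= [xy [n [a [u [hu yE]]]]]] := dE (ball x (real_complex R e)).
  - by exists x; apply: ballxx; rewrite ltcR.
  - by apply: ball_open; rewrite ltcR.
  have /choice[s hs] : forall i, exists s, u i = E s.
    by move=> i; have [s _ <-] := hu i; exists s.
  exists [seq (a i, s i) | i <- enum 'I_n].
  rewrite /lsum big_map big_enum /=; move: xy; rewrite yE -ball_normE /ball_ /= nrm_lt.
  by under eq_bigr do rewrite hs.
have /nbhs_ballP[e /= /complex_gt0[d d0 ->] hd] : nbhs x O by apply: open_nbhs_nbhs.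
have [l hl] := tE x d d0.
exists (lsum E l); split; first by apply: hd; rewrite -ball_normE /ball_ /= nrm_lt.
exists (size l), (fun i => (tnth (in_tuple l) i).1), (fun i => E (tnth (in_tuple l) i).2).
by split=> [i|]; [exists (tnth (in_tuple l) i).2 | rewrite /lsum big_tnth].
Qed.

Lemma closed_lsum H I (E : I -> H) Q : closed_sub Q -> (forall s, Q (E s)) ->
  forall l, Q (lsum E l).
Proof.
move=> [Q0 QD _] QE; elim=> [|p l ih]; rewrite /lsum ?big_nil // big_cons.
exact: QD.
Qed.

(** The pattern of the density arguments: linearity and continuity are packed into [closed_sub Q],
    so that only the family itself has to be examined. *)
Lemma total_ind H I (E : I -> H) Q : total_fam E -> closed_sub Q -> (forall s, Q (E s)) ->
  forall x, Q x.
Proof.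
move=> tE cQ QE x; case: (cQ) => _ _; apply => e e0.
have [l hl] := tE x e e0; exists (lsum E l) => //; exact: closed_lsum.
Qed.

Lemma closed_eq H1 H2 (T S : H1 -> H2) : bdd T -> bdd S -> closed_sub [set x | T x = S x].
Proof.
move=> hT hS; split=> [|a x y /= h1 h2|x h] /=; first by rewrite !bdd0.
  by rewrite !bdd_lin // h1 h2.
have [C C0 hC] := bdd_near hT; have [D D0 hD] := bdd_near hS.
apply/eqP; rewrite -subr_eq0; apply/eqP/(@nrm_eps _ _ (C + D)) => e e0.
have [y /= hy xy] := h e e0.
apply: le_trans (nrm_triB _ (T y) _) _; rewrite mulrDl lerD //.
  by apply: le_trans (hC _ _) _; rewrite ler_wpM2l // ltW.
by rewrite hy; apply: le_trans (hD _ _) _; rewrite ler_wpM2l // ?ltW // nrmBC.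
Qed.

Lemma total_eq H1 H2 I (E : I -> H1) (T S : H1 -> H2) : total_fam E -> bdd T -> bdd S ->
  (forall s, T (E s) = S (E s)) -> T = S.
Proof.
move=> tE hT hS h; apply/funext; exact: (total_ind tE (closed_eq hT hS)).
Qed.

Lemma closed_ortho H (y : H) : closed_sub [set x | '[x, y] = 0].
Proof.
split=> [|a x z /= h1 h2|x h] /=; first exact: ip0l.
  by rewrite ipDl ipZl h1 h2 mulr0 addr0.
apply: eq0_normc; apply/eqP; rewrite eq_le normc_ge0 andbT.
apply: (@le0_eps _ (nrm y)) => e e0; have [z /= hz xz] := h e e0.
rewrite -[x](subrK z) ipDl hz addr0.
by apply: le_trans (cauchy_schwarz _ _) _; rewrite mulrC ler_wpM2l // ltW.
Qed.

Lemma total_ip0 H I (E : I -> H) y : total_fam E -> (forall s, '[E s, y] = 0) -> y = 0.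
Proof.
move=> tE h; apply: ip_eq0 => z; rewrite ipC.
by rewrite (total_ind tE (closed_ortho y) h z) rmorph0.
Qed.

Lemma total_ip H I (E : I -> H) y z : total_fam E ->
  (forall s, '[E s, y] = '[E s, z]) -> y = z.
Proof.
move=> tE h; apply/eqP; rewrite -subr_eq0; apply/eqP/(total_ip0 tE) => s.
by rewrite ipBr h subrr.
Qed.

End Limits.

(** * Orthogonal projection, adjoints and extension from a total family *)

Section Projection.
Context {R : realType}.
Implicit Types H : hilbert R.

Lemma closed_scale H (Q : set H) a x : closed_sub Q -> Q x -> Q (a *: x).
Proof. by move=> [Q0 QD _] Qx; rewrite -[_ *: _]addr0; apply: QD. Qed.

Lemma closed_add H (Q : set H) x y : closed_sub Q -> Q x -> Q y -> Q (x + y).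
Proof. by move=> [Q0 QD _] Qx Qy; rewrite -[x]scale1r; apply: QD. Qed.

Lemma closed_opp H (Q : set H) x : closed_sub Q -> Q x -> Q (- x).
Proof. by move=> cQ Qx; rewrite -scaleN1r; apply: closed_scale. Qed.

Lemma closed_tends H (Q : set H) u l : closed_sub Q -> (forall n, Q (u n)) -> tends u l -> Q l.
Proof.
move=> [_ _ Qc] Qu ul; apply: Qc => e e0; have [N hN] := ul e e0.
by exists (u N); rewrite // nrmBC hN.
Qed.

Lemma small_seq (e : R) : 0 < e -> exists N, forall n, (N <= n)%N -> n.+1%:R^-1 < e.
Proof.
move=> e0; have hN := archi_boundP (ltW (divr_gt0 ltr01 e0)).
set N := Num.bound _ in hN.
exists N => n nN; rewrite invf_plt ?posrE // -div1r.
by apply: lt_le_trans hN _; rewrite ler_nat (leq_trans nN).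
Qed.

Lemma projection H (Q : set H) x : closed_sub Q ->
  exists2 p, Q p & forall g, Q g -> '[x - p, g] = 0.
Proof.
move=> cQ; case: (cQ) => Q0 QD _.
pose E := [set r : R | exists2 y, Q y & r = nrm (x - y) ^+ 2].
have E0 : E !=set0 by exists (nrm (x - 0) ^+ 2), 0.
have lE : has_lbound E by exists 0 => _ [y _ ->]; apply: sqr_ge0.
pose d := inf E.
have dle y : Q y -> d <= nrm (x - y) ^+ 2 by move=> Qy; apply: ge_inf => //; exists y.
have /choice[u hu] : forall n : nat, exists y, Q y /\ nrm (x - y) ^+ 2 < d + n.+1%:R^-1.
  move=> n; have n0 : 0 < n.+1%:R^-1 :> R by rewrite invr_gt0.
  by have [_ [y Qy ->] hy] := inf_adherent n0 (conj E0 lE); exists y.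
have Qu n : Q (u n) by case: (hu n).
have hd n : nrm (x - u n) ^+ 2 < d + n.+1%:R^-1 by case: (hu n).
(* Parallelogram law for [x - u n] and [x - u m]: the midpoint of [u n] and [u m] lies in [Q], so
   its squared distance to [x] is at least [d]. Hence a minimising sequence is Cauchy. *)
have key n m : nrm (u n - u m) ^+ 2 <= 2 * n.+1%:R^-1 + 2 * m.+1%:R^-1.
  have := parallelogram (x - u n) (x - u m).
  have -> : x - u n - (x - u m) = u m - u n by rewrite opprB addrC addrA subrK.
  have -> : x - u n + (x - u m) = (real_complex R 2) *: (x - (real_complex R 2^-1) *: (u n + u m)).
    rewrite scalerBr scalerA -rmorphM /= divff // scale1r.
    by rewrite rmorph_nat scaler_nat mulr2n addrACA -opprD.
  rewrite nrmZ normcR exprMn nrmBC [in X in X -> _]ger0_norm //.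
  have := dle _ (closed_scale (real_complex R 2^-1) cQ (closed_add cQ (Qu n) (Qu m))).
  have := hd n; have := hd m.
  set A := nrm _ ^+ 2; set B := nrm _ ^+ 2; set C := nrm _ ^+ 2; set D := nrm _ ^+ 2.
  set p := n.+1%:R^-1; set q := m.+1%:R^-1.
  move: p q A B C D => p q A B C D; rewrite !exprS expr0; lra.
have [p up] : exists p, tends u p.
  apply: complete => e e0.
  have e2 : 0 < e ^+ 2 / 4 by rewrite divr_gt0 // exprn_gt0.
  have [N hN] := small_seq e2; exists N => n m nN mN.
  rewrite -(@ltr_pXn2r _ 2) ?nnegrE ?(ltW e0) //.
  apply: le_lt_trans (key n m) _.
  have -> : e ^+ 2 = 2 * (e ^+ 2 / 4) + 2 * (e ^+ 2 / 4) by field.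
  by apply: ltrD; rewrite ltr_pM2l //; [exact: hN nN | exact: hN mN].
have Qp : Q p by apply: closed_tends up.
have dp : nrm (x - p) ^+ 2 <= d.
  rewrite -subr_le0; apply: (@le0_eps _ _ (2 * nrm (x - p) + 1)) => e e0.
  have [N hN] := up e e0; have [N' hN'] := small_seq e0.
  have a := hN (maxn N N') (leq_maxl _ _); have b := hN' (maxn N N') (leq_maxr _ _).
  have c := hd (maxn N N').
  have t := nrm_triB x (u (maxn N N')) p.
  have t2 := nrm_ge0 (x - u (maxn N N')).
  have t3 := nrm_ge0 (x - p).
  move: a b c t t2 t3; set A := nrm _; set B := _^-1; set C := nrm _; set D := nrm _.
  move=> a b c t t2 t3.
  have [h|h] := lerP C D; first by nra.
  nra.
exists p => // g Qg.
set z := x - p; set w := '[z, g].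
apply: eq0_normc; apply/eqP; rewrite -sqrf_eq0 eq_le sqr_ge0 andbT.
apply: (@le0_eps _ _ (normc w ^+ 2 * nrm g ^+ 2)) => t t0.
(* First variation: moving [p] inside [Q] by [w * t] times [g] cannot bring it closer to [x];
   division by [t] bounds [2 |w|^2] by [t |w|^2 |g|^2]. *)
have := dle _ (closed_add cQ Qp (closed_scale (w * real_complex R t) cQ Qg)).
rewrite opprD addrA -/z nrmB_sq nrmZ ipZr -/w normcM normcR (ger0_norm (ltW t0)).
have -> : complex.Re (conjc (w * real_complex R t) * w) = t * normc w ^+ 2.
  have -> : conjc (w * real_complex R t) * w = real_complex R t * (w * conjc w).
    by rewrite rmorphM [X in _ * X * _]conjc_real; ring.
  by rewrite mulcJr -rmorphM.
rewrite !exprMn; move: dp; rewrite -/z; move: (sqr_ge0 (normc w)).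
set n := normc w ^+ 2; set m := nrm g ^+ 2; set a := nrm z ^+ 2 => n0 dp h.
have h2 : 0 <= t * (n * t * m - 2 * n).
  have -> : t * (n * t * m - 2 * n) = n * t ^+ 2 * m - 2 * (t * n) by ring.
  lra.
have : 0 <= n * t * m - 2 * n by rewrite -(pmulr_rge0 _ t0).
have -> : n * m * t = n * t * m by ring.
lra.
Qed.

Lemma riesz H (f : H -> R[i]) (C : R) : (forall a x y, f (a *: x + y) = a * f x + f y) ->
  (forall x, normc (f x) <= C * nrm x) -> exists y, forall x, f x = '[x, y].
Proof.
move=> fl fC.
have f0 : f 0 = 0 by have := fl (-1) 0 0; rewrite scaleN1r addr0 oppr0 mulN1r addNr.
have cQ : closed_sub [set x | f x = 0].
  split=> // [a x y /= h1 h2|x h /=]; first by rewrite fl h1 h2 mulr0 addr0.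
  apply: eq0_normc; apply/eqP; rewrite eq_le normc_ge0 andbT.
  apply: (@le0_eps _ _ `|C|) => e e0; have [y /= hy xy] := h e e0.
  have -> : f x = f (x - y).
    by rewrite addrC -scaleN1r fl hy mulr0 add0r.
  apply: le_trans (fC _) _; apply: le_trans (_ : `|C| * nrm (x - y) <= _).
    by rewrite ler_wpM2r // ler_norm.
  by rewrite ler_wpM2l // ltW.
have [h|/existsNP[x0 hx0]] := pselect (forall x, f x = 0).
  by exists 0 => x; rewrite ip0r.
have [p /= fp hp] := projection x0 cQ.
set z := x0 - p in hp.
have fz : f z = f x0 by rewrite /z addrC -scaleN1r fl fp mulr0 add0r.
have zz : '[z, z] != 0.
  apply/eqP => h; apply: hx0; rewrite -fz.
  by rewrite (_ : z = 0) //; apply: nrm_eq0; apply/eqP; rewrite -sqrf_eq0 -Re_ipxx h.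
exists (conjc (f z / '[z, z]) *: z) => x.
have fz0 : f z != 0 by rewrite fz; apply/eqP.
have : '[z, x - (f x / f z) *: z] = 0.
  by apply: hp => /=; rewrite addrC -scaleNr fl mulNr divfK // addNr.
rewrite ipC ipBl ipZl => /(congr1 conjc); rewrite conjcK rmorph0 => /eqP.
rewrite subr_eq0 => /eqP e.
by rewrite ipZr conjcK e mulrC; field; rewrite zz fz0.
Qed.

Lemma adjoint_exists H1 H2 (T : H1 -> H2) : bdd T ->
  exists2 S, bdd S & forall x y, '[T x, y] = '[x, S y].
Proof.
move=> hT; case: (hT) => _ [C C0 hC].
have /choice[S hS] : forall y, exists z, forall x, '[T x, y] = '[x, z].
  move=> y; apply: (@riesz _ (fun x => '[T x, y]) (C * nrm y)) => [a u v|x].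
    by rewrite bdd_lin // ipDl ipZl.
  apply: le_trans (cauchy_schwarz _ _) _.
  by rewrite -mulrA [nrm y * _]mulrC mulrA ler_wpM2r.
exists S => //; split=> [a x y|].
  by apply: ip_inj => z; rewrite [LHS]ipC -hS ipDr ipZr !hS [RHS]ipC ipDr ipZr.
exists C => // y.
have [->|Sy0] := eqVneq (S y) 0; first by rewrite nrm0 mulr_ge0.
have ny : 0 < nrm (S y).
  rewrite lt_neqAle nrm_ge0 andbT eq_sym; apply/eqP => /nrm_eq0 h.
  by rewrite h eqxx in Sy0.
rewrite -(ler_pM2l ny) -expr2 -Re_ipxx -hS.
apply: le_trans (Re_le_normc _) _; apply: le_trans (cauchy_schwarz _ _) _.
by rewrite mulrA [nrm (S y) * C]mulrC ler_wpM2r.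
Qed.

(** [adj] is a choice that carries no information until a candidate exists; Riesz representation
    supplies one. *)
Lemma adj_bdd_ip H (T : H -> H) : bdd T ->
  bdd (adj T) /\ forall x y, '[T x, y] = '[x, adj T y].
Proof.
move=> hT; have [S bS hS] := adjoint_exists hT.
have [] := @getPex _ [set S | bounded H S /\ forall x y, '[T x, y] = '[x, S y]] _.
  by exists S; exact: (conj (proj2 (bounded_bdd S) bS) hS).
by move=> b h; split=> //; exact: (proj1 (bounded_bdd _) b).
Qed.

Lemma adj_bdd H (T : H -> H) : bdd T -> bdd (adj T).
Proof. by move=> /adj_bdd_ip[]. Qed.

Lemma adjE H (T : H -> H) x y : bdd T -> '[T x, y] = '[x, adj T y].
Proof. by move=> /adj_bdd_ip[]. Qed.

Lemma adjEr H (T : H -> H) x y : bdd T -> '[x, T y] = '[adj T x, y].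
Proof. by move=> hT; rewrite ipC adjE // -ipC. Qed.

Lemma adj_uniq H (T S : H -> H) : bdd T -> (forall x y, '[T x, y] = '[x, S y]) -> adj T = S.
Proof.
move=> hT h; apply/funext => y; apply: ip_inj => x; rewrite ipC -adjE // h.
by rewrite -ipC.
Qed.

Lemma adjK H (T : H -> H) : bdd T -> adj (adj T) = T.
Proof.
by move=> hT; apply: adj_uniq => [|x y]; [exact: adj_bdd | rewrite adjEr].
Qed.

Lemma adj_comp H (T S : H -> H) : bdd T -> bdd S -> adj (T \o S) = adj S \o adj T.
Proof.
by move=> hT hS; apply: adj_uniq => [|x y /=]; [exact: bdd_comp | rewrite !adjE].
Qed.

Lemma adj_id H : adj (@idfun H) = idfun.
Proof. by apply: adj_uniq => //; apply: bdd_id. Qed.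

Lemma adj_add H (T S : H -> H) a : bdd T -> bdd S ->
  adj (a *: T + S) = conjc a *: adj T + adj S.
Proof.
move=> hT hS; apply: adj_uniq => [|x y]; first exact: bdd_add.
change ('[a *: T x + S x, y] = '[x, conjc a *: adj T y + adj S y]).
by rewrite ipDl ipDr ipZl ipZr conjcK !adjE.
Qed.

(** The bound also gives well-definedness: combinations of [E] with equal values have images at
    distance 0, so linear relations within the family do no harm. *)
Lemma extension H1 H2 I (E : I -> H1) (X : I -> H2) (C : R) : total_fam E ->
  (forall l, nrm (lsum X l) <= C * nrm (lsum E l)) ->
  exists2 T : H1 -> H2, bdd T & forall s, T (E s) = X s.
Proof.
move=> tE hC0.
wlog C0 : C {hC0} / exists2 D : R, 0 < D & forall l, nrm (lsum X l) <= D * nrm (lsum E l) => [h|].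
  apply: (h C); exists (`|C| + 1) => [|l]; first by rewrite ltr_wpDl.
  by apply: le_trans (hC0 l) _; rewrite ler_wpM2r // (le_trans (ler_norm _)) // lerDl.
move: C0 => {C} [C C0 hC].
pose sc (a : R[i]) := map (fun p : R[i] * I => (a * p.1, p.2)).
have lsumZ H (F : I -> H) a l : lsum F (sc a l) = a *: lsum F l.
  by rewrite /lsum big_map scaler_sumr; apply: eq_bigr => p _; rewrite scalerA.
have lsumD H (F : I -> H) l l' : lsum F (l ++ l') = lsum F l + lsum F l'.
  by rewrite /lsum big_cat.
have lsumB H (F : I -> H) l l' : lsum F (l ++ sc (-1) l') = lsum F l - lsum F l'.
  by rewrite lsumD lsumZ scaleN1r.
have hB l l' : nrm (lsum X l - lsum X l') <= C * nrm (lsum E l - lsum E l').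
  by rewrite -!lsumB.
(* The value at [x] is pinned down by its distance to all images at once; linearity, the bound and
   the values on the family are read off from this single property. *)
have /choice[T hT] : forall x, exists y, forall l, nrm (y - lsum X l) <= C * nrm (x - lsum E l).
  move=> x.
  have /choice[u hu] : forall n : nat, exists l, nrm (x - lsum E l) < n.+1%:R^-1.
    by move=> n; apply: tE; rewrite invr_gt0.
  have [y hy] : exists y, tends (fun n => lsum X (u n)) y.
    apply: complete => e e0.
    have e2 : 0 < e / (2 * C) by rewrite divr_gt0 // mulr_gt0.
    have [N hN] := small_seq e2; exists N => n m nN mN.
    apply: le_lt_trans (hB _ _) _.
    have t := nrm_triB (lsum E (u n)) x (lsum E (u m)).
    have h1 := lt_trans (hu n) (hN n nN); have h2 := lt_trans (hu m) (hN m mN).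
    rewrite nrmBC in h1.
    rewrite mulrC -ltr_pdivlMr //; apply: le_lt_trans t _.
    have -> : e / C = e / (2 * C) + e / (2 * C) by field; rewrite gt_eqF.
    exact: ltrD.
  exists y => l; rewrite -subr_le0; apply: (@le0_eps _ _ (1 + C)) => e e0.
  have [N hN] := hy e e0; have [N' hN'] := small_seq e0.
  have a := hN (maxn N N') (leq_maxl _ _); have b := hN' (maxn N N') (leq_maxr _ _).
  have c := lt_trans (hu (maxn N N')) b.
  have t := nrm_triB y (lsum X (u (maxn N N'))) (lsum X l).
  have t2 := nrm_triB (lsum E (u (maxn N N'))) x (lsum E l).
  have t3 := hB (u (maxn N N')) l.
  rewrite nrmBC in a; rewrite nrmBC in c.
  have t4 : C * nrm (lsum E (u (maxn N N')) - lsum E l) <=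
     C * (nrm (lsum E (u (maxn N N')) - x) + nrm (x - lsum E l)) by rewrite ler_wpM2l // ltW.
  have t5 : C * (nrm (lsum E (u (maxn N N')) - x)) <= C * e by rewrite ler_wpM2l // ltW.
  rewrite mulrDr in t4; lra.
exists T; last first.
  move=> s; apply/eqP; rewrite -subr_eq0; apply/eqP/nrm_eq0/eqP; rewrite eq_le nrm_ge0 andbT.
  have := hT (E s) [:: (1, s)]; rewrite /lsum !big_seq1 /= !scale1r.
  by rewrite subrr nrm0 mulr0.
split=> [a x y|].
  apply/eqP; rewrite -subr_eq0; apply/eqP/(@nrm_eps _ _ _ (2 * C * (normc a + 1))) => e e0.
  have [l hl] := tE x e e0; have [l' hl'] := tE y e e0.
  have h1 := hT x l; have h2 := hT y l'; have h3 := hT (a *: x + y) (sc a l ++ l').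
  rewrite !lsumD !lsumZ in h3.
  have t := nrm_triB (T (a *: x + y)) (a *: lsum X l + lsum X l') (a *: T x + T y).
  have eq1 H (u v u' v' : H) : a *: u + v - (a *: u' + v') = a *: (u - u') + (v - v').
    by rewrite opprD addrACA -scalerBr.
  have t1 := nrmD (a *: (lsum X l - T x)) (lsum X l' - T y).
  have t2 := nrmD (a *: (x - lsum E l)) (y - lsum E l').
  rewrite -eq1 nrmZ nrmBC in t1; rewrite -eq1 nrmZ in t2.
  rewrite [nrm (lsum X l - _)]nrmBC [nrm (lsum X l' - _)]nrmBC in t1.
  rewrite nrmBC in t1.
  have a0 := normc_ge0 a.
  have k1 : C * nrm (x - lsum E l) <= C * e by rewrite ler_wpM2l // ltW.
  have k2 : C * nrm (y - lsum E l') <= C * e by rewrite ler_wpM2l // ltW.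
  have k3 : normc a * nrm (T x - lsum X l) <= normc a * (C * e).
    by rewrite ler_wpM2l // (le_trans h1).
  have k4 : normc a * nrm (x - lsum E l) <= normc a * e by rewrite ler_wpM2l // ltW.
  have k5 : C * nrm (a *: x + y - (a *: lsum E l + lsum E l')) <= C * (normc a * e + e).
    by rewrite ler_wpM2l ?(ltW C0) // (le_trans t2) // lerD // ltW.
  nra.
exists C => [|x]; first exact: ltW.
by have := hT x [::]; rewrite /lsum !big_nil !subr0.
Qed.

Lemma lsum_ip H1 I J (E : I -> H1) (F : J -> H1) l l' :
  '[lsum E l, lsum F l'] = \sum_(p <- l) \sum_(q <- l') p.1 * conjc q.1 * '[E p.2, F q.2].
Proof.
rewrite /lsum ip_suml; apply: eq_bigr => p _; rewrite ip_sumr; apply: eq_bigr => q _.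
by rewrite ipZl ipZr mulrA.
Qed.

(* The square of the norm of a combination is a sum over the Gram matrix, so an identity
   between Gram matrices bounds the operator. *)
Lemma extension_gram H1 H2 H3 I (E : I -> H1) (X : I -> H2) (Y : I -> H3) (C : R) : total_fam E ->
  (forall s t, '[X s, X t] + '[Y s, Y t] = (real_complex R C) * '[E s, E t]) ->
  exists2 T : H1 -> H2, bdd T & forall s, T (E s) = X s.
Proof.
move=> tE h; apply: (@extension _ _ _ _ _ (Num.sqrt `|C|)) => // l.
rewrite -(@ler_pXn2r _ 2) ?nnegrE ?mulr_ge0 ?sqrtr_ge0 //.
rewrite exprMn sqr_sqrtr // -!Re_ipxx !lsum_ip.
have e : '[lsum X l, lsum X l] + '[lsum Y l, lsum Y l] = (real_complex R C) * '[lsum E l, lsum E l].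
  rewrite !lsum_ip -big_split mulr_sumr; apply: eq_bigr => p _ /=.
  rewrite -big_split mulr_sumr; apply: eq_bigr => q _ /=.
  by rewrite -mulrDr h; ring.
rewrite -!lsum_ip; move: e; rewrite !ipxx -rmorphD -rmorphM => /complexI /= e.
have : C * nrm (lsum E l) ^+ 2 <= `|C| * nrm (lsum E l) ^+ 2 by rewrite ler_wpM2r ?sqr_ge0 ?ler_norm.
have := sqr_ge0 (nrm (lsum Y l)); lra.
Qed.

Lemma extension_isometry H1 H2 I (E : I -> H1) (X : I -> H2) : total_fam E ->
  (forall s t, '[X s, X t] = '[E s, E t]) ->
  exists2 T : H1 -> H2, bdd T & (forall s, T (E s) = X s) /\ forall x y, '[T x, T y] = '[x, y].
Proof.
move=> tE h.
have [|T bT hT] := @extension_gram _ _ H1 _ E X (fun=> 0) 1 tE.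
  by move=> s t; rewrite h ip0l addr0 mul1r.
exists T => //; split=> // x y.
have cl z : closed_sub [set x | '[T x, T z] = '[x, z]].
  split=> [|a u v /= h1 h2|u hu] /=; first by rewrite bdd0 // !ip0l.
    by rewrite bdd_lin // !ipDl !ipZl h1 h2.
  have [C C0 hC] := bdd_near bT.
  apply/eqP; rewrite -subr_eq0; apply/eqP/eq0_normc/eqP; rewrite eq_le normc_ge0 andbT.
  apply: (@le0_eps _ _ (C * nrm (T z) + nrm z)) => e e0; have [v /= hv uv] := hu e e0.
  have -> : '[T u, T z] - '[u, z] = '[T u - T v, T z] - '[u - v, z].
    by rewrite !ipBl hv; ring.
  apply: le_trans (le_normcD _ _) _; rewrite normcN mulrDl lerD //.
    apply: le_trans (cauchy_schwarz _ _) _; rewrite -mulrAC ler_wpM2r //.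
    by apply: le_trans (hC _ _) _; rewrite ler_wpM2l ?ltW.
  by apply: le_trans (cauchy_schwarz _ _) _; rewrite mulrC ler_wpM2l // ltW.
have h1 s z : '[T (E s), T z] = '[E s, z].
  rewrite [LHS]ipC [RHS]ipC; congr conjc.
  by apply: (total_ind tE (cl (E s))) => t /=; rewrite !hT h.
by apply: (total_ind tE (cl y)) => t /=; apply: h1.
Qed.

End Projection.

(** * Square-summable sequences and von Neumann's density theorem *)

Section MakeHilbert.
Context {R : realType} (V : lmodType R[i]) (f : V -> V -> R[i]).
Hypothesis fl : forall a x y z, f (a *: x + y) z = a * f x z + f y z.
Hypothesis fC : forall x y, f x y = conjc (f y x).
Hypothesis fp : forall x, 0 <= complex.Re (f x x).
Hypothesis fd : forall x, complex.Re (f x x) = 0 -> x = 0.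
Let n x := Num.sqrt (complex.Re (f x x)).
Hypothesis fcomplete : forall u : nat -> V,
  (forall e, 0 < e -> exists N, forall i j, (N <= i)%N -> (N <= j)%N -> n (u i - u j) < e) ->
  exists l, forall e, 0 < e -> exists N, forall i, (N <= i)%N -> n (u i - l) < e.

Let f0l z : f 0 z = 0.
Proof. by have := fl (-1) 0 0 z; rewrite scaleN1r addr0 oppr0 mulN1r addNr. Qed.
Let fDl x y z : f (x + y) z = f x z + f y z.
Proof. by have := fl 1 x y z; rewrite scale1r mul1r. Qed.
Let fZl a x z : f (a *: x) z = a * f x z.
Proof. by have := fl a x 0 z; rewrite f0l !addr0. Qed.
Let fDr x y z : f z (x + y) = f z x + f z y.
Proof. by rewrite [LHS]fC fDl rmorphD [f z x]fC [f z y]fC. Qed.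
Let fZr a x z : f z (a *: x) = conjc a * f z x.
Proof. by rewrite [LHS]fC fZl rmorphM [f z x]fC. Qed.

(** The quadratic in [t] given by [key] is nonnegative; if [b] exceeded [n x * n y], a suitable [t],
    chosen according to which of the two norms vanish, would make it negative. *)
Let fCS x y : complex.Re (f x y) <= n x * n y.
Proof.
have key t : 0 <= complex.Re (f x x) + 2 * t * complex.Re (f x y) + t ^+ 2 * complex.Re (f y y).
  have := fp (x + real_complex R t *: y).
  rewrite fDl !fDr !fZl !fZr [f y x]fC.
  case: (f x x) (f x y) (f y y) => [a b] [c d] [g h] /=.
  by move=> h0; apply: le_trans h0 _; rewrite le_eqVlt; apply/orP; left; apply/eqP; ring.
have nx : n x ^+ 2 = complex.Re (f x x) by rewrite sqr_sqrtr.
have ny : n y ^+ 2 = complex.Re (f y y) by rewrite sqr_sqrtr.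
have nx0 : 0 <= n x by apply: sqrtr_ge0.
have ny0 : 0 <= n y by apply: sqrtr_ge0.
move: key; rewrite -nx -ny; set b := complex.Re _ => key.
rewrite leNgt; apply/negP => hb.
have b0 : 0 < b by apply: le_lt_trans hb; rewrite mulr_ge0.
have [y0|y1] := eqVneq (n y) 0.
  have := key (- (n x ^+ 2 + 1) / b).
  rewrite y0.
  have -> : n x ^+ 2 + 2 * (- (n x ^+ 2 + 1) / b) * b + (- (n x ^+ 2 + 1) / b) ^+ 2 * 0 ^+ 2 =
    - n x ^+ 2 - 2 by field; rewrite gt_eqF.
  have := sqr_ge0 (n x); lra.
have y2 : 0 < n y by rewrite lt_neqAle eq_sym y1.
have := key (- n x / n y).
have -> : n x ^+ 2 + 2 * (- n x / n y) * b + (- n x / n y) ^+ 2 * n y ^+ 2 =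
  2 * (n x / n y) * (n x * n y - b) by field.
have [x0|x1] := eqVneq (n x) 0; last first.
  have x2 : 0 < n x by rewrite lt_neqAle eq_sym x1.
  by rewrite pmulr_rge0 ?mulr_gt0 ?invr_gt0 // => h; lra.
move=> _; have := key (- b / n y ^+ 2).
rewrite x0.
have -> : 0 ^+ 2 + 2 * (- b / n y ^+ 2) * b + (- b / n y ^+ 2) ^+ 2 * n y ^+ 2 = - (b / n y) ^+ 2.
  by field.
rewrite oppr_ge0 => h; have := exprn_gt0 2 (divr_gt0 b0 y2); lra.
Qed.

(** An alias that carries the norm and inner product coming from [f], apart from any structure
    already on [V]. *)
Definition hsp : Type := V.
HB.instance Definition _ := GRing.Lmodule.on hsp.

Definition hnorm (x : hsp) : R[i] := real_complex R (n x).

Lemma hnormD (x y : hsp) : hnorm (x + y) <= hnorm x + hnorm y.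
Proof.
rewrite /hnorm -rmorphD lecR -(@ler_pXn2r _ 2) ?nnegrE ?addr_ge0 ?sqrtr_ge0 //.
rewrite sqrrD !sqr_sqrtr // fDl !fDr [f y x]fC.
have := fCS x y; rewrite /n; case: (f x x) (f x y) (f y y) => [a b] [c d] [g h] /=.
set p := Num.sqrt a; set q := Num.sqrt g; lra.
Qed.

Lemma hnormZ a (x : hsp) : hnorm (a *: x) = `|a| * hnorm x.
Proof.
rewrite /hnorm normc_def -rmorphM; congr (real_complex R _).
rewrite /n fZl fZr -sqrtrM ?addr_ge0 ?sqr_ge0 //; congr Num.sqrt.
have : f x x = conjc (f x x) by [].
case: (f x x) a => [a b] [c d] /= [hb]; have b0 : b = 0; first lra.
by rewrite b0; ring.
Qed.

Lemma hnorm_eq0 (x : hsp) : hnorm x = 0 -> x = 0.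
Proof.
move=> /complexI /eqP; rewrite sqrtr_eq0 => h; apply: fd.
by apply/eqP; rewrite eq_le h fp.
Qed.

HB.instance Definition _ := Lmodule_isNormed.Build R[i] hsp hnormD hnormZ hnorm_eq0.

Lemma hsp_norm (x : hsp) : `|x| = real_complex R (n x).
Proof. by []. Qed.

Lemma hsp_complete (F : set_system hsp) : ProperFilter F -> cauchy F -> cvg F.
Proof.
move=> FF cF.
have /choice[u hu] : forall i : nat, exists x : hsp, F (ball x (real_complex R i.+1%:R^-1)).
  by move=> i; move/cauchyP: cF; apply; rewrite ltcR invr_gt0.
have hn (x y : hsp) r : ball x (real_complex R r) y <-> n (x - y) < r.
  by rewrite -ball_normE /ball_ /= hsp_norm ltcR.
have nD (x y z : hsp) : n (x - z) <= n (x - y) + n (y - z).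
  have := ler_normD (x - y) (y - z); rewrite addrA subrK !hsp_norm.
  by rewrite -rmorphD lecR.
have nC (x y : hsp) : n (x - y) = n (y - x).
  by apply: complexI; rewrite -!hsp_norm distrC.
have [|l ul] := fcomplete (u := u).
  move=> e e0; have e2 : 0 < e / 2 by rewrite divr_gt0.
  have [N hN] := small_seq e2; exists N => i j iN jN.
  have [z [/= /hn h1 /hn h2]] := filter_ex (filterI (hu i) (hu j)).
  apply: le_lt_trans (nD (u i) z (u j)) _; rewrite [e]splitr.
  by apply: ltrD; [exact: lt_trans h1 (hN i iN) | rewrite nC; exact: lt_trans h2 (hN j jN)].
apply/cvg_ex; exists (l : hsp); apply/cvgrPdist_lt => _ /complex_gt0[e e0 ->].
have e2 : 0 < e / 2 by rewrite divr_gt0.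
have [N hN] := small_seq e2; have [N' hN'] := ul _ e2.
have a := hN (maxn N N') (leq_maxl _ _); have b := hN' (maxn N N') (leq_maxr _ _).
apply: filterS (hu (maxn N N')) => z /hn hz.
rewrite hsp_norm ltcR; apply: le_lt_trans (nD l (u (maxn N N')) z) _; rewrite [e]splitr.
by apply: ltrD; [rewrite nC | exact: lt_trans hz a].
Qed.

HB.instance Definition _ := Uniform_isComplete.Build hsp hsp_complete.

Let g : hsp -> hsp -> R[i] := f.

Let g_bilinear : bilinear_for *%R (@Num.conj R[i] \; *%R) g.
Proof.
split=> [z a x y|z a x y]; first exact: fl.
by rewrite /g fDr fZr.
Qed.

HB.instance Definition _ := bilinear_isBilinear.Build R[i] hsp hsp R[i] *%R (@Num.conj R[i] \; *%R) g g_bilinear.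

Let g_hermitian (x y : hsp) : g x y = (-1) ^+ false * (@Num.conj R[i]) (g y x).
Proof. by rewrite expr0 mul1r; apply: fC. Qed.

HB.instance Definition _ :=
  isHermitianSesquilinear.Build R[i] hsp false (@Num.conj R[i]) g g_hermitian.

Let g_real x : g x x = real_complex R (complex.Re (g x x)).
Proof.
have := fC x x; rewrite /g; case: (f x x) => a b [hb].
by apply/eqP; rewrite eq_complex /= eqxx /=; apply/eqP; lra.
Qed.

Let g_pos (x : hsp) : x != 0 -> 0 < g x x.
Proof.
move=> x0; rewrite g_real ltcR lt_neqAle fp andbT eq_sym.
by apply: contra_neq x0 => /fd.
Qed.

HB.instance Definition _ := isDotProduct.Build R[i] hsp g g_pos.

Lemma hsp_inner (x : hsp) : g x x = `|x| ^+ 2.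
Proof. by rewrite hsp_norm -rmorphXn g_real /n /= sqr_sqrtr. Qed.

Definition make_hilbert : hilbert R := @Hilbert R hsp g hsp_inner.

Lemma make_hilbert_ip (x y : make_hilbert) : '[x, y] = f x y.
Proof. by []. Qed.

End MakeHilbert.

(** * The Hilbert space of square-summable sequences in [P] *)

Section Ell2.
Context {R : realType} (P : hilbert R).

Definition ctends (u : nat -> R[i]) (l : R[i]) :=
  forall e : R, 0 < e -> exists N, forall n, (N <= n)%N -> normc (u n - l) < e.

Lemma real_complete (u : nat -> R) :
  (forall e : R, 0 < e -> exists N, forall n m, (N <= n)%N -> (N <= m)%N -> `|u n - u m| < e) ->
  exists l, forall e : R, 0 < e -> exists N, forall n, (N <= n)%N -> `|u n - l| < e.
Proof.
move=> h; have cu : cauchy (u @ \oo).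
  apply: cauchy_exP => e e0.
  have [N hN] := h _ e0; exists (u N); exists N => // n /= nN.
  by rewrite -ball_normE /ball_ /=; apply: hN.
have /cvg_ex[l /cvgrPdist_lt ul] : cvg (u @ \oo); first exact: (cauchy_cvg (u @ \oo)) cu.
exists l => e e0; have [N _ hN] := ul e e0.
by exists N => n nN; rewrite distrC; apply: hN.
Qed.

Lemma ccomplete (u : nat -> R[i]) :
  (forall e : R, 0 < e -> exists N, forall n m, (N <= n)%N -> (N <= m)%N -> normc (u n - u m) < e) ->
  exists l, ctends u l.
Proof.
have nRe (a : R[i]) : `|complex.Re a| <= normc a.
  by case: a => a b; rewrite /= -sqrtr_sqr ler_wsqrtr // lerDl sqr_ge0.
have nIm (a : R[i]) : `|complex.Im a| <= normc a.
  by case: a => a b; rewrite /= -sqrtr_sqr ler_wsqrtr // lerDr sqr_ge0.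
have nle (a b : R) : normc (Complex a b) <= `|a| + `|b|.
  rewrite -(@ler_pXn2r _ 2) ?nnegrE ?addr_ge0 // sqr_sqrtr ?addr_ge0 ?sqr_ge0 //.
  rewrite sqrrD !real_normK ?num_real // -addrA lerD2l lerDr.
  by rewrite mulrn_wge0 // mulr_ge0.
move=> h.
have [|a ha] := @real_complete (fun n => complex.Re (u n)).
  move=> e e0; have [N hN] := h e e0; exists N => n m nN mN.
  by rewrite -raddfB; apply: le_lt_trans (nRe _) (hN _ _ nN mN).
have [|b hb] := @real_complete (fun n => complex.Im (u n)).
  move=> e e0; have [N hN] := h e e0; exists N => n m nN mN.
  by rewrite -raddfB; apply: le_lt_trans (nIm _) (hN _ _ nN mN).
exists (Complex a b) => e e0; have e2 : 0 < e / 2 by rewrite divr_gt0.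
have [N hN] := ha _ e2; have [N' hN'] := hb _ e2.
exists (maxn N N') => n; rewrite geq_max => /andP[nN nN'].
move: (hN n nN) (hN' n nN'); case: (u n) => c d /= h1 h2.
by apply: le_lt_trans (nle _ _) _; rewrite [e]splitr ltrD.
Qed.

Lemma ctends_uniq u l l' : ctends u l -> ctends u l' -> l = l'.
Proof.
move=> h h'; apply/eqP; rewrite -subr_eq0; apply/eqP/eq0_normc/eqP.
rewrite eq_le normc_ge0 andbT; apply: (@le0_eps _ _ 2) => e e0.
have [N hN] := h e e0; have [N' hN'] := h' e e0.
have a := hN (maxn N N') (leq_maxl _ _); have b := hN' (maxn N N') (leq_maxr _ _).
have -> : l - l' = (u (maxn N N') - l') - (u (maxn N N') - l) by ring.
apply: le_trans (le_normcD _ _) _; rewrite normcN; lra.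
Qed.

Lemma ctends_lin u v a l m : ctends u l -> ctends v m ->
  ctends (fun n => a * u n + v n) (a * l + m).
Proof.
move=> hu hv e e0.
have a0 : 0 < 2 * (normc a + 1) by rewrite mulr_gt0 // ltr_wpDl.
have e1 : 0 < e / (2 * (normc a + 1)) by rewrite divr_gt0.
have e2 : 0 < e / 2 by rewrite divr_gt0.
have [N hN] := hu _ e1; have [N' hN'] := hv _ e2.
exists (maxn N N') => n; rewrite geq_max => /andP[/hN h1 /hN' h2].
have -> : a * u n + v n - (a * l + m) = a * (u n - l) + (v n - m) by ring.
apply: le_lt_trans (le_normcD _ _) _; rewrite normcM [e]splitr; apply: ler_ltD => //.
have : normc a * normc (u n - l) <= (normc a + 1) * (e / (2 * (normc a + 1))).
  by apply: ler_pM => //; [rewrite lerDl | exact: ltW].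
have -> : (normc a + 1) * (e / (2 * (normc a + 1))) = e / 2 by field; lra.
by [].
Qed.

Lemma ctends_conj u l : ctends u l -> ctends (fun n => conjc (u n)) (conjc l).
Proof.
by move=> hu e /hu[N hN]; exists N => n /hN; rewrite -rmorphB normcJr.
Qed.

Definition sqsum (v : nat -> P) := exists C : R, forall n, \sum_(i < n) nrm (v i) ^+ 2 <= C.

Lemma sqsum_tail v : sqsum v -> forall e : R, 0 < e -> exists N, forall n m,
  (N <= n)%N -> (n <= m)%N -> \sum_(n <= i < m) nrm (v i) ^+ 2 < e.
Proof.
move=> [C hC] e e0.
pose E := [set r : R | exists n, r = \sum_(i < n) nrm (v i) ^+ 2].
have E0 : E !=set0 by exists (\sum_(i < 0) nrm (v i) ^+ 2), 0%N.
have uE : has_ubound E by exists C => _ [n ->].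
have [_ [N ->] hN] := sup_adherent e0 (conj E0 uE).
exists N => n m Nn nm.
have h1 : \sum_(i < m) nrm (v i) ^+ 2 <= sup E by apply: ub_le_sup => //; exists m.
have h2 : \sum_(i < N) nrm (v i) ^+ 2 <= \sum_(i < n) nrm (v i) ^+ 2.
  rewrite -!(big_mkord xpredT (fun i => nrm (v i) ^+ 2)) (big_cat_nat _ Nn) //= lerDl.
  by apply: sumr_ge0 => i _; apply: sqr_ge0.
have h3 : \sum_(i < m) nrm (v i) ^+ 2 =
    \sum_(i < n) nrm (v i) ^+ 2 + \sum_(n <= i < m) nrm (v i) ^+ 2.
  by rewrite -!(big_mkord xpredT (fun i => nrm (v i) ^+ 2)) (big_cat_nat _ nm).
lra.
Qed.

Definition psum (v w : nat -> P) n := \sum_(i < n) '[v i, w i].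

Lemma normc_sum I r (Q : pred I) (F : I -> R[i]) :
  normc (\sum_(i <- r | Q i) F i) <= \sum_(i <- r | Q i) normc (F i).
Proof.
elim/big_rec2: _ => [|i y x _ h]; first by rewrite normc0.
by apply: le_trans (le_normcD _ _) _; rewrite lerD2l.
Qed.

Lemma psum_cvg v w : sqsum v -> sqsum w -> exists l, ctends (psum v w) l.
Proof.
move=> hv hw; apply: ccomplete => e e0.
have [N hN] := sqsum_tail hv e0; have [N' hN'] := sqsum_tail hw e0.
have key n m : (maxn N N' <= n)%N -> (n <= m)%N -> normc (psum v w m - psum v w n) < e.
  rewrite geq_max => /andP[nN nN'] nm.
  have -> : psum v w m - psum v w n = \sum_(n <= i < m) '[v i, w i].
    rewrite /psum -!(big_mkord xpredT (fun i => '[v i, w i])) (big_cat_nat _ nm) //=.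
    by rewrite addrAC subrr add0r.
  apply: le_lt_trans (normc_sum _ _ _) _.
  apply: (@le_lt_trans _ _ (\sum_(n <= i < m) (nrm (v i) ^+ 2 + nrm (w i) ^+ 2) / 2)).
    apply: ler_sum => i _; apply: le_trans (cauchy_schwarz _ _) _.
    have := sqr_ge0 (nrm (v i) - nrm (w i)); rewrite sqrrB; lra.
  rewrite -mulr_suml big_split /=.
  have := hN n m nN nm; have := hN' n m nN' nm; lra.
exists (maxn N N') => n m nN mN.
have [nm|/ltnW mn] := leqP n m; last exact: key.
by rewrite -normcN opprB; apply: key.
Qed.

Lemma sqsum_lin a v w : sqsum v -> sqsum w -> sqsum (a *: v + w).
Proof.
move=> [C hC] [D hD]; exists (2 * (normc a ^+ 2 * C + D)) => n.
have h : \sum_(i < n) nrm ((a *: v + w) i) ^+ 2 <=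
    \sum_(i < n) 2 * (normc a ^+ 2 * nrm (v i) ^+ 2 + nrm (w i) ^+ 2).
  apply: ler_sum => i _; change (nrm (a *: v i + w i) ^+ 2 <=
    2 * (normc a ^+ 2 * nrm (v i) ^+ 2 + nrm (w i) ^+ 2)).
  rewrite -exprMn -nrmZ -subr_ge0.
  have := parallelogram (a *: v i) (w i); have := sqr_ge0 (nrm (a *: v i - w i)); lra.
apply: le_trans h _; rewrite -mulr_sumr ler_wpM2l // big_split /= -mulr_sumr.
by apply: lerD; [apply: ler_wpM2l; rewrite ?sqr_ge0 ?hC | exact: hD].
Qed.

Lemma sqsum0 : sqsum 0.
Proof. by exists 0 => n; rewrite big1 // => i _; rewrite nrm0 expr0n. Qed.

Definition sqsum_pred : {pred nat -> P} := fun v => `[< sqsum v >].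

Lemma sqsum_closed : submod_closed sqsum_pred.
Proof.
split; first exact/asboolP/sqsum0.
by move=> a v w /asboolP hv /asboolP hw; apply/asboolP/sqsum_lin.
Qed.

HB.instance Definition _ := GRing.isSubmodClosed.Build R[i] (nat -> P) sqsum_pred
  (GRing.submod_closed_semi sqsum_closed).

Record ell2 := Ell2 { ell2_val : nat -> P; ell2_valP : ell2_val \in sqsum_pred }.
HB.instance Definition _ := [isSub for ell2_val].
HB.instance Definition _ := [Choice of ell2 by <:].
HB.instance Definition _ := [SubChoice_isSubLmodule of ell2 by <:].

Definition ip2 (v w : ell2) : R[i] := xget (0 : R[i]) (ctends (psum (ell2_val v) (ell2_val w))).

Lemma ell2_sq (v : ell2) : sqsum (ell2_val v).
Proof. by have /asboolP := ell2_valP v. Qed.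

Lemma ip2_tends v w : ctends (psum (ell2_val v) (ell2_val w)) (ip2 v w).
Proof.
have [l hl] := psum_cvg (ell2_sq v) (ell2_sq w).
by apply: xgetPex; exists l.
Qed.

Lemma ip2_lin a x y z : ip2 (a *: x + y) z = a * ip2 x z + ip2 y z.
Proof.
apply: ctends_uniq (ip2_tends _ _) _.
rewrite (_ : psum _ _ = fun n => a * psum (ell2_val x) (ell2_val z) n +
  psum (ell2_val y) (ell2_val z) n); first exact: ctends_lin (ip2_tends _ _) (ip2_tends _ _).
apply/funext => n; rewrite /psum mulr_sumr -big_split; apply: eq_bigr => i _ /=.
by rewrite -ipZl -ipDl.
Qed.

Lemma ip2C x y : ip2 x y = conjc (ip2 y x).
Proof.
apply: ctends_uniq (ip2_tends _ _) _.
rewrite (_ : psum _ _ = fun n => conjc (psum (ell2_val y) (ell2_val x) n)).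
  exact: ctends_conj (ip2_tends _ _).
apply/funext => n; rewrite /psum rmorph_sum; apply: eq_bigr => i _ /=.
exact: ipC.
Qed.

Lemma Re_psum v n : complex.Re (psum v v n) = \sum_(i < n) nrm (v i) ^+ 2.
Proof. by rewrite /psum raddf_sum; apply: eq_bigr => i _ /=; rewrite Re_ipxx. Qed.

Lemma ip2_le_psum (v : ell2) n : \sum_(i < n) nrm (ell2_val v i) ^+ 2 <= complex.Re (ip2 v v).
Proof.
rewrite -subr_le0; apply: (@le0_eps _ _ 1) => e e0; rewrite mul1r.
have [N hN] := ip2_tends v v e0.
have h1 := hN (maxn N n) (leq_maxl _ _).
have h2 : \sum_(i < n) nrm (ell2_val v i) ^+ 2 <= \sum_(i < maxn N n) nrm (ell2_val v i) ^+ 2.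
  rewrite -!(big_mkord xpredT (fun i => nrm (ell2_val v i) ^+ 2)).
  rewrite (big_cat_nat _ (leq_maxr N n)) //= lerDl.
  by apply: sumr_ge0 => i _; apply: sqr_ge0.
have h3 := Re_le_normc (psum (ell2_val v) (ell2_val v) (maxn N n) - ip2 v v).
rewrite raddfB /= Re_psum in h3; lra.
Qed.

Lemma ip2_ge_psum (v : ell2) C : (forall n, \sum_(i < n) nrm (ell2_val v i) ^+ 2 <= C) ->
  complex.Re (ip2 v v) <= C.
Proof.
move=> hC; rewrite -subr_le0; apply: (@le0_eps _ _ 1) => e e0; rewrite mul1r.
have [N hN] := ip2_tends v v e0.
have h1 := hN N (leqnn _); rewrite -normcN opprB in h1.
have h3 := Re_le_normc (ip2 v v - psum (ell2_val v) (ell2_val v) N).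
rewrite raddfB /= Re_psum in h3; have := hC N; lra.
Qed.

Lemma ip2_ge0 v : 0 <= complex.Re (ip2 v v).
Proof. by have := ip2_le_psum v 0%N; rewrite big_ord0. Qed.

Lemma ell2_coord (v : ell2) i : nrm (ell2_val v i) ^+ 2 <= complex.Re (ip2 v v).
Proof.
apply: le_trans (ip2_le_psum v i.+1); rewrite big_ord_recr /= lerDr.
by apply: sumr_ge0 => j _; apply: sqr_ge0.
Qed.

Lemma ip2_eq0 v : complex.Re (ip2 v v) = 0 -> v = 0.
Proof.
move=> h; apply: val_inj; apply/funext => i; apply: nrm_eq0.
by apply/eqP; rewrite -sqrf_eq0 eq_le sqr_ge0 andbT -h ell2_coord.
Qed.

Lemma ip2_complete (u : nat -> ell2) (n := fun x => Num.sqrt (complex.Re (ip2 x x))) :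
  (forall e, 0 < e -> exists N, forall i j, (N <= i)%N -> (N <= j)%N -> n (u i - u j) < e) ->
  exists l, forall e, 0 < e -> exists N, forall i, (N <= i)%N -> n (u i - l) < e.
Proof.
move=> cu.
have nsq x : n x ^+ 2 = complex.Re (ip2 x x) by rewrite sqr_sqrtr ?ip2_ge0.
have n0 x : 0 <= n x by apply: sqrtr_ge0.
have nc x i : nrm (ell2_val x i) <= n x.
  by rewrite -(@ler_pXn2r _ 2) ?nnegrE ?nrm_ge0 // nsq ell2_coord.
have /choice[l hl] : forall k, exists y, tends (fun i => ell2_val (u i) k) y.
  move=> k; apply: complete => e e0; have [N hN] := cu e e0; exists N => i j iN jN.
  by apply: le_lt_trans (hN _ _ iN jN); apply: (nc (u i - u j)).
(* The bound holds for every [m] although the auxiliary index [j] depends on [m]: the first [m]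
   coordinates of [u j] are within [e / m.+1] of their limits and contribute at most [e ^+ 2]
   together. The factor 4 comes from the parallelogram law. *)
have key e : 0 < e -> exists N, forall i, (N <= i)%N -> forall m,
    \sum_(k < m) nrm (ell2_val (u i) k - l k) ^+ 2 <= 4 * e ^+ 2.
  move=> e0; have [N hN] := cu e e0; exists N => i iN m.
  have m0 : 0 < e / m.+1%:R by rewrite divr_gt0.
  have [j jN hj] : exists2 j, (N <= j)%N & forall k, (k < m)%N -> nrm (ell2_val (u j) k - l k) < e / m.+1%:R.
    have /(_ m)[M hM] : forall m', exists M, forall j, (M <= j)%N -> forall k, (k < m')%N -> nrm (ell2_val (u j) k - l k) < e / m.+1%:R.
      elim=> [|m' [M hM]]; first by exists 0%N.
      have [M' hM'] := hl m' _ m0; exists (maxn M M') => j; rewrite geq_max => /andP[jM jM'] k.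
      by rewrite ltnS leq_eqVlt => /orP[/eqP->|]; [exact: hM' | exact: hM].
    by exists (maxn N M); [exact: leq_maxl | apply: hM; exact: leq_maxr].
  have h1 : \sum_(k < m) nrm (ell2_val (u i - u j) k) ^+ 2 <= e ^+ 2.
    apply: le_trans (ip2_le_psum _ _) _; rewrite -nsq ler_pXn2r ?nnegrE ?(ltW e0) //.
    exact/ltW/hN.
  have h2 : \sum_(k < m) nrm (ell2_val (u j) k - l k) ^+ 2 <= e ^+ 2.
    apply: le_trans (_ : \sum_(k < m) (e / m.+1%:R) ^+ 2 <= _).
      apply: ler_sum => k _; rewrite ler_pXn2r ?nnegrE ?nrm_ge0 ?(ltW m0) //.
      exact/ltW/hj.
    rewrite sumr_const card_ord -[_ *+ m]mulr_natl expr_div_n.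
    rewrite mulrCA ler_piMr ?sqr_ge0 // ler_pdivrMr ?exprn_gt0 // mul1r.
    by rewrite -natrX ler_nat; apply: leq_trans (leqnSn m) _; rewrite expnS leq_pmulr // expn1.
  have -> : 4 * e ^+ 2 = 2 * e ^+ 2 + 2 * e ^+ 2 by ring.
  apply: le_trans (_ : \sum_(k < m) (2 * nrm (ell2_val (u i - u j) k) ^+ 2 +
     2 * nrm (ell2_val (u j) k - l k) ^+ 2) <= _).
    apply: ler_sum => k _.
    have -> : ell2_val (u i) k - l k = ell2_val (u i - u j) k + (ell2_val (u j) k - l k).
      by rewrite /= addrA subrK.
    set a := ell2_val _ k; set b := _ - l k.
    have := parallelogram a b; have := sqr_ge0 (nrm (a - b)); lra.
  by rewrite big_split /= -!mulr_sumr lerD // ler_wpM2l.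
have sl : sqsum l.
  have [N hN] := key 1 ltr01.
  have : sqsum ((-1) *: (fun k => ell2_val (u N) k - l k) + ell2_val (u N)).
    apply: sqsum_lin; last exact: ell2_sq.
    by exists (4 * 1 ^+ 2); apply: hN.
  congr sqsum; apply/funext => k.
  change (-1 *: (ell2_val (u N) k - l k) + ell2_val (u N) k = l k).
  by rewrite scaleN1r opprB subrK.
have sl' : l \in sqsum_pred by apply/asboolP.
exists (Ell2 sl') => e e0.
(* With [e / 3] the factor 4 of [key] becomes 4/9, which is less than 1. *)
have e2 : 0 < e / 3 by rewrite divr_gt0.
have [N hN] := key _ e2; exists N => i iN.
have h : n (u i - Ell2 sl') ^+ 2 <= 4 * (e / 3) ^+ 2.
  by rewrite nsq; apply: ip2_ge_psum; apply: hN.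
rewrite -(@ltr_pXn2r _ 2) ?nnegrE ?n0 ?(ltW e0) //; apply: le_lt_trans h _.
have := exprn_gt0 2 e0; rewrite expr_div_n; set E := e ^+ 2; lra.
Qed.

Definition l2 : hilbert R := make_hilbert ip2_lin ip2C ip2_ge0 ip2_eq0 ip2_complete.

End Ell2.

(** * Amplification and the density theorem *)

Section Density.
Context {R : realType}.
Implicit Types H P : hilbert R.

Definition clspan H I (E : I -> H) : set H :=
  [set x | forall e : R, 0 < e -> exists l, nrm (x - lsum E l) < e].

Lemma lsum_cat H I (E : I -> H) l l' : lsum E (l ++ l') = lsum E l + lsum E l'.
Proof. by rewrite /lsum big_cat. Qed.

Lemma lsum_scale H I (E : I -> H) a l :
  lsum E [seq (a * p.1, p.2) | p <- l] = a *: lsum E l.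
Proof. by rewrite /lsum big_map scaler_sumr; apply: eq_bigr => p _; rewrite scalerA. Qed.

Lemma clspan_mem H I (E : I -> H) s : clspan E (E s).
Proof.
by move=> e e0; exists [:: (1, s)]; rewrite /lsum big_seq1 scale1r subrr nrm0.
Qed.

Lemma clspan_closed H I (E : I -> H) : closed_sub (clspan E).
Proof.
split=> [e e0|a x y hx hy e e0|x hx e e0].
- by exists [::]; rewrite /lsum big_nil subrr nrm0.
- have a0 : 0 < normc a + 1 by rewrite ltr_wpDl.
  have e1 : 0 < e / 2 / (normc a + 1) by rewrite !divr_gt0.
  have e2 : 0 < e / 2 by rewrite divr_gt0.
  have [l hl] := hx _ e1; have [l' hl'] := hy _ e2.
  exists ([seq (a * p.1, p.2) | p <- l] ++ l'); rewrite lsum_cat lsum_scale.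
  rewrite opprD addrACA -scalerBr; apply: le_lt_trans (nrmD _ _) _.
  rewrite [e]splitr; apply: ler_ltD => //; rewrite nrmZ.
  apply: le_trans (_ : (normc a + 1) * (e / 2 / (normc a + 1)) <= _).
    by apply: ler_pM => //; [rewrite lerDl | exact: ltW].
  by rewrite mulrC divfK // gt_eqF.
- have e2 : 0 < e / 2 by rewrite divr_gt0.
  have [y hy xy] := hx _ e2; have [l hl] := hy _ e2; exists l.
  by apply: le_lt_trans (nrm_triB _ y _) _; rewrite [e]splitr ltrD.
Qed.

Lemma clspan_min H I (E : I -> H) (Q : set H) : closed_sub Q -> (forall s, Q (E s)) ->
  clspan E `<=` Q.
Proof.
move=> cQ QE x hx; case: (cQ) => _ _; apply => e /hx[l hl].
by exists (lsum E l) => //; apply: closed_lsum.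
Qed.

Lemma total_of_ortho H I (E : I -> H) :
  (forall y, (forall s, '[E s, y] = 0) -> y = 0) -> total_fam E.
Proof.
move=> h x; have [p hp hpx] := projection x (clspan_closed E).
suff -> : x = p by [].
apply/eqP; rewrite -subr_eq0; apply/eqP/h => s.
by rewrite ipC hpx ?rmorph0 //; apply: clspan_mem.
Qed.

(** The last clause is the practical one: commutation of an operator with [p] is shown by proposing
    the value of [p] and checking orthogonality. *)
Lemma projector H (Q : set H) : closed_sub Q -> exists p : H -> H,
  [/\ bdd p, forall x, Q (p x), forall x, Q x -> p x = x
    & forall x y, (Q y /\ forall g, Q g -> '[x - y, g] = 0) -> p x = y].
Proof.
move=> cQ; have /choice[p hp] : forall x, exists y, Q y /\ forall g, Q g -> '[x - y, g] = 0.
  by move=> x; have [y] := projection x cQ; exists y.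
have u x y : (Q y /\ forall g, Q g -> '[x - y, g] = 0) -> p x = y.
  move=> [Qy hy]; have [Qp hp'] := hp x.
  apply/eqP; rewrite -subr_eq0; apply/eqP/nrm_eq0/eqP; rewrite -sqrf_eq0 -Re_ipxx.
  have Qd : Q (p x - y) by apply: closed_add => //; apply: closed_opp.
  have -> : '[p x - y, p x - y] = '[x - y, p x - y] - '[x - p x, p x - y].
    have e : p x - y = (x - y) - (x - p x) by rewrite opprB [RHS]addrC addrA subrK.
    by rewrite -ipBl -e.
  by rewrite hy // hp' // subrr.
exists p; split=> // [|x|x Qx]; first split.
- move=> a x y; apply: u; split; first by case: cQ => _ QD _; apply: QD; [case: (hp x) | case: (hp y)].
  move=> g Qg; have [_ h1] := hp x; have [_ h2] := hp y.
  have -> : a *: x + y - (a *: p x + p y) = a *: (x - p x) + (y - p y).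
    by rewrite opprD addrACA scalerBr.
  by rewrite ipDl ipZl h1 // h2 // mulr0 addr0.
- exists 1 => // x; rewrite mul1r; have [Qp h] := hp x.
  have e : nrm x ^+ 2 = nrm (x - p x) ^+ 2 + nrm (p x) ^+ 2.
    by have := nrmD_sq (x - p x) (p x); rewrite subrK h // mulr0 addr0.
  rewrite -(@ler_pXn2r _ 2) ?nnegrE ?nrm_ge0 // e lerDr; exact: sqr_ge0.
- by case: (hp x).
- by apply: u; split=> // g _; rewrite subrr ip0l.
Qed.

Lemma sqsum_amp P (x : P -> P) (v : nat -> P) : bdd x -> sqsum v -> sqsum (x \o v).
Proof.
move=> [_ [C C0 hC]] [D hD]; exists (C ^+ 2 * D) => n.
apply: le_trans (_ : \sum_(i < n) C ^+ 2 * nrm (v i) ^+ 2 <= _).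
  apply: ler_sum => i _ /=; rewrite -exprMn ler_pXn2r ?nnegrE ?mulr_ge0 ?nrm_ge0 //.
by rewrite -mulr_sumr ler_wpM2l ?sqr_ge0.
Qed.

Definition mkl2 P (v : nat -> P) (hv : sqsum v) : l2 P :=
  @Ell2 R P v (introT (asboolP _) hv).

Definition coordl2 P (n : nat) (v : l2 P) : P := ell2_val (v : ell2 P) n.

Lemma l2_ext P (v w : l2 P) : (forall n, coordl2 n v = coordl2 n w) -> v = w.
Proof. by move=> h; suff : (v : ell2 P) = (w : ell2 P) by []; apply: val_inj; apply/funext. Qed.

Lemma l2_tends P (v w : l2 P) : ctends (psum (ell2_val (v : ell2 P)) (ell2_val (w : ell2 P))) '[v, w].
Proof. exact: ip2_tends. Qed.

Lemma nrm_l2 P (v : l2 P) : nrm v ^+ 2 = complex.Re (ip2 v v).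
Proof. by rewrite -Re_ipxx make_hilbert_ip. Qed.

Lemma coordl2_bdd P n : bdd (@coordl2 P n).
Proof.
split=> [a x y //|]; exists 1 => // x; rewrite mul1r.
rewrite -(@ler_pXn2r _ 2) ?nnegrE ?nrm_ge0 // nrm_l2; exact: ell2_coord.
Qed.

(** The amplification of [x], coordinate by coordinate. Square-summability of the image rests on a
    bound for [x]; for other functions the value is [v] by convention. *)
Definition amp P (x : P -> P) (v : l2 P) : l2 P :=
  match pselect (bdd x) with
  | left hx => mkl2 (sqsum_amp hx (ell2_sq v))
  | right _ => v
  end.

Lemma amp_coord P (x : P -> P) v n : bdd x -> coordl2 n (amp x v) = x (coordl2 n v).
Proof. by move=> hx; rewrite /amp; case: pselect. Qed.

Lemma amp_bdd P (x : P -> P) : bdd x -> bdd (amp x).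
Proof.
move=> hx; split=> [a v w|].
  apply: l2_ext => n; rewrite !amp_coord // !(bdd_lin _ _ _ (coordl2_bdd _ _)).
  by rewrite !amp_coord // bdd_lin.
case: (hx) => _ [C C0 hC]; exists C => // v.
rewrite -(@ler_pXn2r _ 2) ?nnegrE ?mulr_ge0 ?nrm_ge0 // nrm_l2.
apply: ip2_ge_psum => n; rewrite exprMn nrm_l2.
apply: le_trans (_ : \sum_(i < n) C ^+ 2 * nrm (coordl2 i v) ^+ 2 <= _).
  apply: ler_sum => i _; rewrite -[ell2_val _ _]/(coordl2 i (amp x v)) amp_coord //.
  by rewrite -exprMn ler_pXn2r ?nnegrE ?mulr_ge0 ?nrm_ge0.
by rewrite -mulr_sumr ler_wpM2l ?sqr_ge0 // ip2_le_psum.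
Qed.

Lemma sqsum_single P (n : nat) (xi : P) : sqsum (fun m => if m == n then xi else 0).
Proof.
exists (nrm xi ^+ 2) => m.
have [nm|mn] := ltnP n m; last first.
  rewrite big1 ?sqr_ge0 // => i _; case: eqP => [e|_]; last by rewrite nrm0 expr0n.
  by have := ltn_ord i; rewrite e ltnNge mn.
rewrite (bigD1 (Ordinal nm)) //= eqxx big1 ?addr0 // => i.
by rewrite -val_eqE /= => /negPf ->; rewrite nrm0 expr0n.
Qed.

Definition single P (n : nat) (xi : P) : l2 P := mkl2 (sqsum_single n xi).

Lemma single_coord P n (xi : P) m : coordl2 m (single n xi) = if m == n then xi else 0.
Proof. by []. Qed.

Lemma single_ip P n (xi : P) v : '[single n xi, v] = '[xi, coordl2 n v].
Proof.
apply: ctends_uniq (l2_tends _ _) _ => e e0; exists n.+1 => m nm.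
rewrite /psum (bigD1 (Ordinal nm)) //= eqxx big1 ?addr0 ?subrr ?normc0 // => i.
by rewrite -val_eqE /= => /negPf ->; rewrite ip0l.
Qed.

Lemma single_bdd P n : bdd (@single P n).
Proof.
split=> [a x y|].
  apply: l2_ext => m; rewrite (bdd_lin _ _ _ (coordl2_bdd _ _)) !single_coord.
  by case: eqP => // _; rewrite scaler0 addr0.
exists 1 => // x; rewrite mul1r -(@ler_pXn2r _ 2) ?nnegrE ?nrm_ge0 //.
by rewrite -!Re_ipxx single_ip single_coord eqxx.
Qed.

Lemma single_total P : total_fam (fun p : nat * P => single p.1 p.2).
Proof.
apply: total_of_ortho => y h; apply: l2_ext => n; rewrite (bdd0 (coordl2_bdd _ _)).
by apply: ip_eq0 => z; rewrite ipC -single_ip (h (n, z)) rmorph0.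
Qed.

Lemma amp_single P (x : P -> P) n xi : bdd x -> amp x (single n xi) = single n (x xi).
Proof.
move=> hx; apply: l2_ext => m; rewrite amp_coord // !single_coord.
by case: eqP => // _; rewrite bdd0.
Qed.

Lemma amp_adj P (x : P -> P) v w : bdd x -> '[amp x v, w] = '[v, amp (adj x) w].
Proof.
move=> hx; have hx' := adj_bdd hx.
apply: ctends_uniq (l2_tends _ _) _; rewrite (_ : psum _ _ = psum (ell2_val (v : ell2 P))
   (ell2_val (amp (adj x) w : ell2 P))); first exact: l2_tends.
apply/funext => n; apply: eq_bigr => i _.
by rewrite -[ell2_val (amp x v) i]/(coordl2 i _) -[ell2_val (amp (adj x) w) i]/(coordl2 i _)
  !amp_coord // adjE.
Qed.

(** Words in generators and their adjoints form such a set, although their sums are not words;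
    linear combinations enter through closed spans. *)
Definition star_closed P (A : set (P -> P)) :=
  [/\ A `<=` @bdd R P P, A idfun, forall x y, A x -> A y -> A (x \o y)
    & forall x, A x -> A (adj x)].

Lemma commutantE P (A : set (P -> P)) y : commutant A y <->
  bdd y /\ forall x, A x -> x \o y = y \o x.
Proof. by split=> -[b h]; split=> //; apply/bounded_bdd. Qed.

(* Von Neumann's argument in l^2(P): the matrix entries of the projection onto the closure
   of A v commute with A, hence with x. *)
Lemma density P (A : set (P -> P)) (x : P -> P) (v w : l2 P) : star_closed A ->
  bicommutant A x -> (forall a, A a -> '[amp a v, w] = 0) -> '[amp x v, w] = 0.
Proof.
move=> [Ab A1 AM Aj] /commutantE[bx hx] hA.
pose E (s : {a | A a}) := amp (sval s) v.
have bE (s : {a | A a}) : bdd (sval s) by apply: Ab; case: s.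
pose K := clspan E; have cK : closed_sub K := clspan_closed E.
have [p [bp Kp pK pu]] := projector cK.
have ampM a b u : bdd a -> bdd b -> amp a (amp b u) = amp (a \o b) u.
  move=> ba bb; apply: l2_ext => n.
  by rewrite amp_coord // amp_coord // amp_coord //; apply: bdd_comp.
have inv a : A a -> forall u, K u -> K (amp a u).
  move=> Aa; apply: clspan_min => [|s].
    have [K0 KD Kc] := cK; have ba := amp_bdd (Ab _ Aa); split=> /=.
    - by rewrite (bdd0 ba).
    - by move=> c u u' hu hu'; rewrite (bdd_lin _ _ _ ba); apply: KD.
    - move=> u hu; apply: Kc => e e0; have [C C0 hC] := bdd_near ba.
      have eC : 0 < e / C by rewrite divr_gt0.
      have [u' Ku' uu'] := hu _ eC; exists (amp a u') => //.
      by apply: le_lt_trans (hC _ _) _; rewrite mulrC -ltr_pdivlMr.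
  case: s => b Ab' /=; rewrite /E /= ampM; [|exact: Ab|exact: Ab].
  exact: (@clspan_mem _ _ E (exist _ _ (AM _ _ Aa Ab'))).
have comm a u : A a -> p (amp a u) = amp a (p u).
  move=> Aa; apply: (pu); split; first exact: inv.
  move=> g Kg; rewrite -(bddB _ _ (amp_bdd (Ab _ Aa))) amp_adj; last exact: Ab.
  have [q Kq hq] := projection u cK.
  have -> : p u = q by apply: pu.
  by apply: hq; apply: inv => //; apply: Aj.
have px m n xi : x (coordl2 m (p (single n xi))) = coordl2 m (p (single n (x xi))).
  pose y xi := coordl2 m (p (single n xi)).
  have yc : commutant A y.
    apply/commutantE; split.
      exact: (bdd_comp (coordl2_bdd P m) (bdd_comp bp (single_bdd P n))).
    move=> a Aa; apply/funext => z; rewrite /= /y -amp_coord; last exact: Ab.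
    by rewrite -comm // amp_single //; apply: Ab.
  by have := congr1 (@^~ xi) (hx y yc); rewrite /= /y => ->.
have eqp : p \o amp x = amp x \o p.
  apply: (@total_eq R (l2 P) (l2 P) _ _ (p \o amp x) (amp x \o p) (@single_total P)).
  - exact: (bdd_comp bp (amp_bdd bx)).
  - exact: (bdd_comp (amp_bdd bx) bp).
  - move=> [n xi] /=; rewrite amp_single //; apply: l2_ext => m.
    by rewrite amp_coord // px.
have Kv : K v.
  have -> : v = E (exist _ _ A1).
    by apply: l2_ext => n; rewrite /E amp_coord //; apply: bdd_id.
  exact: clspan_mem.
have Kxv : K (amp x v).
  have e : p (amp x v) = amp x (p v) by exact: (congr1 (fun h => h v) eqp).
  by rewrite (pK v Kv) in e; rewrite -e; exact: Kp.
have : K `<=` [set z | '[z, w] = 0].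
  by apply: clspan_min; [exact: closed_ortho | case=> a Aa; apply: hA].
exact.
Qed.

End Density.

(** * Normal functionals on a bicommutant *)

Section Normal.
Context {R : realType} (P : hilbert R).
Implicit Types (M A : set (P -> P)) (v w : l2 P).

(** Even places carry [v] and odd places [w]. This realises the direct sum of two copies of [l2 P]
    inside [l2 P], so that a sum of two normal functionals is again given by a single pair of
    sequences. *)
Definition interleave (v w : nat -> P) (n : nat) := if odd n then w n./2 else v n./2.

Lemma sum_interleave (V : zmodType) (F G : P -> P -> V) (v v' w w' : nat -> P) n :
  \sum_(i < n.*2) F (interleave v v' i) (interleave w w' i) =
  \sum_(i < n) F (v i) (w i) + \sum_(i < n) F (v' i) (w' i).
Proof.
elim: n => [|n ih]; first by rewrite !big_ord0 addr0.
rewrite doubleS !big_ord_recr /= ih /interleave /= odd_double /= uphalf_double doubleK.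
by rewrite -!addrA; congr (_ + _); rewrite addrCA.
Qed.

Lemma sqsum_interleave (v w : nat -> P) : sqsum v -> sqsum w -> sqsum (interleave v w).
Proof.
move=> [C hC] [D hD]; exists (C + D) => n.
apply: le_trans (_ : \sum_(i < n.*2) nrm (interleave v w i) ^+ 2 <= _).
  rewrite -!(big_mkord xpredT (fun i => nrm (interleave v w i) ^+ 2)).
  rewrite (@big_cat_nat _ _ _ n _ n.*2) //=; last by rewrite -addnn leq_addr.
  by rewrite lerDl sumr_ge0 // => i _; apply: sqr_ge0.
by rewrite (sum_interleave (fun x _ => nrm x ^+ 2) (fun x _ => nrm x ^+ 2) v w v w) lerD.
Qed.

Definition il v w : l2 P := mkl2 (sqsum_interleave (ell2_sq v) (ell2_sq w)).

Lemma il_ip v v' w w' : '[il v v', il w w'] = '[v, w] + '[v', w'].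
Proof.
have h1 := l2_tends v w; have h2 := l2_tends v' w'.
have h3 := ctends_lin 1 h1 h2; rewrite mul1r in h3.
apply: ctends_uniq h3 => e e0.
have [N hN] := l2_tends (il v v') (il w w') e0.
exists N => n nN; have := hN n.*2 _; rewrite -addnn (leq_trans nN (leq_addr _ _)) addnn.
move/(_ isT).
rewrite /psum (sum_interleave (fun x y => '[x, y]) (fun x y => '[x, y])).
by rewrite mul1r.
Qed.

Lemma amp_il x v w : bdd x -> amp x (il v w) = il (amp x v) (amp x w).
Proof.
move=> hx; apply: l2_ext => n; rewrite amp_coord //.
rewrite /coordl2 /= /interleave.
by case: ifP => _; rewrite -[ell2_val (amp x _) _]/(coordl2 _ _) amp_coord.
Qed.

Definition nfun M (rho : (P -> P) -> R[i]) :=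
  exists v w, forall x, M x -> rho x = '[amp x v, w].

Lemma nfun_add M rho rho' : M `<=` @bdd R P P -> nfun M rho -> nfun M rho' ->
  nfun M (fun x => rho x + rho' x).
Proof.
move=> Mb [v [w h]] [v' [w' h']]; exists (il v v'), (il w w') => x Mx.
by rewrite h // h' // amp_il ?il_ip //; apply: Mb.
Qed.

Lemma nfun_opp M rho : nfun M rho -> nfun M (fun x => - rho x).
Proof.
by move=> [v [w h]]; exists v, (- w) => x Mx; rewrite h // ipNr.
Qed.

Lemma nfun_vec M xi eta : M `<=` @bdd R P P -> nfun M (fun x => '[x xi, eta]).
Proof.
move=> Mb; exists (single 0 xi), (single 0 eta) => x /Mb bx.
by rewrite amp_single // single_ip single_coord.
Qed.

Lemma nfun_conj M M' rho (y z : P -> P) : bdd y -> bdd z -> M `<=` @bdd R P P ->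
  (forall x, M x -> M' (y \o x \o z)) -> nfun M' rho -> nfun M (fun x => rho (y \o x \o z)).
Proof.
move=> by_ bz Mb MM [v [w h]]; exists (amp z v), (amp (adj y) w) => x Mx.
rewrite h; last exact: MM.
rewrite -[y in RHS]adjK // -amp_adj ?adj_bdd // ?adjK //.
have bx := Mb _ Mx.
congr ('[_, _]); apply: l2_ext => n.
by rewrite !amp_coord //; do ?[exact: bdd_comp]; apply: bdd_comp => //; apply: bdd_comp.
Qed.

Lemma sqsum_eseries (v : nat -> P) :
  (\sum_(0 <= n <oo) (complex.Re `|v n| ^+ 2)%:E < +oo)%E <-> sqsum v.
Proof.
have pos (k : nat) : (0 <= (complex.Re `|v k| ^+ 2)%:E)%E by rewrite lee_fin sqr_ge0.
split=> [h|[C hC]].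
  have fin : (\sum_(0 <= n <oo) (complex.Re `|v n| ^+ 2)%:E)%E \is a fin_num.
    by rewrite ge0_fin_numE // nneseries_ge0.
  exists (fine (\sum_(0 <= n <oo) (complex.Re `|v n| ^+ 2)%:E)%E) => n.
  rewrite -lee_fin fineK // -sumEFin.
  have := @nneseries_lim_ge _ (fun n => (complex.Re `|v n| ^+ 2)%:E) xpredT 0 n (fun k _ _ => pos k).
  by rewrite big_mkord.
apply: (@le_lt_trans _ _ C%:E); last exact: ltry.
apply: lime_le; first exact: is_cvg_nneseries.
by apply: nearW => n; rewrite big_mkord sumEFin lee_fin; apply: hC.
Qed.

Lemma ctends_cvg (u : nat -> R[i]) (l : R[i]) : ctends u l <-> (u : nat -> R[i]^o) @ \oo --> (l : R[i]^o).
Proof.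
have nc (z : R[i]) e : (`|(z : R[i]^o)| < real_complex R e) = (normc z < e).
  by rewrite normc_def ltcR; case: z.
split=> [h|/cvgrPdist_lt h e e0].
  apply/cvgrPdist_lt => _ /complex_gt0[e e0 ->]; have [N hN] := h e e0.
  exists N => // n /= nN; by rewrite nc -normcN opprB; apply: hN.
have e0' : 0 < real_complex R e by rewrite ltcR.
have [N _ hN] := h _ e0'; exists N => n nN.
by rewrite -normcN opprB -nc; apply: hN.
Qed.

Lemma normal_nfun M rho : M `<=` @bdd R P P -> normal_functional M rho <-> nfun M rho.
Proof.
move=> Mb; split.
  move=> [v [w [/sqsum_eseries hv /sqsum_eseries hw h]]].
  exists (mkl2 hv), (mkl2 hw) => x Mx.
  have /ctends_cvg hx := h x Mx; apply: ctends_uniq hx _.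
  have := l2_tends (amp x (mkl2 hv)) (mkl2 hw); congr ctends.
  apply/funext => n; rewrite /psum big_mkord; apply: eq_bigr => i _.
  by rewrite -[ell2_val (amp x _) _]/(coordl2 _ _) amp_coord //; apply: Mb.
move=> [v [w h]]; exists (ell2_val (v : ell2 P)), (ell2_val (w : ell2 P)); split.
- by apply/sqsum_eseries/ell2_sq.
- by apply/sqsum_eseries/ell2_sq.
- move=> x Mx; apply/ctends_cvg; rewrite h //.
  have := l2_tends (amp x v) w; congr ctends.
  apply/funext => n; rewrite /psum big_mkord; apply: eq_bigr => i _.
  by rewrite -[ell2_val (amp x _) _]/(coordl2 _ _) amp_coord //; apply: Mb.
Qed.

Lemma bicommutant_bdd A : bicommutant A `<=` @bdd R P P.
Proof. by move=> x [/bounded_bdd]. Qed.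

Lemma bicommutant_comm A x y (v : P) : bicommutant A x -> commutant A y -> x (y v) = y (x v).
Proof. by move=> /commutantE[_ h] /h /(congr1 (@^~ v)) /= ->. Qed.

Lemma sub_bicommutant A : A `<=` @bdd R P P -> A `<=` bicommutant A.
Proof.
move=> Ab x Ax; apply/commutantE; split; first exact: Ab.
by move=> y /commutantE[_ ->].
Qed.

Lemma bicommutant_comp A (x y : P -> P) : bicommutant A x -> bicommutant A y -> bicommutant A (x \o y).
Proof.
move=> Mx My; apply/commutantE; split; first exact: bdd_comp (bicommutant_bdd Mx) (bicommutant_bdd My).
by move=> z hz; apply/funext => v /=; rewrite (bicommutant_comm _ My hz) (bicommutant_comm _ Mx hz).
Qed.

Lemma bicommutant_lin A c (x y : P -> P) :
  bicommutant A x -> bicommutant A y -> bicommutant A (c *: x + y).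
Proof.
move=> Mx My; apply/commutantE; split; first exact: bdd_add (bicommutant_bdd Mx) (bicommutant_bdd My).
move=> z hz; apply/funext => v /=.
have bz : bdd z by move/commutantE: hz => [].
change (z (c *: x v + y v) = c *: x (z v) + y (z v)).
by rewrite (bdd_lin _ _ _ bz) (bicommutant_comm _ Mx hz) (bicommutant_comm _ My hz).
Qed.

Lemma commutant_adj A y : star_closed A -> commutant A y -> commutant A (adj y).
Proof.
move=> [Ab _ _ Aj] /commutantE[bz hz]; apply/commutantE; split; first exact: adj_bdd.
move=> x Ax; have bx := Ab _ Ax; have bx' := adj_bdd bx.
by have := congr1 (@adj R P) (hz _ (Aj _ Ax)); rewrite (adj_comp bx' bz) (adj_comp bz bx') (adjK bx).
Qed.

Lemma bicommutant_adj A x : star_closed A -> bicommutant A x -> bicommutant A (adj x).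
Proof.
move=> sA Mx; have bx := bicommutant_bdd Mx.
apply/commutantE; split; first exact: adj_bdd.
move=> z hz; have bz : bdd z by move/commutantE: hz => [].
have bz' := adj_bdd bz.
have : x \o adj z = adj z \o x.
  by apply/funext => v /=; rewrite (bicommutant_comm _ Mx (commutant_adj sA hz)).
by move/(congr1 (@adj R P)); rewrite (adj_comp bx bz') (adj_comp bz' bx) (adjK bz).
Qed.

Lemma nfun_density A rho : star_closed A -> nfun (bicommutant A) rho ->
  (forall a, A a -> rho a = 0) -> forall x, bicommutant A x -> rho x = 0.
Proof.
move=> sA [v [w h]] hA x Mx; rewrite h //; apply: (density sA Mx) => a Aa.
by rewrite -h ?hA //; have [Ab _ _ _] := sA; exact: sub_bicommutant.
Qed.

(** An identity known on generators passes to the whole algebra: the difference of the matrix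
    coefficients of the two sides is a normal functional of [x], and [nfun_density] tests such a
    functional on [A] alone. *)
Lemma nfun_intertwine A (f g : (P -> P) -> (P -> P)) (y z : P -> P) :
  star_closed A -> bdd y -> bdd z ->
  (forall x, bicommutant A x -> bdd (f x)) -> (forall x, bicommutant A x -> bdd (g x)) ->
  (forall xi eta, nfun (bicommutant A) (fun x => '[f x xi, eta])) ->
  (forall xi eta, nfun (bicommutant A) (fun x => '[g x xi, eta])) ->
  (forall a, A a -> y \o f a = g a \o z) ->
  forall x, bicommutant A x -> y \o f x = g x \o z.
Proof.
move=> sA by_ bz bf bg nf ng h x Mx; apply/funext => xi; apply: ip_inj => eta.
apply/eqP; rewrite -subr_eq0; apply/eqP.
apply: (nfun_density sA (rho := fun x => '[y (f x xi), eta] - '[g x (z xi), eta])) Mx.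
  apply: nfun_add; first exact: bicommutant_bdd.
    have [v [w hv]] := nf xi (adj y eta); exists v, w => x' Mx'.
    by rewrite adjE // hv.
  exact: nfun_opp (ng _ _).
by move=> a /h /(congr1 (@^~ xi)) /= ->; rewrite subrr.
Qed.

End Normal.

(** * Words in fermionic generators *)

Section Words.
Context {R : realType} (I : eqType) (H : hilbert R).

(* (i, s, f) stands for the generator a_i(f), or for its adjoint when s is true. *)
Definition letter := (I * bool * H)%type.

Definition same (l m : letter) := l.1.1 == m.1.1.

Definition sgn (b : bool) : R[i] := if b then -1 else 1.

(* The scalar in the exchange relation l m = -+ m l + cc l m of two letters. *)
Definition cc (l m : letter) : R[i] :=
  if same l m && (l.1.2 != m.1.2)
  then if l.1.2 then '[m.2, l.2] else '[l.2, m.2] else 0.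

Definition star (l : letter) : letter := (l.1.1, ~~ l.1.2, l.2).

Definition cnt (i : I) (w : seq letter) := count (fun l : letter => l.1.1 == i) w.

(** Separating the exchange relation from operators lets matrix coefficients, vacuum expectations
    and their differences be treated alike. Letters of different species have sign 1 and no
    contraction. *)
Definition swaps (phi : seq letter -> R[i]) := forall u l m v,
  phi (u ++ l :: m :: v) = sgn (same l m) * phi (u ++ m :: l :: v) + cc l m * phi (u ++ v).

Lemma sgnM b c : sgn b * sgn c = sgn (b (+) c).
Proof. by case: b c => -[]; rewrite /sgn /= ?mulrNN ?mulr1 ?mul1r. Qed.

Lemma sgn_sq b : sgn b * sgn b = 1.
Proof. by rewrite sgnM addbb. Qed.

(** Each exchange leaves a contraction, which the hypothesis disposes of in one of two ways: the
    scalar vanishes, or the word without the two letters has value 0, typically by induction on the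
    length. *)
Lemma move_letter phi l v u w : swaps phi ->
  (forall v1 m v2, v = v1 ++ m :: v2 -> cc l m = 0 \/ phi (u ++ v1 ++ v2 ++ w) = 0) ->
  phi (u ++ l :: v ++ w) = sgn (odd (cnt l.1.1 v)) * phi (u ++ v ++ l :: w).
Proof.
move=> sw; elim: v u => [|m v ih] u h; first by rewrite mul1r.
rewrite /= sw.
have -> : cc l m * phi (u ++ v ++ w) = 0.
  by case: (h [::] m v erefl) => [->|/= ->]; rewrite ?mul0r ?mulr0.
rewrite addr0 -cat_rcons ih => [|v1 m' v2 e]; last first.
  have [->|] := h (m :: v1) m' v2 (congr1 (cons m) e); first by left.
  by rewrite cat_rcons; right.
by rewrite mulrA sgnM cat_rcons /= /same eq_sym oddD; case: (_ == _).
Qed.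

Definition is_normal (w : seq letter) :=
  exists f g : seq letter, [/\ w = f ++ g, all (fun l : letter => l.1.2) f
    & all (fun l : letter => ~~ l.1.2) g].

(** Wick ordering: contractions shorten the word by two letters and fall under the induction on the
    length, while the inner induction sorts the last letter of the unsorted prefix [u] into
    [f ++ g]. *)
Lemma normal_order phi : swaps phi -> (forall w, is_normal w -> phi w = 0) ->
  forall w, phi w = 0.
Proof.
move=> sw hn w; move: {2}(size w) (leqnn (size w)) => n.
elim: n w => [|n ihn] w.
  by rewrite leqn0 => /nilP ->; apply: hn; exists [::], [::].
suff key u f g : all (fun l : letter => l.1.2) f -> all (fun l : letter => ~~ l.1.2) g ->
    (size (u ++ f ++ g) <= n.+1)%N -> phi (u ++ f ++ g) = 0.
  by move=> hw; have := key w [::] [::] isT isT; rewrite !cats0; apply.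
elim/last_ind: u f g => [|u l ihu] f g hf hg hs.
  by apply: hn; exists f, g.
rewrite cat_rcons in hs *.
case ls : l.1.2; first by rewrite -cat_cons ihu //= ls.
rewrite move_letter // => [|v1 m v2 e].
  by rewrite ihu ?mulr0 //= ?ls //; move: hs; rewrite !size_cat /= !size_cat /= !addnS.
right; apply: ihn; move: hs; rewrite e !(size_cat, size_rcons) /= !(size_cat, size_rcons) /=; lia.
Qed.

End Words.

Section CARSystem.
Context {R : realType} (I : eqType) (H P : hilbert R) (a : I -> H -> P -> P).

(** Different species commute, rather than anticommute, because they will act in different tensor
    factors. *)
Definition CAR_system := [/\ forall i f, bdd (a i f),
    forall i c f g v, a i (c *: f + g) v = c *: a i f v + a i g v,
    forall i f g v, a i f (a i g v) = - a i g (a i f v),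
    forall i f g v, a i f (adj (a i g) v) = - adj (a i g) (a i f v) + '[f, g] *: v
  & forall i j f g v, i != j ->
      a i f (a j g v) = a j g (a i f v) /\ a i f (adj (a j g) v) = adj (a j g) (a i f v)].

Hypothesis hC : CAR_system.

Definition lop (l : letter I H) : P -> P :=
  if l.1.2 then adj (a l.1.1 l.2) else a l.1.1 l.2.

Lemma a_bdd i f : bdd (a i f). Proof. by case: hC. Qed.
Lemma a_lin i c f g v : a i (c *: f + g) v = c *: a i f v + a i g v.
Proof. by case: hC => _ h _ _ _; apply: h. Qed.
Lemma a_anti i f g v : a i f (a i g v) = - a i g (a i f v).
Proof. by case: hC => _ _ h _ _; apply: h. Qed.
Lemma a_car i f g v : a i f (adj (a i g) v) = - adj (a i g) (a i f v) + '[f, g] *: v.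
Proof. by case: hC => _ _ _ h _; apply: h. Qed.
Lemma a0 i v : a i 0 v = 0.
Proof. by have := a_lin i (-1) 0 0 v; rewrite scaleN1r addr0 oppr0 scaleN1r addNr. Qed.
Lemma aD i f g v : a i (f + g) v = a i f v + a i g v.
Proof. by have := a_lin i 1 f g v; rewrite !scale1r. Qed.
Lemma aZ i c f v : a i (c *: f) v = c *: a i f v.
Proof. by have := a_lin i c f 0 v; rewrite a0 !addr0. Qed.
Lemma aN i f v : a i (- f) v = - a i f v.
Proof. by rewrite -scaleN1r aZ scaleN1r. Qed.
Lemma aB i f g v : a i (f - g) v = a i f v - a i g v.
Proof. by rewrite aD aN. Qed.

Lemma adj_aD i f g v : adj (a i (f + g)) v = adj (a i f) v + adj (a i g) v.
Proof.
apply: ip_inj => w; rewrite ipDl -!adjEr; do ?exact: a_bdd.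
by rewrite -ipDr aD.
Qed.
Lemma adj_aZ i c f v : adj (a i (c *: f)) v = conjc c *: adj (a i f) v.
Proof.
apply: ip_inj => w; rewrite ipZl -!adjEr; do ?exact: a_bdd.
by rewrite aZ ipZr.
Qed.
(** The two orders of multiplication of a letter and its adjoint add up to the scalar [|f|^2]. This
    bounds letters by [|f|], and for a unit vector [f] it forbids both images of [v] from being
    small unless [v] is. *)
Lemma a_pythagoras i f v : nrm (a i f v) ^+ 2 + nrm (adj (a i f) v) ^+ 2 = (nrm f * nrm v) ^+ 2.
Proof.
have b := a_bdd i f.
rewrite -!Re_ipxx (adjEr (a i f v) v b) -(adjE (adj (a i f) v) v b) a_car ipDl ipNl ipZl.
by rewrite -raddfD /= addrA subrr add0r !ipxx -rmorphM /= exprMn.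
Qed.

Lemma lop_bdd l : bdd (lop l).
Proof. by rewrite /lop; case: ifP => _; [apply: adj_bdd|]; apply: a_bdd. Qed.

Lemma lop_star l : adj (lop l) = lop (star l).
Proof.
rewrite /lop /star /=; case: l.1.2 => //=; apply: adjK; exact: a_bdd.
Qed.

Lemma lop_swap l m v :
  lop l (lop m v) = sgn (same l m) *: lop m (lop l v) + cc l m *: v.
Proof.
case: l m => [[i s] f] [[j t] g]; rewrite /lop /cc /same /=.
have [<-|ij] := eqVneq i j; last first.
  rewrite /= scale1r scale0r addr0; case: hC => _ _ _ _ /(_ _ _ _ _ _ ij) h.
  case: s t => -[].
  - apply: ip_inj => w; rewrite -!adjEr; do ?exact: a_bdd.
    by have [-> _] := h f g w.
  - apply: ip_inj => w; rewrite -adjEr; last exact: a_bdd.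
    rewrite adjE; last exact: a_bdd.
    rewrite [RHS]adjE; last exact: a_bdd.
    rewrite -adjEr; last exact: a_bdd.
    by have [_ ->] := h f g w.
  - by have [_ ->] := h f g v.
  - by have [-> _] := h f g v.
rewrite /= scaleN1r; case: s t => -[] /=.
- rewrite scale0r addr0; apply: ip_inj => w; rewrite ipNl -!adjEr; do ?exact: a_bdd.
  by rewrite a_anti ipNr.
- by rewrite a_car opprD opprK subrK.
- exact: a_car.
- by rewrite scale0r addr0 a_anti.
Qed.

Definition wop (w : seq (letter I H)) : P -> P := foldr (fun l x => lop l \o x) idfun w.

Lemma wop_cat u w v : wop (u ++ w) v = wop u (wop w v).
Proof. by elim: u => //= l u ->. Qed.

Lemma wop_bdd w : bdd (wop w).
Proof.
elim: w => [|l w ih]; first exact: bdd_id.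
exact: bdd_comp (lop_bdd l) ih.
Qed.

Definition wstar (w : seq (letter I H)) := rev (map (@star R I H) w).

Lemma wop_star w : adj (wop w) = wop (wstar w).
Proof.
rewrite /wstar; elim: w => [|l w ih]; first exact: adj_id.
rewrite /= rev_cons adj_comp; [|exact: lop_bdd|exact: wop_bdd].
apply/funext => v; rewrite -cats1 wop_cat /= ih lop_star.
by [].
Qed.

Lemma wop_swaps Om z : swaps (fun w => '[wop w Om, z]).
Proof.
move=> u l m v; rewrite !wop_cat /= lop_swap.
by rewrite (bddD _ _ (wop_bdd u)) !(bddZ _ _ (wop_bdd u)) ipDl !ipZl.
Qed.

Definition words : set (P -> P) := range wop.

Lemma words_star_closed : star_closed words.
Proof.
split=> [_ [w _ <-]||_ _ [w _ <-] [w' _ <-]|_ [w _ <-]].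
- exact: wop_bdd.
- by exists [::].
- by exists (w ++ w') => //; apply/funext => v; rewrite wop_cat.
- by exists (wstar w); rewrite // wop_star.
Qed.

Lemma words_commutant y : bdd y ->
  (forall i f v, a i f (y v) = y (a i f v)) ->
  (forall i f v, adj (a i f) (y v) = y (adj (a i f) v)) -> commutant words y.
Proof.
move=> by_ h h'; apply/commutantE; split=> // _ [w _ <-]; apply/funext => v /=.
elim: w => //= -[[i s] f] w ih; rewrite /= ih /lop /=.
by case: s; rewrite ?h ?h'.
Qed.

Lemma commutant_lop y l v : commutant words y -> lop l (y v) = y (lop l v).
Proof.
move=> /commutantE[_ h]; have hl : words (wop [:: l]) by exists [:: l].
exact: (congr1 (@^~ v) (h _ hl)).
Qed.

End CARSystem.

(** * Right multiplication and the KMS condition *)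

Section ZeroLimits.
Context {R : realType}.
Implicit Types H P : hilbert R.

(** Bounded, weakly null sequences; the instances are orthonormal sequences and their images under
    bounded operators. *)
Definition wnull H (f : nat -> H) :=
  (exists C : R, forall n, nrm (f n) <= C) /\ forall g, ctends (fun n => '[f n, g]) 0.

Lemma wnull_bdd H (X : H -> H) f : bdd X -> wnull f -> wnull (X \o f).
Proof.
move=> bX [[C hC] h]; split=> [|g].
  case: (bX) => _ [D D0 hD]; exists (D * C) => n /=.
  by apply: le_trans (hD _) _; rewrite ler_wpM2l.
have := h (adj X g); congr ctends; apply/funext => n /=; by rewrite adjE.
Qed.

Lemma tends0_add P (u v : nat -> P) : tends u 0 -> tends v 0 -> tends (fun n => u n + v n) 0.
Proof.
move=> hu hv e e0; have e2 : 0 < e / 2 by rewrite divr_gt0.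
have [N hN] := hu _ e2; have [N' hN'] := hv _ e2.
exists (maxn N N') => n; rewrite geq_max => /andP[/hN h1 /hN' h2].
rewrite !subr0 in h1 h2 *.
by apply: le_lt_trans (nrmD _ _) _; rewrite [e]splitr ltrD.
Qed.

Lemma tends0_dom P P' (u : nat -> P) (v : nat -> P') (C : R) :
  (forall n, nrm (v n) <= C * nrm (u n)) -> tends u 0 -> tends v 0.
Proof.
move=> h hu e e0.
have C1 : 0 < `|C| + 1 by rewrite ltr_wpDl.
have eC : 0 < e / (`|C| + 1) by rewrite divr_gt0.
have [N hN] := hu _ eC; exists N => n /hN; rewrite !subr0 ltr_pdivlMr // => h1.
apply: le_lt_trans (h n) (le_lt_trans _ h1); rewrite mulrC ler_wpM2l //.
by apply: le_trans (ler_norm _) _; rewrite lerDl.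
Qed.

Lemma tends0_bdd P P' (X : P -> P') (u : nat -> P) : bdd X -> tends u 0 -> tends (X \o u) 0.
Proof. by move=> [_ [C C0 hC]]; apply: tends0_dom => n; apply: hC. Qed.

Lemma tends0_scale P (c : R[i]) (u : nat -> P) : tends u 0 -> tends (fun n => c *: u n) 0.
Proof. by apply: (@tends0_dom _ _ _ _ (normc c)) => n; rewrite nrmZ. Qed.

Lemma tends0_coef P (c : nat -> R[i]) (v : P) : ctends c 0 -> tends (fun n => c n *: v) 0.
Proof.
move=> hc e e0; have v1 : 0 < nrm v + 1 by rewrite ltr_wpDl.
have ev : 0 < e / (nrm v + 1) by rewrite divr_gt0.
have [N hN] := hc _ ev; exists N => n /hN; rewrite !subr0 ltr_pdivlMr // nrmZ => h1.
by apply: le_lt_trans h1; rewrite ler_wpM2l // lerDl.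
Qed.

(** The uniform bound [C] is what allows strong convergence to 0 to be checked on a total family. *)
Lemma closed_tends0 P P' (D : nat -> P -> P') (C : R) : (forall n, bdd (D n)) ->
  (forall n v, nrm (D n v) <= C * nrm v) -> closed_sub [set v | tends (fun n => D n v) 0].
Proof.
move=> bD hD; split=> [e e0|c x y /= hx hy|x hx e e0] /=.
- by exists 0%N => n _; rewrite bdd0 // subrr nrm0.
- have := tends0_add (tends0_scale c hx) hy; congr tends.
  by apply/funext => n; rewrite bdd_lin.
- have C1 : 0 < `|C| + 1 by rewrite ltr_wpDl.
  have eC : 0 < e / 2 / (`|C| + 1) by rewrite !divr_gt0.
  have [y /= hy xy] := hx _ eC.
  have e2 : 0 < e / 2 by rewrite divr_gt0.
  have [N hN] := hy _ e2; exists N => n /hN h1; rewrite !subr0 in h1 *.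
  rewrite -[x](subrK y) bddD //; apply: le_lt_trans (nrmD _ _) _.
  rewrite [e]splitr; apply: ltrD => //; apply: le_lt_trans (hD _ _) _.
  apply: (@le_lt_trans _ _ ((`|C| + 1) * nrm (x - y))).
    by rewrite ler_wpM2r // (le_trans (ler_norm _)) // lerDl.
  by rewrite mulrC -ltr_pdivlMr.
Qed.

End ZeroLimits.

(** [Lam] is the second quantisation of [V], where each species may have its own one-particle
    map. *)
Definition quantises {R : realType} (H P : hilbert R) (I : eqType) (a : I -> H -> P -> P) (Om : P)
    (V : I -> H -> H) (Lam : P -> P) :=
  [/\ bdd Lam, forall x y, '[Lam x, Lam y] = '[x, y], Lam Om = Om,
      forall i f v, Lam (a i f v) = a i (V i f) (Lam v)
    & forall i f v, Lam (adj (a i f) v) = adj (a i (V i f)) (Lam v)].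

(* T is the covariance of the quasi-free vacuum Om; f_kms is its KMS condition on words. *)
Record fermi_system {R : realType} (H P : hilbert R) (k : nat) (a : 'I_k -> H -> P -> P)
    (Om : P) (T Ti T1i S : H -> H) : Prop := FermiSystem {
  f_car : CAR_system a;
  f_bT : bdd T;
  f_sa : forall x y, '[T x, y] = '[x, T y];
  f_bTi : bdd Ti;
  f_TK : forall x, T (Ti x) = x;
  f_TK' : forall x, Ti (T x) = x;
  f_bT1i : bdd T1i;
  f_T1K : forall x, T1i x - T (T1i x) = x;
  f_T1K' : forall x, T1i (x - T x) = x;
  f_bS : bdd S;
  f_iso : forall x y, '[S x, S y] = '[x, y];
  f_ST : forall x, T (S x) = S (T x);
  f_Om : '[Om, Om] = 1;
  f_tot : total_fam (fun w => wop a w Om);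
  f_kms : forall i f w, '[a i (T f) (wop a w Om), Om] = '[wop a w (a i (f - T f) Om), Om];
  f_lam : forall V : 'I_k -> H -> H, (forall i, bdd (V i)) ->
    (forall i x y, '[V i x, V i y] = '[x, y]) -> (forall i x, T (V i x) = V i (T x)) ->
    exists Lam, quantises a Om V Lam }.

Section Fermions.
Context {R : realType} (H P : hilbert R) (k : nat).
Context (a : 'I_k -> H -> P -> P) (Om : P) (T Ti T1i S : H -> H).
Hypothesis hF : fermi_system a Om T Ti T1i S.

Let hC := f_car hF.
Let bT := f_bT hF.
Let Tsa := f_sa hF.
Let bTi := f_bTi hF.
Let TK := f_TK hF.
Let TK' := f_TK' hF.
Let bT1i := f_bT1i hF.
Let T1K := f_T1K hF.
Let T1K' := f_T1K' hF.
Let tot := f_tot hF.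
Let kms1 := f_kms hF.
Let ab i f : bdd (a i f) := a_bdd hC i f.
Let wb w : bdd (wop a w) := wop_bdd hC w.

Lemma wop_star_ip w x y : '[wop a w x, y] = '[x, wop a (wstar w) y].
Proof. by rewrite adjE // wop_star. Qed.

Lemma wstarK (w : seq (letter 'I_k H)) : wstar (wstar w) = w.
Proof.
rewrite /wstar -map_rev revK -map_comp map_id_in // => -[[i s] f] _.
by rewrite /star /= negbK.
Qed.

Lemma kms2 i f w :
  '[adj (a i (f - T f)) (wop a w Om), Om] = '[wop a w (adj (a i (T f)) Om), Om].
Proof.
have := congr1 (@conjc R) (kms1 i f (wstar w)); rewrite -!ipC => e.
by rewrite [RHS]wop_star_ip -(adjEr _ _ (ab i (T f))) e -wop_star_ip (adjEr _ _ (ab i _)).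
Qed.

Lemma wop_ip u w : '[wop a u Om, wop a w Om] = '[wop a (wstar w ++ u) Om, Om].
Proof. by rewrite wop_cat [RHS]wop_star_ip wstarK. Qed.

(** Boundedness comes from a Gram identity: by KMS, the Gram matrices of right multiplication by
    [a i (f - T f)] and of its formal adjoint turn into vacuum expectations with the two orders of a
    letter and an adjoint letter, and the anticommutation relation collapses their sum to a scalar
    multiple of the Gram matrix of the words. *)
Lemma right_mul_exists i f : exists2 b : P -> P, bdd b &
  (forall w, b (wop a w Om) = wop a w (a i (f - T f) Om)) /\
  (forall w, adj b (wop a w Om) = wop a w (adj (a i (T f)) Om)).
Proof.
set g := f - T f.
have key w w' : '[wop a w (a i g Om), wop a w' Om] = '[wop a w Om, wop a w' (adj (a i (T f)) Om)].
  rewrite -[in LHS](wstarK w') -wop_star_ip -wop_cat -kms1 adjE // wop_cat.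
  by rewrite wop_star_ip wstarK.
(* [extension_gram] takes a real constant; self-adjointness of [T] makes this inner product real. *)
have Creal : '[T f, g] = real_complex R (complex.Re '[T f, g]).
  have : conjc '[T f, g] = '[T f, g] by rewrite -ipC /g ipBl ipBr (Tsa f f).
  by case: '[_, _] => c d [h]; apply/eqP; rewrite eq_complex /= eqxx /=; apply/eqP; lra.
have [|b bb hb] := @extension_gram _ _ _ _ _ _ (fun w => wop a w (a i g Om))
    (fun w => wop a w (adj (a i (T f)) Om)) (complex.Re '[T f, g]) tot.
  move=> w w'; rewrite -Creal.
  have -> : '[wop a w (a i g Om), wop a w' (a i g Om)] =
    '[a i (T f) (adj (a i g) (wop a (wstar w' ++ w) Om)), Om].
    have -> : '[a i (T f) (adj (a i g) (wop a (wstar w' ++ w) Om)), Om] =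
      '[adj (a i g) (wop a (wstar w' ++ w) (a i g Om)), Om].
      exact: (kms1 i f ((i, true, g) :: wstar w' ++ w)).
    by rewrite -adjEr // wop_cat [RHS]wop_star_ip wstarK.
  have -> : '[wop a w (adj (a i (T f)) Om), wop a w' (adj (a i (T f)) Om)] =
    '[adj (a i g) (a i (T f) (wop a (wstar w' ++ w) Om)), Om].
    have -> : '[adj (a i g) (a i (T f) (wop a (wstar w' ++ w) Om)), Om] =
      '[a i (T f) (wop a (wstar w' ++ w) (adj (a i (T f)) Om)), Om].
      exact: (kms2 i f ((i, false, T f) :: wstar w' ++ w)).
    by rewrite [RHS](adjE _ _ (ab i (T f))) wop_cat [RHS]wop_star_ip wstarK.
  by rewrite -ipDl a_car // addrAC addNr add0r ipZl wop_ip.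
exists b => //; split=> // w.
apply: (total_ip tot) => w'; rewrite -adjE // hb; exact: key.
Qed.

(** Right multiplication by [a i (f - T f)]; its adjoint is right multiplication by
    [adj (a i (T f))]. Invertibility of [T] and of [1 - T] lets both kinds of letter run over all of
    [H]. *)
Definition bop i f : P -> P := s2val (cid2 (right_mul_exists i f)).

Lemma bop_bdd i f : bdd (bop i f).
Proof. exact: s2valP (cid2 (right_mul_exists i f)). Qed.
Lemma bopE i f w : bop i f (wop a w Om) = wop a w (a i (f - T f) Om).
Proof. exact: (proj1 (s2valP' (cid2 (right_mul_exists i f))) w). Qed.
Lemma adj_bopE i f w : adj (bop i f) (wop a w Om) = wop a w (adj (a i (T f)) Om).
Proof. exact: (proj2 (s2valP' (cid2 (right_mul_exists i f))) w). Qed.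

(* Right multiplication by a letter: x Om |-> x l Om. *)
Definition rb (l : letter 'I_k H) : P -> P :=
  if l.1.2 then adj (bop l.1.1 (Ti l.2)) else bop l.1.1 (T1i l.2).

Lemma rb_bdd l : bdd (rb l).
Proof. by rewrite /rb; case: ifP => _; [apply: adj_bdd|]; apply: bop_bdd. Qed.

Lemma rbE l w : rb l (wop a w Om) = wop a (rcons w l) Om.
Proof.
case: l => [[i s] f]; rewrite -cats1 wop_cat /rb /=.
by case: s; rewrite ?bopE ?adj_bopE ?TK ?T1K.
Qed.

Lemma adj_rb_true i f : adj (rb (i, true, T f)) = rb (i, false, f - T f).
Proof.
by rewrite /rb /= TK' T1K' adjK //; apply: bop_bdd.
Qed.

Lemma adj_rb_false i f : adj (rb (i, false, f - T f)) = rb (i, true, T f).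
Proof. by rewrite /rb /= TK' T1K'. Qed.

Lemma rb_comm l w v : rb l (wop a w v) = wop a w (rb l v).
Proof.
apply: (total_ind tot (Q := [set v | rb l (wop a w v) = wop a w (rb l v)])).
  apply: (@closed_eq _ _ _ (rb l \o wop a w) (wop a w \o rb l)).
    exact: bdd_comp (rb_bdd l) (wb w).
  exact: bdd_comp (wb w) (rb_bdd l).
by move=> u /=; rewrite -wop_cat !rbE rcons_cat wop_cat.
Qed.

Lemma rb_commutant l : commutant (words a) (rb l).
Proof.
apply/commutantE; split; first exact: rb_bdd.
by move=> _ [w _ <-]; apply/funext => v /=; rewrite rb_comm.
Qed.

(** The bound is linear in [|f|], hence uniform along bounded sequences of letters. The operators
    [bop i f] satisfy an anticommutation relation of their own with their adjoints, so the sum rule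
    [bsum] is the analogue of [a_pythagoras]. *)
Lemma rb_bound i s : exists2 C : R, 0 <= C & forall f v, nrm (rb (i, s, f) v) <= C * (nrm f * nrm v).
Proof.
have bsum f v : nrm (bop i f v) ^+ 2 + nrm (adj (bop i f) v) ^+ 2 =
    complex.Re '[T f, f - T f] * nrm v ^+ 2.
  have bb := bop_bdd i f.
  have e : adj (bop i f) \o bop i f = (-1) *: (bop i f \o adj (bop i f)) + ('[f - T f, T f] *: @idfun P).
    apply: (total_eq tot).
    - exact: bdd_comp (adj_bdd bb) bb.
    - apply: bdd_add; first exact: bdd_comp bb (adj_bdd bb).
      by have := bdd_add ('[f - T f, T f]) (bdd_id P) (@bdd_zero R P P); rewrite addr0.
    move=> w /=.
    change (adj (bop i f) (bop i f (wop a w Om)) = -1 *: (bop i f (adj (bop i f) (wop a w Om))) +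
       '[f - T f, T f] *: wop a w Om).
    rewrite bopE adj_bopE.
    have -> : wop a w (a i (f - T f) Om) = wop a (rcons w (i, false, f - T f)) Om.
      by rewrite -cats1 wop_cat.
    have -> : wop a w (adj (a i (T f)) Om) = wop a (rcons w (i, true, T f)) Om.
      by rewrite -cats1 wop_cat.
    rewrite bopE adj_bopE -!cats1 !wop_cat /= /lop /= a_car // (bddD _ _ (wb w)) (bddN _ (wb w)).
    by rewrite scaleN1r (bddZ _ _ (wb w)).
  rewrite -!Re_ipxx (adjEr (bop i f v) v bb) -(adjE (adj (bop i f) v) v bb).
  rewrite -[adj (bop i f) (bop i f v)]/((adj (bop i f) \o bop i f) v) e.
  change (complex.Re '[-1 *: (bop i f (adj (bop i f) v)) + '[f - T f, T f] *: v, v] +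
    complex.Re '[bop i f (adj (bop i f) v), v] = complex.Re '[T f, f - T f] * complex.Re '[v, v]).
  have -> : '[f - T f, T f] = '[T f, f - T f] by rewrite ipBl ipBr (Tsa f f).
  move: '[T f, f - T f] => c.
  rewrite ipDl scaleN1r ipNl ipZl raddfD raddfN /= addrAC addNr add0r.
  by rewrite ipxx; case: c => c d /=; ring.
have key f v : nrm (bop i f v) <= (nrm (T f) + nrm (f - T f)) * nrm v /\
    nrm (adj (bop i f) v) <= (nrm (T f) + nrm (f - T f)) * nrm v.
  have h0 : complex.Re '[T f, f - T f] <= (nrm (T f) + nrm (f - T f)) ^+ 2.
    apply: le_trans (Re_le_normc _) _; apply: le_trans (cauchy_schwarz _ _) _.
    have := sqr_ge0 (nrm (T f)); have := sqr_ge0 (nrm (f - T f)).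
    have := mulr_ge0 (nrm_ge0 (T f)) (nrm_ge0 (f - T f)).
    by rewrite sqrrD; lra.
  have h1 : complex.Re '[T f, f - T f] * nrm v ^+ 2 <= ((nrm (T f) + nrm (f - T f)) * nrm v) ^+ 2.
    by rewrite exprMn ler_wpM2r ?sqr_ge0.
  have := bsum f v; have := sqr_ge0 (nrm (bop i f v)); have := sqr_ge0 (nrm (adj (bop i f) v)).
  by split; rewrite -(@ler_pXn2r _ 2) ?nnegrE ?mulr_ge0 ?addr_ge0 ?nrm_ge0 //; lra.
have [_ [C C0 hT]] := bT; have [_ [D D0 hTi]] := bTi; have [_ [E E0 hT1i]] := bT1i.
have key2 f (v : P) c : nrm f <= c -> (nrm (T f) + nrm (f - T f)) * nrm v <= ((1 + 2 * C) * c) * nrm v.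
  move=> fc; rewrite ler_wpM2r //; have := hT f; have := nrm_triB f 0 (T f).
  rewrite subr0 sub0r nrmN.
  have : C * nrm f <= C * c by rewrite ler_wpM2l.
  lra.
exists ((1 + 2 * C) * (D + E)).
  by rewrite mulr_ge0 ?addr_ge0 ?mulr_ge0.
move=> f v; rewrite /rb /=; case: s.
  have h : nrm (Ti f) <= (D + E) * nrm f.
    by apply: le_trans (hTi _) _; rewrite ler_wpM2r // lerDl.
  have [_ h1] := key (Ti f) v; apply: (le_trans h1); apply: (le_trans (key2 _ v _ h)).
  by rewrite !mulrA.
have h : nrm (T1i f) <= (D + E) * nrm f.
  by apply: le_trans (hT1i _) _; rewrite ler_wpM2r // lerDr.
have [h1 _] := key (T1i f) v; apply: (le_trans h1); apply: (le_trans (key2 _ v _ h)).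
by rewrite !mulrA.
Qed.

Let M := bicommutant (words a).

Lemma M_bdd x : M x -> bdd x.
Proof. exact: bicommutant_bdd. Qed.

Lemma M_comm x y v : M x -> commutant (words a) y -> x (y v) = y (x v).
Proof. exact: bicommutant_comm. Qed.

Lemma M_words w : M (wop a w).
Proof. by apply: sub_bicommutant => [_ [u _ <-]//|]; exists w. Qed.

Lemma M_comp x y : M x -> M y -> M (x \o y).
Proof. exact: bicommutant_comp. Qed.

Lemma M_lin c x y : M x -> M y -> M (c *: x + y).
Proof. exact: bicommutant_lin. Qed.

Lemma M_adj x : M x -> M (adj x).
Proof. apply: bicommutant_adj; exact: words_star_closed. Qed.

(** Right multiplications commute with [x] and build every word vector from [Om], one letter at a
    time. *)
Lemma M_separating x : M x -> x Om = 0 -> x = fun=> 0.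
Proof.
move=> Mx x0; apply: (total_eq tot); [exact: M_bdd|exact: bdd_zero|] => w.
elim/last_ind: w => [|w l ih]; first exact: x0.
by rewrite -rbE (M_comm _ Mx (rb_commutant l)) ih bdd0 //; apply: rb_bdd.
Qed.

End Fermions.

(** * Second quantisation, gradings and asymptotic commutation *)

Section Quantisation.
Context {R : realType} (H P : hilbert R) (k : nat).
Context (a : 'I_k -> H -> P -> P) (Om : P) (T Ti T1i S : H -> H).
Hypothesis hF : fermi_system a Om T Ti T1i S.

Let hC := f_car hF.
Let bT := f_bT hF.
Let Tsa := f_sa hF.
Let bS := f_bS hF.
Let Siso := f_iso hF.
Let ST := f_ST hF.
Let tot := f_tot hF.
Let lb l : bdd (lop a l) := lop_bdd hC l.
Local Notation M := (bicommutant (words a)).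

Definition vword (V : 'I_k -> H -> H) (w : seq (letter 'I_k H)) : seq (letter 'I_k H) :=
  [seq (l.1.1, l.1.2, V l.1.1 l.2) | l <- w].

Lemma q_bdd V G : quantises a Om V G -> bdd G. Proof. by case. Qed.
Lemma q_iso V G x y : quantises a Om V G -> '[G x, G y] = '[x, y].
Proof. by case=> _ h _ _ _; apply: h. Qed.
Lemma q_Om V G : quantises a Om V G -> G Om = Om. Proof. by case. Qed.

Lemma q_lop V G i s f v : quantises a Om V G ->
  G (lop a (i, s, f) v) = lop a (i, s, V i f) (G v).
Proof. by case=> _ _ _ h h'; rewrite /lop /=; case: s; rewrite ?h ?h'. Qed.

Lemma q_wop V G w v : quantises a Om V G -> G (wop a w v) = wop a (vword V w) (G v).
Proof.
by move=> q; elim: w => //= -[[i s] f] w ih; rewrite (q_lop _ _ _ _ q) ih.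
Qed.

Lemma q_uniq V V' G G' : quantises a Om V G -> quantises a Om V' G' ->
  (forall i f, V i f = V' i f) -> G = G'.
Proof.
move=> q q' e; apply: (total_eq tot); [exact: q_bdd q|exact: q_bdd q'|] => w.
rewrite (q_wop _ _ q) (q_wop _ _ q') (q_Om q) (q_Om q'); congr (wop a _ Om).
by apply: eq_map => l; rewrite e.
Qed.

Lemma q_id : quantises a Om (fun=> idfun) idfun.
Proof. by split=> //; apply: bdd_id. Qed.

Lemma q_comp V V' G G' : quantises a Om V G -> quantises a Om V' G' ->
  quantises a Om (fun i => V i \o V' i) (G \o G').
Proof.
move=> [b i o h h'] [b2 i2 o2 h2 h2']; split=> /=.
- exact: bdd_comp.
- by move=> x y; rewrite i i2.
- by rewrite o2 o.
- by move=> j f v; rewrite h2 h.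
- by move=> j f v; rewrite h2' h'.
Qed.

Lemma S_adjK f : adj S (S f) = f.
Proof. by apply: ip_inj => g; rewrite -adjEr // Siso. Qed.

(** The projection onto the range of [S] for [true], onto its orthogonal complement, the cokernel,
    for [false]. *)
Definition Q (r : bool) (f : H) : H := if r then S (adj S f) else f - S (adj S f).

Lemma adjS_T f : adj S (T f) = T (adj S f).
Proof. by apply: ip_inj => g; rewrite -adjEr // Tsa ST [RHS]Tsa -adjEr //. Qed.

Lemma Q_bdd r : bdd (Q r).
Proof.
have h : bdd (S \o adj S) := bdd_comp bS (adj_bdd bS).
case: r => //; have := bdd_add (-1) h (bdd_id H); congr bdd; apply/funext => f.
by change (-1 *: S (adj S f) + f = f - S (adj S f)); rewrite scaleN1r addrC.
Qed.

Lemma Q_T r f : T (Q r f) = Q r (T f).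
Proof. by case: r; rewrite /Q ?(bddB _ _ bT) ST adjS_T. Qed.

Lemma Q_sum f : Q true f + Q false f = f.
Proof. by rewrite addrC subrK. Qed.

Lemma Q_idem r r' f : Q r (Q r' f) = if r == r' then Q r f else 0.
Proof.
have hf g : Q false g = g - Q true g by [].
have h : Q true (Q true f) = Q true f by rewrite /Q S_adjK.
have h2 : Q true (Q false f) = 0.
  by rewrite /Q !(bddB _ _ (adj_bdd bS)) S_adjK subrr (bdd0 bS).
by case: r r' => -[]; [exact: h | exact: h2 | rewrite hf h subrr | rewrite hf h2 subr0].
Qed.

Lemma Q_ip r f g : '[Q r f, g] = '[f, Q r g].
Proof.
case: r; first by rewrite /Q (adjE _ _ bS) (adjEr _ _ bS).
by rewrite /Q ipBl ipBr (adjE _ _ bS) (adjEr _ _ bS).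
Qed.

Lemma Q_ortho f g : '[Q true f, Q false g] = 0.
Proof. by rewrite Q_ip Q_idem ip0r. Qed.

Lemma Q_S r f : Q r (S f) = if r then S f else 0.
Proof. by case: r; rewrite /Q S_adjK ?subrr. Qed.

Lemma sgn_conj b : conjc (sgn b : R[i]) = sgn b.
Proof. by case: b; rewrite /sgn ?rmorphN1 ?rmorph1. Qed.

(** A self-adjoint unitary that commutes with [T], because both projections do; this is what allows
    the signs to be second quantised. *)
Definition Vp (p : 'I_k -> bool -> bool) i (f : H) : H :=
  sgn (p i true) *: Q true f + sgn (p i false) *: Q false f.

Lemma Vp_Q p i r f : Vp p i (Q r f) = sgn (p i r) *: Q r f.
Proof. by rewrite /Vp !Q_idem; case: r => /=; rewrite scaler0 ?addr0 ?add0r. Qed.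

Lemma Vp_full p i f : p i true = p i false -> Vp p i f = sgn (p i true) *: f.
Proof. by rewrite /Vp => <-; rewrite -scalerDr Q_sum. Qed.

Lemma Vp_bdd p i : bdd (Vp p i).
Proof.
rewrite (_ : Vp p i = sgn (p i true) *: Q true + (sgn (p i false) *: Q false + (fun=> 0))).
  by apply: bdd_add; [exact: Q_bdd | apply: bdd_add; [exact: Q_bdd | exact: bdd_zero]].
apply/funext => f; change (Vp p i f = sgn (p i true) *: Q true f + (sgn (p i false) *: Q false f + 0)).
by rewrite addr0.
Qed.

Lemma Vp_comp p q i f : Vp p i (Vp q i f) = Vp (fun i r => p i r (+) q i r) i f.
Proof.
rewrite {2}/Vp (bddD _ _ (Vp_bdd p i)) !(bddZ _ _ (Vp_bdd p i)) !Vp_Q !scalerA.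
by rewrite !sgnM [q i true (+) _]addbC [q i false (+) _]addbC.
Qed.

Lemma Vp_id i f : Vp (fun _ _ => false) i f = f.
Proof. by rewrite Vp_full // scale1r. Qed.

Lemma Vp_ip p i f g : '[Vp p i f, g] = '[f, Vp p i g].
Proof. by rewrite /Vp ipDl ipDr !ipZl !ipZr !sgn_conj !Q_ip. Qed.

Lemma grading_exists p : exists G, quantises a Om (Vp p) G.
Proof.
apply: (f_lam hF) => [i|i x y|i x]; first exact: Vp_bdd.
  rewrite Vp_ip Vp_comp (_ : (fun i r => _) = fun _ _ => false) ?Vp_id //.
  by apply/funext => j; apply/funext => r; rewrite addbb.
by rewrite /Vp (bddD _ _ bT) !(bddZ _ _ bT) !Q_T.
Qed.

(* The sign p i true (p i false) is attached to the letters of species i in the range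
   (cokernel) of S. *)
Definition gr p : P -> P := projT1 (cid (grading_exists p)).
Lemma gr_q p : quantises a Om (Vp p) (gr p).
Proof. exact: projT2 (cid (grading_exists p)). Qed.

Lemma gr_bdd p : bdd (gr p). Proof. exact: q_bdd (gr_q p). Qed.
Lemma gr_Om p : gr p Om = Om. Proof. exact: q_Om (gr_q p). Qed.

Lemma grM p q v : gr p (gr q v) = gr (fun i r => p i r (+) q i r) v.
Proof.
have := q_uniq (q_comp (gr_q p) (gr_q q)) (gr_q (fun i r => p i r (+) q i r)).
by move=> /(_ (fun i f => Vp_comp p q i f)) /(congr1 (@^~ v)).
Qed.

Lemma grK p v : gr p (gr p v) = v.
Proof.
rewrite grM (_ : (fun i r => _) = fun _ _ => false); last first.
  by apply/funext => j; apply/funext => r; rewrite addbb.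
by have := q_uniq (gr_q (fun _ _ => false)) q_id Vp_id => ->.
Qed.

Lemma gr_ip p x y : '[gr p x, y] = '[x, gr p y].
Proof. by rewrite -[y in LHS](grK p) (q_iso _ _ (gr_q p)). Qed.

Lemma lopZ i s c f v : lop a (i, s, sgn c *: f) v = sgn c *: lop a (i, s, f) v.
Proof.
by rewrite /lop /=; case: s; rewrite ?(aZ hC) ?(adj_aZ hC) ?sgn_conj.
Qed.

Lemma lopD i s f g v : lop a (i, s, f + g) v = lop a (i, s, f) v + lop a (i, s, g) v.
Proof. by rewrite /lop /=; case: s; rewrite ?(aD hC) ?(adj_aD hC). Qed.

Lemma gr_split p i s r f v :
  gr p (lop a (i, s, Q r f) v) = sgn (p i r) *: lop a (i, s, Q r f) (gr p v).
Proof. by rewrite (q_lop _ _ _ _ (gr_q p)) Vp_Q lopZ. Qed.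

Lemma gr_full p i s f v : p i true = p i false ->
  gr p (lop a (i, s, f) v) = sgn (p i true) *: lop a (i, s, f) (gr p v).
Proof. by move=> h; rewrite (q_lop _ _ _ _ (gr_q p)) (Vp_full _ h) lopZ. Qed.

Lemma shift_exists : exists W, quantises a Om (fun=> S) W.
Proof. exact: (f_lam hF). Qed.

(** The second quantised shift, an isometry; it implements the flow through [alpha_W], and
    compression by it is a left inverse of the flow. *)
Definition W : P -> P := projT1 (cid shift_exists).
Lemma W_q : quantises a Om (fun=> S) W.
Proof. exact: projT2 (cid shift_exists). Qed.

Lemma W_bdd : bdd W. Proof. exact: q_bdd W_q. Qed.
Lemma W_Om : W Om = Om. Proof. exact: q_Om W_q. Qed.
Lemma W_adjK v : adj W (W v) = v.
Proof. by apply: ip_inj => g; rewrite -adjEr ?(q_iso _ _ W_q) //; apply: W_bdd. Qed.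

Lemma gr_W p q v : (forall i r, q i r = p i true) -> gr p (W v) = W (gr q v).
Proof.
move=> h; suff e : gr p \o W = W \o gr q by exact: (congr1 (@^~ v) e).
apply: (q_uniq (q_comp (gr_q p) W_q) (q_comp W_q (gr_q q))) => i f /=.
rewrite (Vp_full (p := q)) ?h // /Vp !Q_S scaler0 addr0.
by rewrite (bddZ _ _ bS).
Qed.

Lemma lop_gr p i s f v : lop a (i, s, f) (gr p v) = gr p (lop a (i, s, Vp p i f) v).
Proof.
rewrite (q_lop _ _ _ _ (gr_q p)) Vp_comp (_ : (fun i r => _) = fun _ _ => false) ?Vp_id //.
by apply/funext => j; apply/funext => r; rewrite addbb.
Qed.

Lemma gr_words p y : commutant (words a) y -> commutant (words a) (gr p \o y \o gr p).
Proof.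
move=> hy; have by_ : bdd y by case/commutantE: hy.
have h i s f v : lop a (i, s, f) (gr p (y (gr p v))) = gr p (y (gr p (lop a (i, s, f) v))).
  by rewrite lop_gr (commutant_lop _ _ hy) -(q_lop _ _ _ _ (gr_q p)).
apply: words_commutant => [|i f v|i f v].
- by apply: bdd_comp (gr_bdd p); apply: bdd_comp => //; apply: gr_bdd.
- exact: (h i false).
- exact: (h i true).
Qed.

Lemma gr_M p x : M x -> M (gr p \o x \o gr p).
Proof.
move=> Mx; have bx := M_bdd Mx.
apply/commutantE; split.
  by apply: bdd_comp (gr_bdd p); apply: bdd_comp => //; apply: gr_bdd.
move=> y hy; apply/funext => v /=.
have := M_comm (gr p v) Mx (gr_words p hy); rewrite /= grK => ->.
by rewrite !grK.
Qed.

Lemma rb_W i s f v : rb hF (i, s, S f) (W v) = W (rb hF (i, s, f) v).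
Proof.
suff e : rb hF (i, s, S f) \o W = W \o rb hF (i, s, f) by exact: (congr1 (@^~ v) e).
apply: (total_eq tot) => [||w /=].
- exact: bdd_comp (rb_bdd _ _) W_bdd.
- exact: bdd_comp W_bdd (rb_bdd _ _).
- by rewrite rbE !(q_wop _ _ W_q) W_Om rbE /vword map_rcons.
Qed.

(** The full parity of species [i], blind to the splitting into range and cokernel. *)
Definition gm i : P -> P := gr (fun j _ => j == i).

Lemma gm_lop i j s f v : gm i (lop a (j, s, f) v) = sgn (j == i) *: lop a (j, s, f) (gm i v).
Proof. exact: gr_full. Qed.

Lemma gm_wop i w v : gm i (wop a w v) = sgn (odd (cnt i w)) *: wop a w (gm i v).
Proof.
elim: w => [|[[j s] f] w ih] /=; first by rewrite scale1r.
by rewrite gm_lop ih (bddZ _ _ (lb _)) scalerA sgnM oddD oddb.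
Qed.

(** On a word vector, right multiplication after the parity differs from left multiplication only by
    the contractions met on the way through the word. These scalars are inner products with [f n],
    which tend to 0, and [rb_bound] extends the convergence to all vectors. *)
Lemma rb_gm_lop i s (f : nat -> H) v : wnull f ->
  tends (fun n => rb hF (i, s, f n) (gm i v) - lop a (i, s, f n) v) 0.
Proof.
move=> hf; have [[C hC'] hfg] := hf.
have [D D0 hD] := rb_bound hF i s.
have lopn t g u : nrm (lop a (i, t, g) u) <= nrm g * nrm u.
  have h := a_pythagoras hC i g u.
  rewrite -(@ler_pXn2r _ 2) ?nnegrE ?mulr_ge0 ?nrm_ge0 // -h /lop /=.
  by case: t; rewrite ?lerDr ?lerDl sqr_ge0.
have C0 : 0 <= C by apply: le_trans (hC' 0%N).
pose X n := fun u => rb hF (i, s, f n) (gm i u) - lop a (i, s, f n) u.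
have bX n : bdd (X n).
  have := bdd_add (-1) (lb (i, s, f n)) (bdd_comp (rb_bdd hF (i, s, f n)) (gr_bdd (fun j _ => j == i))).
  congr bdd; apply/funext => u.
  change (-1 *: lop a (i, s, f n) u + rb hF (i, s, f n) (gm i u) = X n u).
  by rewrite scaleN1r addrC.
apply: (total_ind tot (Q := [set u | tends (fun n => X n u) 0])).
  apply: (closed_tends0 bX (C := D * C + C)) => n u.
  apply: le_trans (nrmD _ _) _; rewrite nrmN mulrDl lerD //.
    apply: le_trans (hD _ _) _; rewrite -mulrA ler_wpM2l //.
    have -> : nrm (gm i u) = nrm u.
      by apply/eqP; rewrite -(@eqrXn2 _ 2) ?nrm_ge0 // -!Re_ipxx (q_iso _ _ (gr_q _)).
    by rewrite ler_wpM2r.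
  by apply: le_trans (lopn _ _ _) _; rewrite ler_wpM2r.
move=> w /=.
have hcc t m : ctends (fun n => cc (i, t, f n) m) 0.
  rewrite /cc /same /=; case: (_ && _); last first.
    by move=> e e0; exists 0%N => n _; rewrite subrr normc0.
  case: t => /=; last exact: hfg.
  have := ctends_conj (hfg m.2); rewrite rmorph0; congr ctends.
  by apply/funext => n; rewrite -ipC.
(* Moving the letter through a fixed word costs finitely many contractions, each tending to 0. *)
have key (u : seq (letter 'I_k H)) xi :
    tends (fun n => lop a (i, s, f n) (wop a u xi) -
      sgn (odd (cnt i u)) *: wop a u (lop a (i, s, f n) xi)) 0.
  elim: u => [|m u ih] /=.
    move=> e e0; exists 0%N => n _ /=; by rewrite scale1r subrr subr0 nrm0.
  have := tends0_add (tends0_scale (sgn (same (i, s, f 0%N) m)) (tends0_bdd (lb m) ih))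
    (tends0_coef (wop a u xi) (hcc s m)).
  congr tends; apply/funext => n /=.
  rewrite (lop_swap hC) (bddB _ _ (lb m)) (bddZ _ _ (lb m)) scalerBr scalerA.
  rewrite sgnM /same /= addrAC; congr (_ + _ - sgn _ *: _).
  by rewrite oddD oddb eq_sym.
have := tends0_scale (-1) (key w Om); congr tends; apply/funext => n.
rewrite /X gm_wop [gm i Om]gr_Om (bddZ _ _ (rb_bdd _ _)) rbE -cats1 wop_cat scaleN1r opprB.
by [].
Qed.

(* Right multiplication by f_n lies in the commutant, and differs from left multiplication
   composed with the grading by a strongly null sequence. *)
Lemma asymptotic_commutation i s (f : nat -> H) x v : wnull f -> M x ->
  tends (fun n => lop a (i, s, f n) (x v) - gm i (x (gm i (lop a (i, s, f n) v)))) 0.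
Proof.
move=> hf Mx; have Mx' := gr_M (fun j _ => j == i) Mx.
have h1 := tends0_scale (-1) (rb_gm_lop i s (x v) hf).
have h2 := tends0_bdd (M_bdd Mx') (rb_gm_lop i s v hf).
have := tends0_add h1 h2; congr tends; apply/funext => n /=.
(* The conjugate of [x] by the parity again lies in the algebra, so it commutes with right
   multiplication. *)
have -> : rb hF (i, s, f n) (gm i (x v)) =
    gm i (x (gm i (rb hF (i, s, f n) (gm i v)))).
  have := M_comm (gm i v) Mx' (rb_commutant hF (i, s, f n)).
  by rewrite /= -/(gm i) => ->; rewrite /gm grK.
rewrite scaleN1r opprB -!/(gm i _).
have bg := gr_bdd (fun j _ => j == i).
rewrite /gm !(bddB _ _ bg) !(bddB _ _ (M_bdd Mx)) !(bddB _ _ bg).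
by rewrite addrA subrK.
Qed.

End Quantisation.

Lemma map_cat_cons (A B : Type) (f : A -> B) s v1 m v2 : map f s = v1 ++ m :: v2 ->
  exists s1 x s2, [/\ s = s1 ++ x :: s2, v1 = map f s1, m = f x & v2 = map f s2].
Proof.
elim: v1 s => [|y v1 ih] [|x s] //= [].
  by move=> <- <-; exists [::], x, s.
move=> <- /ih[s1 [x' [s2 [-> -> -> ->]]]]; by exists (x :: s1), x', s2.
Qed.

Lemma has_cat_cons (A : Type) (p : pred A) s : has p s ->
  exists s1 x s2, s = s1 ++ x :: s2 /\ p x.
Proof.
elim: s => //= x s ih; case px : (p x) => /=; first by exists [::], x, s.
by move=> /ih[s1 [y [s2 [-> py]]]]; exists (x :: s1), y, s2.
Qed.

(** * Vectors on which left and right multiplication agree *)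

Section KMSVectors.
Context {R : realType} (H P : hilbert R) (k : nat).
Context (a : 'I_k -> H -> P -> P) (Om : P) (T Ti T1i S : H -> H).
Hypothesis hF : fermi_system a Om T Ti T1i S.

Let hC := f_car hF.
Let tot := f_tot hF.
Let ab i f : bdd (a i f) := a_bdd hC i f.
Let lb l : bdd (lop a l) := lop_bdd hC l.
Let rbb l : bdd (rb hF l) := rb_bdd hF l.

(* Moving a letter around the circle: the KMS condition replaces l u by u l' and graded
   commutation brings l' back to the front, up to words with two letters removed. *)
Lemma kms_vector_step i (E : H -> H) s f u1 u2 z : bdd E -> (forall h, T (E h) = E (T h)) ->
  gm hF i z = z -> (forall t h, lop a (i, t, E h) z = rb hF (i, t, E h) z) ->
  (forall v1 m v2, u1 ++ u2 = v1 ++ m :: v2 ->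
     (forall t h, cc (i, t, E h) m = 0) \/ '[wop a (v1 ++ v2) Om, z] = 0) ->
  '[wop a (u1 ++ (i, s, E f) :: u2) Om, z] = 0.
Proof.
move=> bE ET gz hz hu; set phi := fun w => '[wop a w Om, z].
have sw : swaps phi by exact: (wop_swaps hC Om z).
have par w : phi w = sgn (odd (cnt i w)) * phi w.
  rewrite /phi -{1}gz -gr_ip -/(gm hF i _) gm_wop [gm hF i Om]gr_Om ipZl.
  by [].
have front t h : phi ((i, t, E h) :: u1 ++ u2) =
    sgn (odd (cnt i u1)) * phi (u1 ++ (i, t, E h) :: u2).
  have := @move_letter _ _ _ phi (i, t, E h) u1 [::] u2 sw; apply => v1 m v2 e.
  have e2 : u1 ++ u2 = v1 ++ m :: (v2 ++ u2) by rewrite e -catA.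
  by have [h1|h1] := hu _ _ _ e2; [left | right].
rewrite -/(phi _).
(* Words of odd degree in species [i] pair to 0 with the parity-invariant vector [z]; in the other
   case [u], without the letter, is odd, which produces the minus sign of [back]. *)
have [oc|ec] := boolP (odd (cnt i (u1 ++ (i, s, E f) :: u2))).
  have := par (u1 ++ (i, s, E f) :: u2); rewrite oc mulN1r => e.
  have {}e : phi (u1 ++ (i, s, E f) :: u2) *+ 2 = 0 by rewrite mulr2n {1}e addNr.
  by move/eqP: e; rewrite mulrn_eq0 /= => /eqP.
set u := u1 ++ u2 in front hu *.
have ou : odd (cnt i u).
  by move: ec; rewrite /cnt /u !count_cat /= eqxx add1n addnS /= negbK.
suff key : forall t h, phi ((i, t, E h) :: u) = 0.
  have := front s f; rewrite key => /esym /eqP; rewrite mulf_eq0 => /orP[/eqP h|/eqP //].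
  by have := sgn_sq (odd (cnt i u1) : bool) (R := R); rewrite h mul0r => /esym/eqP; rewrite oner_eq0.
have back t h : phi (rcons u (i, t, E h)) = - phi ((i, t, E h) :: u).
  have := @move_letter _ _ _ phi (i, t, E h) u [::] [::] sw; rewrite /= !cats0 ou mulN1r.
  move=> -> ; first by rewrite opprK cats1.
  by move=> v1 m v2 e; have [h1|h1] := hu v1 m v2 e; [left; apply: h1 | right; rewrite cats0].
have add t h h' : phi ((i, t, E h) :: u) + phi ((i, t, E h') :: u) = phi ((i, t, E h + E h') :: u).
  by rewrite /phi /= (lopD hF) ipDl.
have EB h : E (h - T h) = E h - T (E h) by rewrite (bddB _ _ bE) ET.
move=> t h.
(* Taking a letter to the other side turns it into its adjoint acting on [z], where left and right
   multiplication agree; the adjoint of that right multiplication appends the complementary letter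
   at the end. With [back], the [T] part and the [1 - T] part of [E h] have opposite values, so
   their sum vanishes. *)
have hf : phi ((i, false, T (E h)) :: u) = - phi ((i, false, E h - T (E h)) :: u).
  rewrite -EB -back EB /phi -(rbE hF) -adj_rb_true -(adjEr _ _ (rbb _)) ET -hz.
  exact: (adjE _ _ (ab i (E (T h)))).
have ht : phi ((i, true, E h - T (E h)) :: u) = - phi ((i, true, T (E h)) :: u).
  rewrite ET -back /phi -(rbE hF) -ET -adj_rb_false -(adjEr _ _ (rbb _)) -EB -hz.
  exact: (esym (adjEr _ _ (ab i _))).
case: t.
  have := add true (h - T h) (T h); rewrite EB -ET subrK => <-.
  by rewrite -EB EB ht addNr.
have := add false (T h) (h - T h); rewrite -(bddD _ _ bE) [T h + _]addrC subrK => <-.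
by rewrite EB -ET hf addNr.
Qed.

(** After the component along [Om] is removed, [kms_vector_step] with [E := idfun] reduces the
    pairing with a word to words with two letters fewer, down to the empty word. This yields both
    the trivial centre and the scalar compressions below. *)
Lemma kms_vector_vacuum z : (forall i, gm hF i z = z) ->
  (forall l, lop a l z = rb hF l z) -> z = '[z, Om] *: Om.
Proof.
move=> gz hz; set y := z - '[z, Om] *: Om.
suff y0 : y = 0 by apply/eqP; rewrite -subr_eq0 -/y y0.
have gy i : gm hF i y = y.
  by rewrite /y /gm (bddB _ _ (gr_bdd _ _)) (bddZ _ _ (gr_bdd _ _)) gr_Om -/(gm hF i z) gz.
have rO l : lop a l Om = rb hF l Om by rewrite -[X in rb hF l X]/(wop a [::] Om) rbE.
have hy l : lop a l y = rb hF l y.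
  by rewrite /y (bddB _ _ (lb l)) (bddB _ _ (rbb l)) (bddZ _ _ (lb l)) (bddZ _ _ (rbb l)) hz rO.
apply: (total_ip0 tot) => w; move: {2}(size w) (leqnn (size w)) => n.
elim: n w => [|n ih] [|[[i s] f] w] //= hw.
- by rewrite /y ipBr ipZr (f_Om hF) mulr1 -ipC subrr.
- by rewrite /y ipBr ipZr (f_Om hF) mulr1 -ipC subrr.
- apply: (@kms_vector_step i idfun s f [::] w y (bdd_id H)) => // v1 m v2 /= e.
  right; apply: ih; rewrite -ltnS; apply: leq_trans hw.
  by rewrite e !size_cat /= addnS !ltnS.
Qed.

(** The second boolean of a split letter records whether its vector is projected to the range or to
    the cokernel of [S]. *)
Definition spl (m : 'I_k * bool * bool * H) : letter 'I_k H :=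
  (m.1.1.1, m.1.1.2, Q S m.1.2 m.2).
Definition wsp w := wop a (map spl w).

Lemma wsp_total : total_fam (fun w => wsp w Om).
Proof.
have cK := clspan_closed (fun w => wsp w Om).
have spK m v : clspan (fun w => wsp w Om) v -> clspan (fun w => wsp w Om) (lop a (spl m) v).
  move: v; apply: clspan_min => [|w]; last exact: (clspan_mem _ (m :: w)).
  case: cK => K0 KD Kc; split=> /= [|c x y hx hy|x hx].
  - by rewrite (bdd0 (lb _)).
  - by rewrite (bdd_lin _ _ _ (lb _)); apply: KD.
  - apply: Kc => e e0; have [C C0 hC'] := bdd_near (lb (spl m)).
    have eC : 0 < e / C by rewrite divr_gt0.
    have [y hy xy] := hx _ eC; exists (lop a (spl m) y) => //.
    by apply: le_lt_trans (hC' _ _) _; rewrite mulrC -ltr_pdivlMr.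
have wK w : clspan (fun w => wsp w Om) (wop a w Om).
  elim: w => [|[[i s] f] w ih] /=; first exact: (clspan_mem _ [::]).
  rewrite -[f](Q_sum S) (lopD hF); apply: (closed_add cK).
    exact: (spK (i, s, true, f)).
  exact: (spK (i, s, false, f)).
by move=> x; apply: (total_ind tot cK wK).
Qed.

(** [Gin i] is the parity in cokernel letters of species [i], [Gout i] that in its range letters;
    their product is [gm i]. *)
Definition Gin i : P -> P := gr hF (fun j r => (j == i) && ~~ r).
Definition Gout i : P -> P := gr hF (fun j r => (j == i) && r).

Lemma gm_in_out i v : gm hF i v = Gin i (Gout i v).
Proof.
rewrite /Gin grM /gm; congr (gr hF _ v).
by apply/funext => j; apply/funext => -[]; case: (j == i).
Qed.

Definition cout i (w : seq ('I_k * bool * bool * H)) := count (fun m => (m.1.1.1 == i) && m.1.2) w.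

Lemma Gout_wsp i w v : Gout i (wsp w v) = sgn (odd (cout i w)) *: wsp w (Gout i v).
Proof.
elim: w => [|[[[j s] r] f] w ih] /=; first by rewrite scale1r.
by rewrite /Gout gr_split -/(Gout i _) ih (bddZ _ _ (lb _)) scalerA sgnM oddD oddb.
Qed.

(** Left and right multiplication need agree on [z] for range letters only: in [kms_vector_step]
    with [E := Q S true], a range letter has no contraction with cokernel letters or with other
    species. A contraction with a range letter of species [i] removes two of them, so the count
    stays odd and induction applies. *)
Lemma Gout_vector i z : gm hF i z = z ->
  (forall s f, lop a (i, s, Q S true f) z = rb hF (i, s, Q S true f) z) -> Gout i z = z.
Proof.
move=> gz hz; apply: (total_ip wsp_total) => w; rewrite -gr_ip -/(Gout i _) Gout_wsp.
rewrite [Gout i Om]gr_Om ipZl.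
have [od|_] := boolP (odd (cout i w)); last by rewrite mul1r.
suff -> : '[wsp w Om, z] = 0 by rewrite mulr0.
move: {2}(size w) (leqnn (size w)) od => n; elim: n w => [|n ih] w.
  by rewrite leqn0 => /nilP ->.
move=> hw o; have hh : has (fun m => (m.1.1.1 == i) && m.1.2) w.
  by rewrite has_count -/(cout i w); case: (cout i w) o.
have [w1 [[[[j s] r] f] [w2 [ew /= /andP[/eqP ej rt]]]]] := has_cat_cons hh.
rewrite ej rt in ew; rewrite ew in hw o *; rewrite /wsp map_cat /=.
apply: (kms_vector_step (E := Q S true)) => //.
- exact: (Q_bdd hF).
- exact: (Q_T hF).
move=> v1 m v2; rewrite -map_cat => ee; have [s1 [[[[j' s'] r'] f'] [s2 [e -> -> ->]]]] := map_cat_cons ee.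
have [jr|jr] := boolP ((j' == i) && r'); last first.
  left=> t h; rewrite /cc /same /=; case: eqP => //= ij.
  move: jr; rewrite -ij eqxx /= => /negPf ->.
  case: ifP => // _; case: t => /=; last exact: (Q_ortho hF).
  by rewrite ipC (Q_ortho hF) rmorph0.
right; rewrite -map_cat; apply: ih.
  have : size (w1 ++ w2) = size (s1 ++ (j', s', r', f') :: s2) by rewrite e.
  move: hw; rewrite !size_cat /=; lia.
have : cout i (w1 ++ w2) = cout i (s1 ++ (j', s', r', f') :: s2) by rewrite e.
move: o; rewrite /cout !count_cat /= eqxx jr; lia.
Qed.

End KMSVectors.

(** * The relative commutant and its normalisers *)

Section Flow.
Context {R : realType} (H P : hilbert R) (k : nat).
Context (a : 'I_k -> H -> P -> P) (Om : P) (T Ti T1i S : H -> H).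
Hypothesis hF : fermi_system a Om T Ti T1i S.

Let hC := f_car hF.
Let bS := f_bS hF.
Let Siso := f_iso hF.
Let ST := f_ST hF.
Let tot := f_tot hF.
Let wb w : bdd (wop a w) := wop_bdd hC w.
Let lb l : bdd (lop a l) := lop_bdd hC l.
Local Notation M := (bicommutant (words a)).
Variable alpha : (P -> P) -> (P -> P).
Hypothesis alM : star_hom M M alpha.
Hypothesis alN : normal_map M alpha.
Hypothesis alA : forall i f, alpha (a i f) = a i (S f).
Variable en : nat -> H.
Hypothesis en_ker : forall n, adj S (en n) = 0.
Hypothesis en_norm : forall n, nrm (en n) = 1.
Hypothesis en_null : wnull en.
Let rbb l : bdd (rb hF l) := rb_bdd hF l.
Let gmb i : bdd (gm hF i) := gr_bdd hF _.
Let Ginb i : bdd (Gin hF i) := gr_bdd hF _.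
Let Mb x : M x -> bdd x := @bicommutant_bdd _ _ _ x.

Lemma M_lop l : M (lop a l).
Proof. exact: (M_words hF [:: l]). Qed.

Lemma alpha_M x : M x -> M (alpha x).
Proof. by case: alM => h _ _ _ _; apply: h. Qed.
Lemma alpha_comp x y : M x -> M y -> alpha (x \o y) = alpha x \o alpha y.
Proof. by case: alM => _ _ _ h _; apply: h. Qed.
Lemma alpha_id : alpha idfun = idfun.
Proof. by case: alM. Qed.
Lemma alpha_adj x : M x -> alpha (adj x) = adj (alpha x).
Proof. by case: alM => _ _ _ _ h; apply: h. Qed.

Lemma alpha_lop i s f : alpha (lop a (i, s, f)) = lop a (i, s, S f).
Proof. by rewrite /lop /=; case: s; rewrite ?(alpha_adj (M_lop (i, false, f))) alA. Qed.

Lemma alpha_wop w : alpha (wop a w) = wop a (vword (fun=> S) w).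
Proof.
elim: w => [|[[i s] f] w ih] /=; first exact: alpha_id.
by rewrite alpha_comp ?alpha_lop ?ih //; [exact: M_lop | exact: (M_words hF)].
Qed.

Lemma alpha_nfun xi eta : nfun M (fun x => '[alpha x xi, eta]).
Proof.
apply/normal_nfun; first exact: bicommutant_bdd.
apply: (alN (rho := fun x => '[x xi, eta])); apply/normal_nfun; first exact: bicommutant_bdd.
by apply: nfun_vec; apply: bicommutant_bdd.
Qed.

Lemma id_nfun xi eta : nfun M (fun x => '[x xi, eta]).
Proof. by apply: nfun_vec; apply: bicommutant_bdd. Qed.

(** The image of the flow is generated, through normality, by the letters with vectors in the range
    of [S]. *)
Lemma commute_range y : bdd y ->
  (forall i s f v, y (lop a (i, s, S f) v) = lop a (i, s, S f) (y v)) ->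
  forall x v, M x -> y (alpha x v) = alpha x (y v).
Proof.
move=> by_ hy x v Mx; suff : y \o alpha x = alpha x \o y by move/(congr1 (@^~ v)).
refine (nfun_intertwine (f := alpha) (g := alpha) (words_star_closed hC) by_ by_ _ _ _ _ _ Mx).
- by move=> z /alpha_M/Mb.
- by move=> z /alpha_M/Mb.
- exact: alpha_nfun.
- exact: alpha_nfun.
move=> _ [w _ <-]; rewrite alpha_wop; apply/funext => u /=.
by elim: w u => //= -[[i s] f] w ih u; rewrite hy ih.
Qed.

Lemma alpha_W x v : M x -> alpha x (W hF v) = W hF (x v).
Proof.
move=> Mx; suff : W hF \o x = alpha x \o W hF by move/(congr1 (@^~ v)).
have bW := W_bdd hF.
refine (nfun_intertwine (f := id) (g := alpha) (words_star_closed hC) bW bW _ _ _ _ _ Mx).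
- exact: Mb.
- by move=> z /alpha_M/Mb.
- exact: id_nfun.
- exact: alpha_nfun.
move=> _ [w _ <-]; rewrite alpha_wop; apply/funext => u /=.
by rewrite (q_wop _ _ (W_q hF)).
Qed.

Lemma adjW_alpha x v : M x -> adj (W hF) (alpha x v) = x (adj (W hF) v).
Proof.
move=> Mx; have bW := W_bdd hF; apply: ip_inj => u; rewrite -(adjEr _ _ bW).
have Mx' := M_adj hF Mx.
rewrite [LHS](adjE _ _ (Mb (alpha_M Mx))) -alpha_adj // alpha_W // (adjEr _ _ bW).
by rewrite -(adjE _ _ (Mb Mx)).
Qed.

Lemma alpha_inj x : M x -> alpha x = (fun=> 0) -> x = fun=> 0.
Proof.
move=> Mx h; apply/funext => v.
by rewrite -(W_adjK hF (x v)) -alpha_W // h (bdd0 (adj_bdd (W_bdd hF))).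
Qed.

Lemma Gin_alpha i x v : M x -> Gin hF i (alpha x v) = alpha x (Gin hF i v).
Proof.
move=> Mx; apply: commute_range => //.
move=> j s f u; rewrite -[S f](Q_S hF true f) /Gin gr_split /= andbF.
by rewrite scale1r.
Qed.

Lemma gm_M i x : M x -> M (gm hF i \o x \o gm hF i). Proof. exact: gr_M. Qed.

Lemma wnull_S : wnull (S \o en). Proof. exact: wnull_bdd. Qed.

(** By [a_pythagoras] with unit vectors, the norm of [v] is computed from the two images, which tend
    to 0. *)
Lemma null_letters i (f : nat -> H) v : (forall n, nrm (f n) = 1) ->
  (forall s, tends (fun n => lop a (i, s, f n) v) 0) -> v = 0.
Proof.
move=> nf hf; apply: nrm_eq0; apply/eqP; rewrite -sqrf_eq0 eq_le sqr_ge0 andbT.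
apply: (@le0_eps _ _ 2) => e e0.
(* For [e <= 1] a square below [e ^+ 2] is also below [e], which is the linear form that [le0_eps]
   expects. *)
wlog e1 : e e0 / e <= 1 => [h|].
  have [e1|e1] := leP e 1; first exact: h.
  by have := h 1 ltr01 (lexx _); lra.
have [N hN] := hf false e e0; have [N' hN'] := hf true e e0.
have h1 := hN (maxn N N') (leq_maxl _ _); have h2 := hN' (maxn N N') (leq_maxr _ _).
rewrite !subr0 /lop /= in h1 h2.
have := a_pythagoras hC i (f (maxn N N')) v; rewrite nf mul1r => <-.
have sq (x : R) : 0 <= x -> x < e -> x ^+ 2 <= e.
  move=> x0 xe; rewrite expr2 -[e]mulr1; apply: ler_pM => //; first exact: ltW.
  exact: ltW (lt_le_trans xe e1).
have := sq _ (nrm_ge0 _) h1; have := sq _ (nrm_ge0 _) h2; lra.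
Qed.

Definition rel_commutant x := M x /\ forall y v, M y -> x (alpha y v) = alpha y (x v).

Lemma rel_commutant_lop x i s f v : rel_commutant x ->
  x (lop a (i, s, S f) v) = lop a (i, s, S f) (x v).
Proof. by move=> [_ h]; rewrite -alpha_lop h //; apply: M_lop. Qed.

(* A letter a_i(S e_n) commutes with x, and asymptotically graded-commutes with it. *)
Lemma rel_commutant_gm i x v : rel_commutant x -> gm hF i (x (gm hF i v)) = x v.
Proof.
move=> hx; have [Mx _] := hx; apply/esym/eqP; rewrite -subr_eq0; apply/eqP.
apply: (@null_letters i (S \o en)) => [n|s] /=.
  by apply/eqP; rewrite -(@eqrXn2 _ 2) ?nrm_ge0 // -Re_ipxx Siso Re_ipxx en_norm.
have := asymptotic_commutation hF i s v wnull_S Mx; congr tends; apply/funext => n /=.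
rewrite (bddB _ _ (lb _)); congr (_ - _).
rewrite gm_lop eqxx (bddZ _ _ (Mb Mx)) (rel_commutant_lop _ _ _ _ hx).
by rewrite (bddZ _ _ (gmb i)) gm_lop eqxx scalerA sgn_sq scale1r.
Qed.

Lemma rel_commutant_gmE i x v : rel_commutant x -> gm hF i (x v) = x (gm hF i v).
Proof. by move=> hx; rewrite -(rel_commutant_gm i v hx) [gm hF i (gm hF i _)]grK. Qed.

(** [Gin i] is the product of [gm i] and [Gout i]. The first commutes with [x] by asymptotic
    commutation; the second fixes [x Om] by the KMS argument, because [x] commutes with range
    letters and with right multiplications. *)
Lemma rel_commutant_Gin i x v : rel_commutant x -> Gin hF i (x v) = x (Gin hF i v).
Proof.
move=> hx; have [Mx _] := hx.
have gmx u := rel_commutant_gmE i u hx.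
have goz : Gout hF i (x Om) = x Om.
  apply: Gout_vector; first by rewrite gmx [gm hF i Om]gr_Om.
  move=> s f; rewrite -[Q S true f]/(S (adj S f)) -rel_commutant_lop //.
  rewrite -[lop a _ Om]/(wop a (rcons [::] _) Om) -(rbE hF) (M_comm _ Mx (rb_commutant hF _)).
  by [].
(* The separating vector lifts invariance of [x Om] to the operator [x]. *)
have gox u : Gout hF i (x u) = x (Gout hF i u).
  have Mgx := gr_M hF (fun j r => (j == i) && r) Mx.
  have My : M ((-1) *: x + (Gout hF i \o x \o Gout hF i)) by apply: M_lin.
  have e := M_separating hF My.
  have e0 : (-1) *: x + (Gout hF i \o x \o Gout hF i) = fun=> 0.
    apply: e; change (-1 *: x Om + Gout hF i (x (Gout hF i Om)) = 0).
    by rewrite [Gout hF i Om]gr_Om goz scaleN1r addNr.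
  have e1 : -1 *: x (Gout hF i u) + Gout hF i (x (Gout hF i (Gout hF i u))) = 0.
    exact: (congr1 (@^~ (Gout hF i u)) e0).
  move: e1; by rewrite scaleN1r [Gout hF i (Gout hF i u)]grK addrC => /eqP; rewrite subr_eq0 => /eqP.
have gin u : Gin hF i u = gm hF i (Gout hF i u).
  by rewrite gm_in_out [Gout hF i (Gout hF i u)]grK.
by rewrite !gin gox gmx.
Qed.

(** Cokernel letters. Their products with an even number of letters in every species supply elements
    of the relative commutant. *)
Definition inner_letter (m : 'I_k * bool * H) : letter 'I_k H := (m.1.1, m.1.2, Q S false m.2).
Definition inner_op q := wop a (map inner_letter q).
Definition cin i (q : seq ('I_k * bool * H)) := count (fun m => m.1.1 == i) q.

Lemma inner_swap i s f q v :
  lop a (i, s, S f) (inner_op q v) = sgn (odd (cin i q)) *: inner_op q (lop a (i, s, S f) v).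
Proof.
elim: q => [|[[j t] g] q ih] /=; first by rewrite scale1r.
have -> : lop a (i, s, S f) (lop a (inner_letter (j, t, g)) (inner_op q v)) =
    sgn (i == j) *: lop a (inner_letter (j, t, g)) (lop a (i, s, S f) (inner_op q v)).
  rewrite (lop_swap hC) (_ : cc _ _ = 0) ?scale0r ?addr0 //.
  rewrite /cc /same /= -(Q_S hF true f); case: ifP => // _.
  by clear ih; case: s; rewrite ?(Q_ortho hF) // ipC (Q_ortho hF) rmorph0.
by rewrite ih (bddZ _ _ (lb _)) scalerA sgnM oddD oddb eq_sym.
Qed.

Lemma Gin_inner i q v : Gin hF i (inner_op q v) = sgn (odd (cin i q)) *: inner_op q (Gin hF i v).
Proof.
elim: q => [|[[j s] f] q ih] /=; first by rewrite scale1r.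
by rewrite /Gin gr_split -/(Gin hF i _) ih (bddZ _ _ (lb _)) scalerA sgnM oddD oddb andbT.
Qed.

Lemma even_rel_commutant q : (forall i, ~~ odd (cin i q)) -> rel_commutant (inner_op q).
Proof.
move=> hq; split; first exact: (M_words hF).
move=> y v; apply: commute_range => [|i s f u]; first exact: wb.
by rewrite inner_swap (negPf (hq i)) scale1r.
Qed.

(** Commutation with range letters is given; for a single cokernel letter, which is odd and so
    outside the relative commutant, its commutator [y] with [x] is shown to vanish. Then [x]
    commutes with all letters, and [kms_vector_vacuum] makes [x Om] a multiple of [Om]. *)
Lemma rel_center x : rel_commutant x ->
  (forall y v, rel_commutant y -> x (y v) = y (x v)) -> exists c : R[i], forall v, x v = c *: v.
Proof.
move=> hx hc; have [Mx _] := hx.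
have gmx i u := rel_commutant_gmE i u hx.
have xin i s f v : x (lop a (i, s, Q S false f) v) = lop a (i, s, Q S false f) (x v).
  set l := (i, s, Q S false f).
  pose y := (-1) *: (lop a l \o x) + (x \o lop a l).
  have My : M y by apply: M_lin; apply: M_comp => //; apply: M_lop.
  have yE u : y u = x (lop a l u) - lop a l (x u).
    by change (-1 *: lop a l (x u) + x (lop a l u) = x (lop a l u) - lop a l (x u)); rewrite scaleN1r addrC.
  suff y0 u : gm hF i (y (gm hF i u)) = 0.
    have := y0 (gm hF i v); rewrite /gm grK => /(congr1 (gr hF (fun j _ => j == i))).
    by rewrite grK (bdd0 (gr_bdd _ _)) yE => /eqP; rewrite subr_eq0 => /eqP.
  apply: (@null_letters i en) => // t.
  have Qen n : en n = Q S false (en n) by rewrite /Q en_ker (bdd0 bS) subr0.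
  (* The even product of the letter [l] with a letter of [en n] commutes with [x], so [y] applied
     after the latter letter only sees the asymptotic commutator of [x] with that letter. Asymptotic
     commutation for [y] then moves the letter to the front, where [null_letters] applies. *)
  have key w : tends (fun n => y (lop a (i, t, en n) w)) 0.
    have := tends0_bdd (lb l) (asymptotic_commutation hF i t w en_null Mx).
    congr tends; apply/funext => n /=.
    rewrite yE gmx [gm hF i (gm hF i _)]grK (bddB _ _ (lb l)); congr (_ - _).
    have hq : rel_commutant (inner_op [:: (i, s, f); (i, t, en n)]).
      by apply: even_rel_commutant => j; rewrite /cin /=; case: (i == j).
    by rewrite (Qen n); exact: (esym (hc _ w hq)).
  have My' := gm_M i My.
  have h := tends0_add (asymptotic_commutation hF i t u en_null My') (key u).
  move: h; congr tends; apply/funext => n /=.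
  by rewrite [gm hF i (gm hF i (y _))]grK [gm hF i (gm hF i _)]grK subrK.
have xlop i s f v : x (lop a (i, s, f) v) = lop a (i, s, f) (x v).
  have e u : lop a (i, s, f) u = lop a (i, s, Q S true f) u + lop a (i, s, Q S false f) u.
    by rewrite -(lopD hF) Q_sum.
  rewrite !e (bddD _ _ (Mb Mx)) xin.
  by rewrite -[Q S true f]/(S (adj S f)) (rel_commutant_lop _ _ _ _ hx).
have xwop w v : x (wop a w v) = wop a w (x v).
  by elim: w v => //= -[[i s] f] w ih v; rewrite xlop ih.
exists '[x Om, Om] => v.
have xOm : x Om = '[x Om, Om] *: Om.
  apply: (kms_vector_vacuum (hF := hF)) => [i|[[i s] f]]; first by rewrite gmx [gm hF i Om]gr_Om.
  rewrite -xlop -[lop a _ Om]/(wop a (rcons [::] _) Om) -(rbE hF).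
  by rewrite (M_comm _ Mx (rb_commutant hF _)).
have bc : bdd (fun v : P => '[x Om, Om] *: v).
  have := bdd_add ('[x Om, Om]) (bdd_id P) (@bdd_zero R P P); congr bdd.
  apply/funext => u; change ('[x Om, Om] *: u + 0 = '[x Om, Om] *: u); exact: addr0.
apply: (congr1 (@^~ v) (total_eq tot (Mb Mx) bc _)) => w.
by rewrite xwop {1}xOm (bddZ _ _ (wb w)).
Qed.

(** With [g] the grading, [q = adj w g w g] lies in the relative commutant because [g] fixes the
    image of the flow and [w] normalises it. It is central there because [y] and [w y adj w] are
    both fixed by [g]. Hence it is a scalar, and its square is 1. *)
Lemma unit_degree w : M w -> (forall v, w (adj w v) = v) -> (forall v, adj w (w v) = v) ->
  (forall x, M x -> exists2 y, M y & forall v, w (alpha x v) = alpha y (w v)) ->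
  (forall x, M x -> exists2 y, M y & forall v, w (alpha y v) = alpha x (w v)) ->
  forall i, exists b : bool, forall v, Gin hF i (w v) = sgn b *: w (Gin hF i v).
Proof.
move=> Mw w1 w2 hw hw' i; set g := Gin hF i.
have gg u : g (g u) = u by exact: grK.
have bw := Mb Mw; have Mw' := M_adj hF Mw.
have Mgwg : M (g \o w \o g) := gr_M hF _ Mw.
pose q := adj w \o (g \o w \o g).
have Mq : M q by apply: M_comp.
have inv x y : (forall v, w (alpha x v) = alpha y (w v)) ->
    forall z, adj w (alpha y z) = alpha x (adj w z).
  by move=> e z; rewrite -{1}(w1 z) -e w2.
have hq : rel_commutant q.
  split=> // y v My; have [y' My' e] := hw y My.
  rewrite /q /= -/g [g (alpha y v)]Gin_alpha // e [g (alpha y' _)]Gin_alpha //.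
  exact: inv.
have qg v : g (q (g v)) = q v by rewrite -[q v](gg) [g (q v)]rel_commutant_Gin.
(* Invariance of [q] under [g] identifies it with [g (adj w) g w], which is its inverse. *)
have qq v : q (q v) = v.
  by rewrite -[q v in LHS]qg /q /= -/g !gg w1 gg w2.
have qc y v : rel_commutant y -> q (y v) = y (q v).
  move=> hy; have [My _] := hy.
  have hm : rel_commutant (w \o y \o adj w).
    split; first by apply: M_comp => //; apply: M_comp.
    move=> x u Mx; have [x' Mx' e] := hw' x Mx; rewrite /= (inv _ _ e).
    by have [_ ->] := hy; rewrite // e.
  rewrite /q /= -/g [g (y v)]rel_commutant_Gin // -/g.
  have := rel_commutant_Gin i (w (g v)) hm; rewrite /= w2 -/g => ->.
  by rewrite !w2.
have [c hc] := rel_center hq qc.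
have c2 : c * c = 1.
  have := qq Om; rewrite !hc scalerA => /(congr1 (fun v => '[v, Om])).
  by rewrite ipZl (f_Om hF) mulr1.
have gw v : g (w v) = c *: w (g v).
  by rewrite -(bddZ _ _ bw) -hc /q /= -/g gg w1.
have : (c - 1) * (c + 1) = 0 by rewrite -subr_sqr expr1n expr2 c2 subrr.
move/eqP; rewrite mulf_eq0 subr_eq0 addr_eq0 => /orP[/eqP e|/eqP e].
  by exists false => v; rewrite gw e.
by exists true => v; rewrite gw e.
Qed.

Local Notation W := (W hF).
Let bW : bdd W := W_bdd hF.

Lemma Gin_W i x : Gin hF i (W x) = W x.
Proof.
suff e : Gin hF i \o W = W by exact: (congr1 (@^~ x) e).
apply: (q_uniq hF (q_comp (gr_q hF _) (W_q hF)) (W_q hF)) => j f /=.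
by rewrite /Vp !(Q_S hF) andbF scale1r scaler0 addr0.
Qed.

Lemma adjW_lop i s f v : adj W (lop a (i, s, S f) v) = lop a (i, s, f) (adj W v).
Proof. by rewrite -alpha_lop adjW_alpha //; apply: M_lop. Qed.

Lemma adjW_rb i s f v : adj W (rb hF (i, s, S f) v) = rb hF (i, s, f) (adj W v).
Proof.
have [s' [f' [h h']]] : exists s' f', adj (rb hF (i, s, f)) = rb hF (i, s', f') /\
    adj (rb hF (i, s, S f)) = rb hF (i, s', S f').
  case: s.
    exists false, (Ti f - f); have e : f = T (Ti f) := esym (f_TK hF f); split.
      by rewrite {1}e adj_rb_true (f_TK hF).
    by rewrite {1}e -ST adj_rb_true ST (f_TK hF) (bddB _ _ bS).
  exists true, (T (T1i f)); have e : f = T1i f - T (T1i f) := esym (f_T1K hF f); split.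
    by rewrite {1}e adj_rb_false.
  by rewrite {1}e (bddB _ _ bS) -ST adj_rb_false.
apply: ip_inj => u; rewrite -(adjEr _ _ bW) [LHS](adjE _ _ (rbb _)) h' rb_W (adjEr _ _ bW).
by rewrite -h -(adjE _ _ (rbb _)).
Qed.

(** Compression by [W] acts on cokernel words as a slice map. An odd word is killed because the
    grading fixes the range of [W]; an even one commutes with range letters, so its compressed
    vacuum vector meets the conditions of [kms_vector_vacuum]. *)
Lemma inner_slice q : exists c : R[i], forall v, adj W (inner_op q (W v)) = c *: v.
Proof.
have [/existsP[i oi]|] := boolP [exists i, odd (cin i q)].
  exists 0 => v; rewrite scale0r; apply: ip_eq0 => u; rewrite -(adjEr _ _ bW).
  have := gr_ip hF (fun j r => (j == i) && ~~ r) (inner_op q (W v)) (W u).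
  rewrite -/(Gin hF i _) -/(Gin hF i (W u)) Gin_inner !Gin_W oi ipZl mulN1r => e.
  have {}e : '[inner_op q (W v), W u] *+ 2 = 0 by rewrite mulr2n -{1}e addNr.
  by move/eqP: e; rewrite mulrn_eq0 /= => /eqP.
rewrite negb_exists => /forallP hq.
have cq := even_rel_commutant hq; have [Mq _] := cq.
set z := adj W (inner_op q Om).
have zOm : z = '[z, Om] *: Om.
  apply: (kms_vector_vacuum (hF := hF)) => [i|[[i s] f]].
    apply: ip_inj => u; rewrite gr_ip -/(gm hF i u) /z -!(adjEr _ _ bW).
    rewrite -(gr_W hF (p := fun j _ => j == i)) // -gr_ip -/(gm hF i _).
    by rewrite (rel_commutant_gmE _ _ cq) [gm hF i Om]gr_Om.
  rewrite /z -adjW_lop -adjW_rb; congr (adj W _).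
  rewrite -(rel_commutant_lop _ _ _ _ cq) -[lop a _ Om]/(wop a (rcons [::] _) Om) -(rbE hF).
  by rewrite (M_comm _ Mq (rb_commutant hF _)).
exists '[z, Om] => v.
have bc : bdd (fun v : P => '[z, Om] *: v).
  have := bdd_add ('[z, Om]) (bdd_id P) (@bdd_zero R P P); congr bdd.
  apply/funext => u; change ('[z, Om] *: u + 0 = '[z, Om] *: u); exact: addr0.
have bl : bdd (adj W \o inner_op q \o W).
  by apply: bdd_comp bW; apply: bdd_comp (wb _); apply: adj_bdd.
apply: (congr1 (@^~ v) (total_eq tot bl bc _)) => w.
rewrite /= (q_wop _ _ (W_q hF)) W_Om.
have -> : inner_op q (wop a (vword (fun=> S) w) Om) = wop a (vword (fun=> S) w) (inner_op q Om).
  by rewrite -alpha_wop; case: cq => _ ->; [|exact: (M_words hF)].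
rewrite -alpha_wop adjW_alpha; last exact: (M_words hF).
by rewrite -[adj W _]/z [X in wop a w X]zOm (bddZ _ _ (wb w)).
Qed.

(** Range and cokernel letters are orthogonal, so they pass each other up to sign without
    contraction. *)
Lemma reorder w : exists c q u, forall v,
  wsp a S w (W v) = c *: inner_op q (W (wop a u v)).
Proof.
elim: w => [|[[[i s] r] f] w [c [q [u h]]]]; first by exists 1, [::], [::] => v; rewrite scale1r.
case: r.
  exists (c * sgn (odd (cin i q))), q, ((i, s, adj S f) :: u) => v.
  rewrite /wsp /= -/(wsp a S w) h (bddZ _ _ (lb _)) -[spl _ _]/(i, s, S (adj S f)) inner_swap.
  by rewrite scalerA -(q_lop _ _ _ _ (W_q hF)).
exists c, ((i, s, f) :: q), u => v.
by rewrite /wsp /= -/(wsp a S w) h (bddZ _ _ (lb _)).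
Qed.

(** On a split word, [reorder] and [inner_slice] reduce the compression to a scalar times an
    ordinary word; normality carries this to the whole algebra. *)
Lemma compress_M m : M m -> M (adj W \o m \o W).
Proof.
pose A := range (wsp a S).
have bA x : A x -> bdd x by case=> w _ <-; apply: wb.
have sA : star_closed A.
  split=> [//||_ _ [w _ <-] [w' _ <-]|_ [w _ <-]]; first by exists [::].
    by exists (w ++ w') => //; apply/funext => v /=; rewrite /wsp map_cat wop_cat.
  exists (rev [seq (m.1.1.1, ~~ m.1.1.2, m.1.2, m.2) | m <- w]) => //.
  rewrite /wsp wop_star // /wstar map_rev -!map_comp; congr (wop a (rev _)).
(* Every letter is the sum of its two split parts, so whatever commutes with split words commutes
   with all words. *)
have MA x : M x -> bicommutant A x.
  move=> Mx; apply/commutantE; split; first exact: Mb.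
  move=> y /commutantE[by_ hy]; apply/funext => v.
  have hl i s r f u : y (lop a (i, s, Q S r f) u) = lop a (i, s, Q S r f) (y u).
    have e : wsp a S [:: (i, s, r, f)] \o y = y \o wsp a S [:: (i, s, r, f)].
      by apply: hy; exists [:: (i, s, r, f)].
    exact: (esym (congr1 (@^~ u) e)).
  have hl2 i s f u : lop a (i, s, f) (y u) = y (lop a (i, s, f) u).
    have e u' : lop a (i, s, f) u' = lop a (i, s, Q S true f) u' + lop a (i, s, Q S false f) u'.
      by rewrite -(lopD hF) Q_sum.
    by rewrite !e (bddD _ _ by_) !hl.
  rewrite /= (M_comm _ Mx) //; apply: words_commutant => // i f u.
    exact: (hl2 i false).
  exact: (hl2 i true).
move=> Mm; have bm := Mb Mm.
have bWm x : bdd x -> bdd (adj W \o x \o W).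
  by move=> bx; apply: bdd_comp bW; apply: bdd_comp => //; apply: adj_bdd.
apply/commutantE; split; first exact: bWm.
move=> y hy; have by_ : bdd y by case/commutantE: hy.
have nf xi eta : nfun (bicommutant A) (fun x => '[(adj W \o x \o W) xi, eta]).
  have [v [w h]] := nfun_vec (W xi) (W eta) (@bicommutant_bdd _ _ A).
  by exists v, w => x Ax; rewrite -h //= -(adjEr _ _ bW).
suff -> : y \o (adj W \o m \o W) = (adj W \o m \o W) \o y by [].
apply: (nfun_intertwine (f := fun x => adj W \o x \o W) (g := fun x => adj W \o x \o W)
  sA by_ by_ _ _ nf nf _ (MA _ Mm)) => [x /bicommutant_bdd/bWm|x /bicommutant_bdd/bWm|_ [w _ <-]] //.
have [c [q [u h]]] := reorder w; have [d hd] := inner_slice q.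
apply/funext => v /=; rewrite !h !(bddZ _ _ (adj_bdd bW)) !hd !(bddZ _ _ by_).
by move/commutantE: hy => [_ /(_ (wop a u))] /(_ (ex_intro2 _ _ u Logic.I erefl)) /(congr1 (@^~ v)) /= ->.
Qed.

(** [y0] is the compression of [q w] by [W], for an even cokernel word [q]: both [q] and [W] pass
    the relation between [x] and [y] along. If every such compression vanished, [w Om] would be
    orthogonal to all split words, the odd ones being excluded by the grading; since [Om] is
    separating, [w] would be 0. *)
Lemma even_intertwiner w : M w -> (exists v, w v <> 0) ->
  (forall i v, Gin hF i (w v) = w (Gin hF i v)) ->
  exists y0, [/\ M y0, y0 <> (fun=> 0)
    & forall x y, M x -> M y -> (forall v, w (alpha x v) = alpha y (w v)) ->
      forall v, y0 (x v) = y (y0 v)].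
Proof.
move=> Mw [v0 wv0] gw; have bw := Mb Mw.
have [q [eq [v qv]]] : exists q, (forall i, ~~ odd (cin i q)) /\
    exists v, adj W (inner_op q (w (W v))) <> 0.
  apply: contrapT => h0.
  have h q v : (forall i, ~~ odd (cin i q)) -> adj W (inner_op q (w (W v))) = 0.
    by move=> hq; apply: contrapT => h1; apply: h0; exists q; split=> //; exists v.
  apply: wv0; suff wOm : w Om = 0 by rewrite (M_separating hF Mw wOm).
  apply: (total_ip0 (wsp_total hF)) => u.
  have [c [q [u' e]]] := reorder u; rewrite -(W_Om hF) e ipZl.
  suff -> : '[inner_op q (W (wop a u' Om)), w (W Om)] = 0 by rewrite mulr0.
  have [/existsP[i oi]|] := boolP [exists i, odd (cin i q)].
    have := gr_ip hF (fun j r => (j == i) && ~~ r) (inner_op q (W (wop a u' Om))) (w (W Om)).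
    rewrite -/(Gin hF i _) -/(Gin hF i (w (W Om))) Gin_inner gw !Gin_W oi ipZl mulN1r => e2.
    have {}e2 : '[inner_op q (W (wop a u' Om)), w (W Om)] *+ 2 = 0 by rewrite mulr2n -{1}e2 addNr.
    by move/eqP: e2; rewrite mulrn_eq0 /= => /eqP.
  rewrite negb_exists => /forallP hq.
  rewrite (adjE _ _ (wb _)) wop_star // /wstar.
  pose q' := rev [seq (m.1.1, ~~ m.1.2, m.2) | m <- q].
  have -> : wop a (rev [seq star i | i <- map (inner_letter) q]) = inner_op q'.
    by rewrite /inner_op /q' map_rev -!map_comp; congr (wop a (rev _)); apply: eq_map => -[[? ?] ?].
  have hq' i : ~~ odd (cin i q').
    by rewrite /cin /q' count_rev count_map; apply: hq.
  by rewrite (adjEr (W _) _ bW) || rewrite (adjE _ _ bW) h // ip0r.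
have cq := even_rel_commutant eq; have [Mq _] := cq.
exists (adj W \o (inner_op q \o w) \o W); split.
- by apply: compress_M; apply: M_comp.
- by move=> e; apply: qv; exact: (congr1 (@^~ v) e).
move=> x y Mx My h u /=.
rewrite -alpha_W // h; case: cq => _ -> //.
by rewrite adjW_alpha.
Qed.

End Flow.

(** The last two clauses say that conjugation by [w] maps the image of the flow into itself and onto
    itself, in terms of elements of [M]. *)
Definition normalises {R : realType} (P : hilbert R) (M : set (P -> P))
    (alpha : (P -> P) -> (P -> P)) (w : P -> P) :=
  [/\ M w, forall v, w (adj w v) = v, forall v, adj w (w v) = v,
      forall x, M x -> exists2 y, M y & forall v, w (alpha x v) = alpha y (w v)
    & forall x, M x -> exists2 y, M y & forall v, w (alpha y v) = alpha x (w v)].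

(** * Normalising unitaries of every degree *)

Section OddUnitaries.
Context {R : realType} (H P : hilbert R) (k : nat).
Context (a : 'I_k -> H -> P -> P) (Om : P) (T Ti T1i S : H -> H).
Hypothesis hF : fermi_system a Om T Ti T1i S.

Let hC := f_car hF.
Let bS := f_bS hF.
Let lb l : bdd (lop a l) := lop_bdd hC l.
Local Notation M := (bicommutant (words a)).
Variable alpha : (P -> P) -> (P -> P).
Hypothesis alM : star_hom M M alpha.
Hypothesis alN : normal_map M alpha.
Hypothesis alA : forall i f, alpha (a i f) = a i (S f).
Variable e : H.
Hypothesis e_ker : adj S e = 0.
Hypothesis e_norm : nrm e = 1.
Let Mb x : M x -> bdd x := @bicommutant_bdd _ _ _ x.

Lemma normalises_id : normalises M alpha idfun.
Proof.
split=> [|v|v|x Mx|x Mx]; [exact: (M_words hF [::])|by rewrite adj_id|by rewrite adj_id|exists x|exists x] => //.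
Qed.

Lemma normalises_comp w w' : normalises M alpha w -> normalises M alpha w' ->
  normalises M alpha (w \o w').
Proof.
move=> [Mw w1 w2 w3 w4] [Mw' w1' w2' w3' w4'].
have ae : adj (w \o w') = adj w' \o adj w by apply: adj_comp; apply: Mb.
split=> [|v|v|x Mx|x Mx]; rewrite ?ae /= ?w1' ?w2 //.
- exact: M_comp.
- have [y My h] := w3' x Mx; have [z Mz h'] := w3 y My.
  by exists z => // v; rewrite h h'.
- have [y My h] := w4 x Mx; have [z Mz h'] := w4' y My.
  by exists z => // v; rewrite h' h.
Qed.

Lemma normalises_adj w : normalises M alpha w -> normalises M alpha (adj w).
Proof.
move=> [Mw w1 w2 w3 w4]; have bw := Mb Mw; split=> [|v|v|x Mx|x Mx]; rewrite ?adjK //.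
- exact: M_adj hF _ Mw.
- have [y My h] := w4 x Mx; exists y => // v.
  by rewrite -{1}(w1 v) -h w2.
- have [y My h] := w3 x Mx; exists y => // v.
  by rewrite -{1}(w1 v) -h w2.
Qed.

Definition odd_unit i : P -> P := fun v => lop a (i, false, e) v + lop a (i, true, e) v.

Lemma odd_unitE i : odd_unit i = 1 *: lop a (i, false, e) + lop a (i, true, e).
Proof.
apply/funext => v.
by change (lop a (i, false, e) v + lop a (i, true, e) v =
  1 *: lop a (i, false, e) v + lop a (i, true, e) v); rewrite scale1r.
Qed.

Lemma odd_unit_M i : M (odd_unit i).
Proof. by rewrite odd_unitE; apply: M_lin; [exact: M_lop hF _|exact: M_lop hF _]. Qed.

Lemma odd_unit_sq i v : odd_unit i (odd_unit i v) = v.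
Proof.
have l0 s : lop a (i, s, e) (lop a (i, s, e) v) = 0.
  have := lop_swap hC (i, s, e) (i, s, e) v.
  rewrite /cc /same /= !eqxx /= scale0r addr0 scaleN1r => h.
  have : lop a (i, s, e) (lop a (i, s, e) v) *+ 2 = 0 by rewrite mulr2n {1}h addNr.
  rewrite -scaler_nat => /eqP; rewrite scaler_eq0 pnatr_eq0 /= => /eqP //.
rewrite /odd_unit !(bddD _ _ (lb _)) !l0 add0r addr0.
rewrite (lop_swap hC (i, false, e)) /cc /same /= eqxx /= scaleN1r ipxx e_norm expr1n.
by rewrite addrAC addNr add0r scale1r.
Qed.

Lemma odd_unit_adj i : adj (odd_unit i) = odd_unit i.
Proof.
have b1 := lb (i, false, e); have b2 := lb (i, true, e).
rewrite odd_unitE (adj_add _ b1 b2) !(lop_star hC) rmorph1 /star /=.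
by apply/funext => v; rewrite -odd_unitE; change (1 *: lop a (i, true, e) v + lop a (i, false, e) v =
  lop a (i, false, e) v + lop a (i, true, e) v); rewrite scale1r addrC.
Qed.

Let Qe : Q S false e = e. Proof. by rewrite /Q e_ker (bdd0 bS) subr0. Qed.

Lemma odd_unit_Gin i j v : Gin hF j (odd_unit i v) = sgn (i == j) *: odd_unit i (Gin hF j v).
Proof.
rewrite /Gin (bddD _ _ (gr_bdd _ _)) -{1 2}Qe !gr_split Qe andbT -scalerDr.
by [].
Qed.

Lemma gm_nfun i xi eta : nfun M (fun x => '[alpha (gm hF i \o x \o gm hF i) xi, eta]).
Proof.
have bg : bdd (gm hF i) := gr_bdd hF _.
refine (nfun_conj (rho := fun x => '[alpha x xi, eta]) (M' := M) bg bg _ _ _).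
- exact: bicommutant_bdd.
- by move=> x Mx; apply: gr_M.
- exact: (alpha_nfun alN).
Qed.

(** The vector [e] is orthogonal to the range of [S], so the unitary anticommutes with range letters
    of its own species and commutes with the others: on the image of the flow it acts as the parity
    of species [i]. *)
Lemma odd_unit_alpha i x v : M x ->
  odd_unit i (alpha x v) = alpha (gm hF i \o x \o gm hF i) (odd_unit i v).
Proof.
move=> Mx; have bu := Mb (odd_unit_M i).
suff h : odd_unit i \o alpha x = alpha (gm hF i \o x \o gm hF i) \o odd_unit i.
  exact: (congr1 (@^~ v) h).
have aM y : M y -> bdd (alpha y) by move=> My; apply: Mb; apply: (alpha_M alM).
refine (nfun_intertwine (f := alpha) (g := fun x => alpha (gm hF i \o x \o gm hF i))
  (words_star_closed hC) bu bu aM _ (alpha_nfun alN) (gm_nfun i) _ Mx).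
  by move=> y My; apply: aM; apply: gr_M.
move=> _ [w _ <-].
have -> : gm hF i \o wop a w \o gm hF i = sgn (odd (cnt i w)) *: wop a w + (fun=> 0).
  apply/funext => u; rewrite /= gm_wop [gm hF i (gm hF i u)]grK.
  by change (sgn (odd (cnt i w)) *: wop a w u = sgn (odd (cnt i w)) *: wop a w u + 0); rewrite addr0.
have M0 : M (fun=> 0).
  have := M_lin (-1) (M_words hF [::]) (M_words hF [::]); congr M.
  apply/funext => u; change (-1 *: u + u = 0); by rewrite scaleN1r addNr.
have al0 : alpha (fun=> 0) = fun=> 0.
  case: alM => _ _ lin _ _; have := lin (-1) _ _ M0 M0.
  rewrite (_ : -1 *: (fun _ : P => 0 : P) + (fun=> 0) = fun=> 0); last first.
    by apply/funext => u; change (-1 *: (0 : P) + 0 = 0); rewrite scaler0 addr0.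
  by move=> ->; apply/funext => u; change (-1 *: alpha (fun=> 0) u + alpha (fun=> 0) u = 0); rewrite scaleN1r addNr.
have [_ _ lin _ _] := alM; rewrite (lin _ _ _ (M_words hF w) M0) {lin}.
rewrite al0 (alpha_wop hF alM alA); apply/funext => u.
change (odd_unit i (wop a (vword (fun=> S) w) u) =
  sgn (odd (cnt i w)) *: wop a (vword (fun=> S) w) (odd_unit i u) + 0); rewrite addr0.
elim: w u => [|[[j s] f] w ih] u; first by rewrite scale1r.
have sw z : odd_unit i (lop a (j, s, S f) z) = sgn (i == j) *: lop a (j, s, S f) (odd_unit i z).
  have c0 t : cc (i, t, e) (j, s, S f) = 0.
    rewrite /cc /same /=; case: ifP => // _; case: t.
      by rewrite -(adjEr _ _ bS) || rewrite (adjE _ _ bS) e_ker ip0r.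
    by rewrite (adjEr _ _ bS) e_ker ip0l.
  by rewrite /odd_unit !(lop_swap hC _ (j, s, S f)) !c0 !scale0r !addr0 -scalerDr (bddD _ _ (lb _)).
by rewrite /= sw ih (bddZ _ _ (lb _)) scalerA sgnM oddD oddb eq_sym.
Qed.

Lemma odd_unit_normalises i : normalises M alpha (odd_unit i).
Proof.
have MG x : M x -> M (gm hF i \o x \o gm hF i) by move=> Mx; apply: gr_M.
split=> [|v|v|x Mx|x Mx]; rewrite ?odd_unit_adj ?odd_unit_sq //.
- exact: odd_unit_M.
- by exists (gm hF i \o x \o gm hF i) => [|v]; [exact: MG | exact: odd_unit_alpha].
- exists (gm hF i \o x \o gm hF i) => [|v]; first exact: MG.
  rewrite odd_unit_alpha; last exact: MG.
  congr (alpha _ _); apply/funext => u /=.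
  by rewrite [gm hF i (gm hF i (x _))]grK [gm hF i (gm hF i u)]grK.
Qed.

Definition odd_prod (s : seq 'I_k) : P -> P := foldr (fun i x => odd_unit i \o x) idfun s.

Lemma odd_prod_normalises s : normalises M alpha (odd_prod s).
Proof.
elim: s => [|i s ih]; first exact: normalises_id.
exact: normalises_comp (odd_unit_normalises i) ih.
Qed.

Lemma odd_prod_Gin s j v : uniq s ->
  Gin hF j (odd_prod s v) = sgn (j \in s) *: odd_prod s (Gin hF j v).
Proof.
elim: s => [|i s ih] /=; first by rewrite scale1r.
move=> /andP[js us]; rewrite odd_unit_Gin ih // (bddZ _ _ (Mb (odd_unit_M i))) scalerA sgnM in_cons eq_sym.
by case: eqP js => //= <- /negPf ->.
Qed.

End OddUnitaries.

(* en witnesses that the cokernel of S is infinite-dimensional. *)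
Record flow_system {R : realType} (H P : hilbert R) (k : nat) (a : 'I_k -> H -> P -> P)
    (Om : P) (T Ti T1i S : H -> H) (alpha : (P -> P) -> (P -> P)) (en : nat -> H) : Prop :=
  FlowSystem {
  fl_fermi : fermi_system a Om T Ti T1i S;
  fl_hom : star_hom (bicommutant (words a)) (bicommutant (words a)) alpha;
  fl_normal : normal_map (bicommutant (words a)) alpha;
  fl_a : forall i f, alpha (a i f) = a i (S f);
  fl_ker : forall n, adj S (en n) = 0;
  fl_norm : forall n, nrm (en n) = 1;
  fl_null : wnull en }.

Section StarHom.
Context {R : realType} (P1 P2 : hilbert R) (M1 : set (P1 -> P1)) (M2 : set (P2 -> P2)).
Context (f : (P1 -> P1) -> (P2 -> P2)).
Hypothesis hf : star_hom M1 M2 f.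

Lemma shom_M x : M1 x -> M2 (f x). Proof. by case: hf => h _ _ _ _; apply: h. Qed.
Lemma shom_comp x y : M1 x -> M1 y -> f (x \o y) = f x \o f y.
Proof. by case: hf => _ _ _ h _; apply: h. Qed.
Lemma shom_adj x : M1 x -> f (adj x) = adj (f x).
Proof. by case: hf => _ _ _ _ h; apply: h. Qed.
Lemma shom_id : f idfun = idfun. Proof. by case: hf. Qed.
Lemma shom_0 : M1 idfun -> f (fun=> 0) = fun=> 0.
Proof.
move=> M1id; case: hf => _ f1 lin _ _; have := lin (-1) _ _ M1id M1id.
rewrite (_ : -1 *: idfun + idfun = fun=> 0); last first.
  by apply/funext => u; change (-1 *: u + u = 0); rewrite scaleN1r addNr.
move=> ->; rewrite f1; apply/funext => u.
by change (-1 *: u + u = 0); rewrite scaleN1r addNr.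
Qed.

(** Normalising depends on the image of [alpha1] alone, so [f] is asked to match images, not to
    intertwine the two maps. *)
Lemma shom_normalises alpha1 alpha2 w : normalises M1 alpha1 w ->
  (forall x, M1 x -> M1 (alpha1 x)) ->
  (forall x, M1 x -> exists2 y, M2 y & f (alpha1 x) = alpha2 y) ->
  (forall y, M2 y -> exists2 x, M1 x & f (alpha1 x) = alpha2 y) ->
  M1 (adj w) -> normalises M2 alpha2 (f w).
Proof.
move=> [Mw w1 w2 w3 w4] aM fa af Mw'.
have e1 : w \o adj w = idfun by apply/funext => v; exact: w1.
have e2 : adj w \o w = idfun by apply/funext => v; exact: w2.
split=> [|v|v|y My|y My]; first exact: shom_M.
- by rewrite -shom_adj // -[f w _]/((f w \o f (adj w)) v) -shom_comp // e1 shom_id.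
- by rewrite -shom_adj // -[f (adj w) _]/((f (adj w) \o f w) v) -shom_comp // e2 shom_id.
- have [x Mx e] := af y My; have [x' Mx' h] := w3 x Mx; have [y' My' e'] := fa x' Mx'.
  exists y' => // v; rewrite -e -e' -[LHS]/((f w \o f (alpha1 x)) v).
  rewrite -[RHS]/((f (alpha1 x') \o f w) v) -!shom_comp //; try exact: aM.
  by congr (f _ v); apply/funext => u; exact: h.
- have [x Mx e] := af y My; have [x' Mx' h] := w4 x Mx; have [y' My' e'] := fa x' Mx'.
  exists y' => // v; rewrite -e -e' -[LHS]/((f w \o f (alpha1 x')) v).
  rewrite -[RHS]/((f (alpha1 x) \o f w) v) -!shom_comp //; try exact: aM.
  by congr (f _ v); apply/funext => u; exact: h.
Qed.

End StarHom.

Lemma Gin_adj {R : realType} (H P : hilbert R) (k : nat) (a : 'I_k -> H -> P -> P) (Om : P)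
    (T Ti T1i S : H -> H) (hF : fermi_system a Om T Ti T1i S) (x : P -> P) j d : bdd x ->
  (forall v, Gin hF j (x v) = sgn d *: x (Gin hF j v)) ->
  forall v, Gin hF j (adj x v) = sgn d *: adj x (Gin hF j v).
Proof.
move=> bx e v; apply: ip_inj => z.
rewrite gr_ip ipZl !(adjE _ _ (adj_bdd bx)) !adjK // gr_ip -/(Gin hF j (x z)) e ipZr.
by rewrite sgn_conj mulrA sgn_sq mul1r.
Qed.

(** * Comparing degrees across an isomorphism *)

Section NonConjugacy.
Context {R : realType} (H1 P1 H2 P2 : hilbert R) (k l : nat).
Context (a1 : 'I_k -> H1 -> P1 -> P1) (Om1 : P1) (T1 Ti1 T1i1 S1 : H1 -> H1).
Context (a2 : 'I_l -> H2 -> P2 -> P2) (Om2 : P2) (T2 Ti2 T1i2 S2 : H2 -> H2).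
Context (al1 : (P1 -> P1) -> (P1 -> P1)) (al2 : (P2 -> P2) -> (P2 -> P2)).
Context (en1 : nat -> H1) (en2 : nat -> H2).
Hypothesis h1 : flow_system a1 Om1 T1 Ti1 T1i1 S1 al1 en1.
Hypothesis h2 : flow_system a2 Om2 T2 Ti2 T1i2 S2 al2 en2.
Local Notation M1 := (bicommutant (words a1)).
Local Notation M2 := (bicommutant (words a2)).
Context (Psi : (P1 -> P1) -> (P2 -> P2)) (Psi' : (P2 -> P2) -> (P1 -> P1)).
Hypothesis hPsi : star_iso M1 M2 Psi Psi'.
Hypothesis Psi1 : forall x, M1 x -> exists2 y, M2 y & Psi (al1 x) = al2 y.
Hypothesis Psi2 : forall y, M2 y -> exists2 x, M1 x & Psi (al1 x) = al2 y.

Lemma no_iso_lt : ~ (l < k)%N.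
Proof.
move=> lk; have hF1 := fl_fermi h1; have hF2 := fl_fermi h2.
have [hom hom' PK PK'] := hPsi.
have aM1 x : M1 x -> M1 (al1 x) by apply: (alpha_M (fl_hom h1)).
have aM2 x : M2 x -> M2 (al2 x) by apply: (alpha_M (fl_hom h2)).
pose u (g : {set 'I_k}) := odd_prod a1 (en1 0%N) (enum g).
have nu g : normalises M1 al1 (u g).
  apply: (odd_prod_normalises hF1 (fl_hom h1) (fl_normal h1) (fl_a h1)).
    exact: fl_ker h1 0%N.
  exact: fl_norm h1 0%N.
have Madj1 x : M1 x -> M1 (adj x) by move=> Mx; exact: (M_adj hF1 Mx).
have nv g : normalises M2 al2 (Psi (u g)).
  apply: (shom_normalises hom (nu g)) => //; apply: Madj1; by case: (nu g).
have hdeg g : exists d : {ffun 'I_l -> bool}, forall j v,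
    Gin hF2 j (Psi (u g) v) = sgn (d j) *: Psi (u g) (Gin hF2 j v).
  have [n1 n2 n3 n4 n5] := nv g.
  have /choice[d hd] : forall j, exists b, forall v,
      Gin hF2 j (Psi (u g) v) = sgn b *: Psi (u g) (Gin hF2 j v).
    move=> j; exact: (unit_degree hF2 (fl_hom h2) (fl_normal h2) (fl_a h2) (fl_ker h2) (fl_norm h2) (fl_null h2)
      n1 n2 n3 n4 n5).
  by exists [ffun j => d j] => j v; rewrite ffunE.
have [deg degE] := choice hdeg.
(* Pigeonhole: the subsets of the [k] species outnumber the degree vectors in [l] signs. *)
have [g [h [gh dgh]]] : exists g h, g != h /\ deg g = deg h.
  apply: contrapT => ninj; have : injective deg.
    move=> g h e; apply/eqP; apply: contrapT => /negP gh; apply: ninj.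
    by exists g, h.
  move/leq_card; rewrite card_ffun card_bool card_ord -cardsT -powersetT card_powerset cardsT card_ord.
  by rewrite leq_exp2l // leqNgt lk.
pose w := adj (u g) \o u h.
have nw : normalises M1 al1 w.
  by apply: normalises_comp => //; apply: (normalises_adj hF1).
have nPw : normalises M2 al2 (Psi w).
  by apply: (shom_normalises hom nw) => //; apply: Madj1; case: nw.
have Pw : Psi w = adj (Psi (u g)) \o Psi (u h).
  have [Mg _ _ _ _] := nu g; have [Mh _ _ _ _] := nu h.
  by rewrite /w (shom_comp hom) ?(shom_adj hom) //; apply: Madj1.
have even j v : Gin hF2 j (Psi w v) = Psi w (Gin hF2 j v).
  have [Mg _ _ _ _] := nv g; have bg := bicommutant_bdd Mg.
  rewrite Pw /= (Gin_adj bg (degE g j)) degE dgh.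
  by rewrite (bddZ _ _ (adj_bdd bg)) scalerA sgn_sq scale1r.
have [MPw p1 p2 p3 p4] := nPw.
have Pw0 : exists v, Psi w v <> 0.
  exists (adj (Psi w) Om2) => e0.
  have e1 : Om2 = 0 by rewrite -(p1 Om2).
  by have := f_Om hF2; rewrite e1 ip0l => /esym/eqP; rewrite oner_eq0.
have [y0 [My0 ny0 hy0]] := even_intertwiner (fl_hom h2) (fl_normal h2) (fl_a h2) (fl_norm h2) (fl_null h2) MPw Pw0 even.
have [z Mz Pz] := Psi2 My0.
have [Mw w1 w2 w3 w4] := nw.
have Mw' := Madj1 _ Mw.
have bw := bicommutant_bdd Mw.
(* The relation defining [y0] is pushed through [al2] and pulled back by [Psi'], so that [al1 z]
   obeys the same exchange rule with the image of the flow as [w] does; the two rules cancel in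
   [adj w \o al1 z]. *)
have hn : rel_commutant a1 al1 (adj w \o al1 z).
  split; first by apply: M_comp => //; apply: aM1.
  move=> x v Mx; have [x' Mx' e] := w3 x Mx.
  have [y My ey] := Psi1 Mx; have [y' My' ey'] := Psi1 Mx'.
  have e1 : y0 \o y = y' \o y0.
    apply/funext => t; apply: hy0 => // s.
    rewrite -ey -ey' -[LHS]/((Psi w \o Psi (al1 x)) s) -[RHS]/((Psi (al1 x') \o Psi w) s).
    rewrite -!(shom_comp hom) //; do ?exact: aM1.
    by congr (Psi _ s); apply/funext => t'; exact: e.
  have e2 : al1 z \o al1 x = al1 x' \o al1 z.
    have := congr1 al2 e1.
    rewrite (alpha_comp (fl_hom h2) My0 My) (alpha_comp (fl_hom h2) My' My0) -ey -ey' -Pz.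
    rewrite -(shom_comp hom (aM1 _ Mz) (aM1 _ Mx)) -(shom_comp hom (aM1 _ Mx') (aM1 _ Mz)).
    move/(congr1 Psi'); rewrite (PK _ (M_comp (aM1 _ Mz) (aM1 _ Mx))).
    by rewrite (PK _ (M_comp (aM1 _ Mx') (aM1 _ Mz))).
  rewrite /= -[al1 z _]/((al1 z \o al1 x) v) e2 /=.
  by rewrite -{1}[al1 z v](w1) -e w2.
have [i hi] : exists i, (i \in g) != (i \in h).
  apply: contrapT => n; move/eqP: gh; apply; apply/setP => i.
  by apply/eqP; apply: contrapT => /negP ni; apply: n; exists i.
have Gu f v : Gin hF1 i (u f v) = sgn (i \in f) *: u f (Gin hF1 i v).
  rewrite (odd_prod_Gin hF1 (fl_ker h1 0%N)) ?enum_uniq // mem_enum.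
  by [].
(* In a species [i] where [g] and [h] differ, [adj w] applied to [al1 z] is even as an element of
   the relative commutant, and odd because [al1 z] is even and [w] odd; hence it is 0. *)
have z0 : al1 z = fun=> 0.
  apply/funext => v; rewrite -[al1 z v]w1.
  have en : Gin hF1 i (adj w (al1 z v)) = adj w (al1 z (Gin hF1 i v)).
    exact: (rel_commutant_Gin hF1 (fl_hom h1) (fl_a h1) (fl_norm h1) (fl_null h1) i v hn).
  have Gw v' : Gin hF1 i (w v') = sgn true *: w (Gin hF1 i v').
    have [Mg _ _ _ _] := nu g; have bg := bicommutant_bdd Mg.
    rewrite /w /= (Gin_adj bg (Gu g)) Gu (bddZ _ _ (adj_bdd bg)) scalerA sgnM.
    by move: hi; case: (i \in g); case: (i \in h).
  have eo := Gin_adj bw Gw (al1 z v).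
  have bw' := adj_bdd bw.
  move: eo; rewrite en (Gin_alpha hF1 (fl_hom h1) (fl_normal h1) (fl_a h1)) // scaleN1r.
  move/eqP; rewrite -addr_eq0 -mulr2n -scaler_nat scaler_eq0 pnatr_eq0 /= => /eqP e0.
  have e1 : adj w (al1 z v) = 0.
    have := congr1 (Gin hF1 i) en; rewrite e0 /Gin grK => ->; exact: bdd0 (gr_bdd hF1 _).
  by rewrite e1 (bdd0 bw).
have : al2 y0 = fun=> 0 by rewrite -Pz z0 (shom_0 hom) //; exact: (M_words hF1 [::]).
by move/(alpha_inj hF2 (fl_hom h2) (fl_normal h2) (fl_a h2) My0).
Qed.

End NonConjugacy.

(** * Homomorphisms of C*-algebras *)

Section StarHomContractive.
Context {R : realType} (F L : hilbert R) (A : set (F -> F)) (pi : (F -> F) -> (L -> L)).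
Hypothesis hA : Cstar_algebra A.
Hypothesis hpi : star_hom A (bounded L) pi.

Let A1 : A idfun. Proof. by case: hA => -[]. Qed.
Let Ab x : A x -> bdd x. Proof. by case: hA => -[h _] _ _ _ _ /h/bounded_bdd. Qed.
Let Alin c x y : A x -> A y -> A (c *: x + y). Proof. by case: hA => _ h _ _ _; apply: h. Qed.
Let Acomp x y : A x -> A y -> A (x \o y). Proof. by case: hA => _ _ h _ _; apply: h. Qed.
Let Aadj x : A x -> A (adj x). Proof. by case: hA => _ _ _ h _; apply: h. Qed.

Lemma Cstar_0 : A (fun=> 0).
Proof.
have := Alin (-1) A1 A1; congr A; apply/funext => u.
by change (-1 *: u + u = 0); rewrite scaleN1r addNr.
Qed.

Lemma Cstar_scale c x : A x -> A (c *: x).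
Proof. by move=> Ax; have := Alin c Ax Cstar_0; rewrite (_ : (fun=> 0) = 0) // addr0. Qed.

Lemma Cstar_closed x : bdd x -> (forall e, 0 < e -> exists2 y, A y &
  forall v, nrm (x v - y v) <= e * nrm v) -> A x.
Proof.
move=> bx h; case: hA => _ _ _ _; apply; first exact/bounded_bdd.
move=> e e0; have [d d0 ->] := complex_gt0 e0.
by have [y Ay hy] := h d d0; exists y => // v; rewrite !nrmE -rmorphM lecR.
Qed.

Lemma adj_le c (x : F -> F) : bdd x -> (forall u, nrm (x u) <= c * nrm u) ->
  forall u, nrm (adj x u) <= c * nrm u.
Proof.
move=> bx h u; have [->|u0] := eqVneq (nrm (adj x u)) 0.
  by have := h u; apply: le_trans.
have p : 0 < nrm (adj x u) by rewrite lt_neqAle eq_sym u0 nrm_ge0.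
rewrite -(ler_pM2r p) -expr2 -Re_ipxx adjEr ?adjK //; last exact: adj_bdd.
apply: le_trans (Re_le_normc _) _; apply: le_trans (cauchy_schwarz _ _) _.
by rewrite mulrAC ler_wpM2r.
Qed.

(* The inverse exists by orthogonality; it lies in A because it is the sum of the Neumann series. *)
Lemma neumann t q : A t -> 0 <= q < 1 -> (forall u, nrm (t u) <= q * nrm u) ->
  exists2 g, A g & forall v, g (v - t v) = v.
Proof.
move=> At /andP[q0 q1] ht; have bt := Ab At.
have q1' : 0 < 1 - q by rewrite subr_gt0.
have low v : nrm v <= (1 - q)^-1 * nrm (v - t v).
  rewrite ler_pdivlMl // mulrBl mul1r lerBlDr; have := nrm_triB v (t v) 0.
  by rewrite !subr0 => h; apply: le_trans h _; rewrite lerD2l.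
have tot : total_fam (fun v => v - t v).
  apply: total_of_ortho => y hy.
  have e : y = adj t y.
    apply: ip_inj => z; rewrite ipC (ipC (adj t y)) -adjE //.
    by have := hy z; rewrite ipBl => /eqP; rewrite subr_eq0 => /eqP ->.
  apply: nrm_eq0; apply/eqP; have := adj_le bt ht y; rewrite -e => h.
  rewrite eq_le nrm_ge0 andbT -(pmulr_rle0 _ q1') mulrBl mul1r subr_le0 //.
have [|g bg hg] := @extension _ _ _ _ _ (@idfun F) (1 - q)^-1 tot.
  move=> l; apply: le_trans (low _) _.
  by rewrite (bdd_lsum idfun l bt) /lsum -sumrB; under eq_bigr do rewrite -scalerBr.
exists g => //; have rec v : g v = v + g (t v).
  by apply/eqP; rewrite -subr_eq; apply/eqP; rewrite -(bddB _ _ bg) hg.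
(* The [n]-th partial sum of the Neumann series, in Horner form. *)
pose s := fix s n : F -> F := if n is n'.+1 then 1 *: idfun + (s n' \o t) else fun=> 0.
have As n : A (s n) by elim: n => [|n ih]; [exact: Cstar_0|apply: Alin => //; exact: Acomp].
have [_ [G G0 hG]] := bg.
have err n v : nrm (g v - s n v) <= G * q ^+ n * nrm v.
  elim: n v => [|n ih] v; first by rewrite subr0 mulr1.
  rewrite rec -[s n.+1 v]/(1 *: v + s n (t v)) scale1r opprD addrACA subrr add0r.
  apply: le_trans (ih _) _; rewrite exprSr mulrA -[leRHS]mulrA ler_wpM2l //.
  by rewrite mulr_ge0 ?exprn_ge0.
apply: Cstar_closed => // e e0.
have [n hn] : exists n, G * q ^+ n <= e.
  have q_lt : `|q| < 1 by rewrite ger0_norm.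
  have G1 : 0 < G + 1 by lra.
  have /cvgrPdist_lt /(_ _ (divr_gt0 e0 G1)) [n _ hn] := cvg_expr q_lt.
  exists n; have := hn n (leqnn n); rewrite /= sub0r normrN ger0_norm ?exprn_ge0 //.
  rewrite ltr_pdivlMr // mulrDr mulr1 mulrC; have := exprn_ge0 n q0; lra.
exists (s n) => // v; apply: le_trans (err n v) _; by rewrite ler_wpM2r.
Qed.

Let p1 : pi idfun = idfun. Proof. exact: shom_id hpi. Qed.
Let pb x : A x -> bdd (pi x). Proof. by move=> Ax; apply/bounded_bdd; exact: (shom_M hpi Ax). Qed.

Lemma shom_lin c x y v : A x -> A y -> pi (c *: x + y) v = c *: pi x v + pi y v.
Proof. by case: hpi => _ _ h _ _ Ax Ay; rewrite h. Qed.

(* If N, the square of the norm of pi x, exceeded c^2, then 1 - x^* x / N would be invertible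
   in A, whereas 1 - (pi x)^* (pi x) / N is not bounded below. *)
Lemma shom_le c x : A x -> 0 <= c -> (forall u, nrm (x u) <= c * nrm u) ->
  forall v, nrm (pi x v) <= c * nrm v.
Proof.
move=> Ax c0 hx; set k := pi x; have bk : bdd k := pb Ax; have bx := Ab Ax.
have [_ [C C0 hC]] := bk.
pose Q := [set r : R | exists2 v, nrm v <= 1 & r = nrm (k v) ^+ 2].
have Q0 : Q 0 by exists 0; rewrite ?nrm0 // (bdd0 bk) nrm0 expr0n.
have Qub : ubound Q (C ^+ 2).
  move=> _ [v v1 ->]; rewrite ler_pXn2r ?nnegrE //; apply: le_trans (hC _) _.
  by rewrite ler_piMr.
have hQ : has_sup Q by split; [exists 0 | exists (C ^+ 2)].
set N := sup Q.
have N0 : 0 <= N by apply: ub_le_sup => //; case: hQ.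
have kN v : nrm (k v) ^+ 2 <= N * nrm v ^+ 2.
  have [v0|v0] := eqVneq (nrm v) 0.
    by rewrite (nrm_eq0 v0) (bdd0 bk) nrm0 expr0n mulr0.
  have p : 0 < nrm v by rewrite lt_neqAle eq_sym v0 nrm_ge0.
  rewrite -ler_pdivrMr ?exprn_gt0 //; apply: ub_le_sup; first by case: hQ.
  exists ((real_complex R (nrm v)^-1) *: v).
    by rewrite nrmZ normcR ger0_norm ?invr_ge0 // mulVf.
  by rewrite (bddZ _ _ bk) nrmZ normcR ger0_norm ?invr_ge0 // exprMn mulrC exprVn.
have [Nc|Nc] := leP N (c ^+ 2).
  move=> v; rewrite -(@ler_pXn2r _ 2) ?nnegrE ?mulr_ge0 // exprMn.
  by apply: le_trans (kN v) _; rewrite ler_wpM2r ?sqr_ge0.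
have Np : 0 < N by apply: le_lt_trans (sqr_ge0 c) Nc.
pose t := (real_complex R N^-1) *: (adj x \o x).
have Axx : A (adj x \o x) by apply: Acomp => //; apply: Aadj.
have At : A t by apply: Cstar_scale.
have tq u : nrm (t u) <= N^-1 * c ^+ 2 * nrm u.
  rewrite [t u]/(_ *: adj x (x u)) nrmZ normcR ger0_norm ?invr_ge0 // -mulrA.
  rewrite ler_wpM2l ?invr_ge0 //; apply: le_trans (adj_le bx hx _) _.
  by rewrite expr2 -mulrA ler_wpM2l.
have [|g Ag hg] := neumann At _ tq.
  by rewrite mulr_ge0 ?invr_ge0 ?sqr_ge0 //= ltr_pdivrMl // mulr1.
have kE v : pi t v = (real_complex R N^-1) *: adj k (k v).
  have -> : t = real_complex R N^-1 *: (adj x \o x) + (fun=> 0) by apply/esym; exact: addr0.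
  rewrite (shom_lin _ _ Axx Cstar_0) (shom_0 hpi A1) addr0 (shom_comp hpi (Aadj Ax) Ax).
  by rewrite (shom_adj hpi Ax).
have gE v : pi g (v - pi t v) = v.
  have Am : A (-1 *: t + idfun) by apply: Alin.
  have e : g \o (-1 *: t + idfun) = idfun.
    by apply/funext => u; change (g (-1 *: t u + u) = u); rewrite scaleN1r addrC hg.
  have := congr1 (@^~ v) (congr1 pi e).
  by rewrite p1 (shom_comp hpi) //= shom_lin // p1 scaleN1r addrC.
have [_ [G' G'0 hG']] := pb Ag; pose G := G' + 1.
have G1 : 1 <= G by rewrite lerDr.
have hG v : nrm v <= G * nrm (v - pi t v).
  rewrite -{1}(gE v); apply: le_trans (hG' _) _; rewrite ler_wpM2r // lerDl.
  by [].
(* Boundedness below of the identity minus [pi t], with constant [G], keeps [nrm (k v) ^+ 2] on the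
   unit ball below [N] by a fixed factor, which contradicts the choice of [N] as supremum. *)
have bad v : nrm v <= 1 -> nrm (k v) ^+ 2 <= N * (1 - G ^- 2).
  move=> v1.
  have h1 : nrm (adj k (k v)) ^+ 2 <= N * nrm (k v) ^+ 2.
    have [->|p] := eqVneq (nrm (adj k (k v))) 0; first by rewrite expr0n mulr_ge0 ?sqr_ge0.
    have p2 : 0 < nrm (adj k (k v)) ^+ 2 by rewrite lt_neqAle eq_sym expf_neq0 // sqr_ge0.
    set A' := adj k (k v).
    have e : nrm A' ^+ 2 <= nrm (k A') * nrm (k v).
      rewrite -Re_ipxx {2}/A' -adjE //.
      exact: le_trans (Re_le_normc _) (cauchy_schwarz _ _).
    rewrite -(ler_pM2r p2) -expr2 -/A'.
    apply: le_trans (_ : (nrm (k A') * nrm (k v)) ^+ 2 <= _).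
      by rewrite ler_pXn2r ?nnegrE ?mulr_ge0 ?sqr_ge0.
    by rewrite exprMn [leRHS]mulrAC ler_wpM2r ?sqr_ge0.
  have h2 : nrm (v - pi t v) ^+ 2 <= nrm v ^+ 2 - N^-1 * nrm (k v) ^+ 2.
    rewrite nrmB_sq kE nrmZ normcR ger0_norm ?invr_ge0 // exprMn.
    have -> : complex.Re '[v, real_complex R N^-1 *: adj k (k v)] = N^-1 * nrm (k v) ^+ 2.
      by rewrite ipZr -adjE // ipxx conjc_real -rmorphM.
    have : N^-1 ^+ 2 * nrm (adj k (k v)) ^+ 2 <= N^-1 * nrm (k v) ^+ 2.
      rewrite expr2 -mulrA ler_wpM2l ?invr_ge0 // ler_pdivrMl //.
    lra.
  have h3 : nrm v ^+ 2 <= G ^+ 2 * (nrm v ^+ 2 - N^-1 * nrm (k v) ^+ 2).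
    apply: le_trans (_ : (G * nrm (v - pi t v)) ^+ 2 <= _).
      by rewrite ler_pXn2r ?nnegrE ?mulr_ge0 //; apply: le_trans G1.
    by rewrite exprMn ler_wpM2l ?sqr_ge0.
  have Gp : 0 < G ^+ 2 by rewrite exprn_gt0 //; apply: lt_le_trans G1.
  rewrite mulrC -ler_pdivrMr // mulrC.
  have h4 : nrm v ^+ 2 * G ^- 2 <= nrm v ^+ 2 - N^-1 * nrm (k v) ^+ 2.
    by rewrite ler_pdivrMr // mulrC.
  have h5 : nrm v ^+ 2 <= 1 by rewrite expr_le1.
  have h6 : 0 <= 1 - G ^- 2 by rewrite subr_ge0 invf_le1 // exprn_ege1.
  have : nrm v ^+ 2 * (1 - G ^- 2) <= 1 - G ^- 2 by rewrite ler_piMl.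
  rewrite mulrBr mulr1; lra.
have : N <= N * (1 - G ^- 2).
  by apply: ge_sup; [exists 0 | move=> _ [v v1 ->]; exact: bad].
rewrite -{1}[N]mulr1 ler_pM2l // lerBrDr gerDl leNgt invr_gt0 exprn_gt0 //.
exact: lt_le_trans G1.
Qed.

End StarHomContractive.

(** The projection onto the closed span of the [e i Om] commutes with [A] and fixes [Om], so it also
    fixes [x Om] for [x] in the bicommutant. This transfers cyclicity from the large algebra to
    words. *)
Lemma cyclic_total {R : realType} (P : hilbert R) (A : set (P -> P)) (Om : P) I (e : I -> P -> P) :
  star_closed A -> (forall i, A (e i)) -> (forall x, A x -> exists i, x = e i) ->
  (forall y, (forall x, bicommutant A x -> '[x Om, y] = 0) -> y = 0) ->
  total_fam (fun i => e i Om).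
Proof.
move=> [Ab A1 AM Aj] Ae eA hy; apply: total_of_ortho => y yo.
have cQ := clspan_closed (fun i => e i Om); set Q := clspan _ in cQ.
have [p [bp pQ pid pu]] := projector cQ.
have Qi i : Q (e i Om) by apply: clspan_mem.
have QA x v : A x -> Q v -> Q (x v).
  move=> Ax Qv; have bx := Ab _ Ax.
  suff : Q `<=` [set v | Q (x v)] by apply.
  apply: clspan_min => [|i].
    split=> [|c u w|u h] /=; first by rewrite (bdd0 bx); case: cQ.
      by rewrite (bdd_lin _ _ _ bx); case: cQ => _ h _; apply: h.
    have [C C0 hC] := bdd_near bx; have [_ _ cl] := cQ; apply: cl => d d0.
    have [w Qw hw] := h _ (divr_gt0 d0 C0); exists (x w) => //.
    by apply: le_lt_trans (hC _ _) _; rewrite mulrC -ltr_pdivlMr.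
  by have [j ej] := eA _ (AM _ _ Ax (Ae i)); rewrite /= -[x _]/((x \o e i) Om) ej; apply: Qi.
have cp : commutant A p.
  apply/commutantE; split=> // x Ax; apply/funext => v /=.
  have [q Qq hq] := projection v cQ.
  have -> : p v = q by apply: pu.
  apply/esym/pu; split; first exact: QA.
  move=> g Qg; have bx := Ab _ Ax; rewrite -(bddB _ _ bx) adjE //.
  by apply: hq; apply: QA => //; apply: Aj.
apply: hy => x Mx.
have -> : x Om = p (x Om).
  have [i ei] := eA _ A1; have <- : p Om = Om by apply: pid; have := Qi i; rewrite -ei.
  by rewrite -(bicommutant_comm _ Mx cp) (pid (p Om)).
have Qy : Q `<=` [set v | '[v, y] = 0] by apply: clspan_min; [exact: closed_ortho|].
exact: Qy.
Qed.

(** * The Fock space and quasi-free states *)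

Section Laplace.
Context {R : realType} (V : nmodType).
Implicit Types (phi : V -> R[i]) (B : V -> V -> R[i]) (G : seq V -> R[i]).

(** One determinant serves the Fock inner product and the moments of the state, with different
    kernels [B]. *)
Definition gdet B (f g : seq V) : R[i] :=
  if size f == size g
  then \det (\matrix_(i < size f, j < size f) B f`_i g`_j) else 0.

(* The terms of a Laplace expansion: signed coefficients with the remaining entries. *)
Fixpoint del phi (u : seq V) : seq (R[i] * seq V) :=
  if u is x :: u' then (phi x, u') :: [seq (- p.1, x :: p.2) | p <- del phi u'] else [::].

Lemma del_size phi u p : p \in del phi u -> size u = (size p.2).+1.
Proof.
elim: u p => //= x u ih p; rewrite in_cons => /orP[/eqP -> //|/mapP[q /ih e ->]] /=.
by rewrite e.
Qed.

Lemma del_sum phi u G : \sum_(p <- del phi u) p.1 * G p.2 =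
  \sum_(j < size u) ((-1) ^+ j * phi u`_j) * G (take j u ++ drop j.+1 u).
Proof.
elim: u G => [|x u ih] G; first by rewrite big_nil big_ord0.
rewrite /= big_cons big_map big_ord_recl /= drop0 mul1r; congr (_ + _).
under eq_bigr do rewrite mulNr.
rewrite sumrN (ih (fun u' => G (x :: u'))) -sumrN; apply: eq_bigr => j _.
by rewrite /bump /= add1n exprS mulN1r !mulNr.
Qed.

Lemma gdet_cons B h s u : gdet B (h :: s) u = \sum_(p <- del (B h) u) p.1 * gdet B s p.2.
Proof.
rewrite /gdet; have [e|ne] := eqVneq (size (h :: s)) (size u); last first.
  rewrite big_seq big1 // => p /del_size e; case: eqP => [e'|]; last by rewrite mulr0.
  by rewrite /= e' -e eqxx in ne.
rewrite (del_sum _ _ (fun t => if size s == size t then \det (\matrix_(i, j) B s`_i t`_j) else 0)).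
rewrite (expand_det_row _ ord0) -e; apply: eq_bigr => j _.
rewrite mxE /cofactor add0n mulrCA mulrA /=; congr (_ * _).
have js : (j <= size s)%N by rewrite -ltnS.
have js' : (j <= size u)%N by rewrite -e ltnW.
have -> : size (take j u ++ drop j.+1 u) = size s.
  by rewrite size_cat size_takel // size_drop -e /= subSS subnKC.
rewrite eqxx; congr (\det _); apply/matrixP => a b; rewrite !mxE /= add0n; congr (B _ _).
rewrite nth_cat size_takel // /bump; case: ltnP => bj.
  by rewrite add0n nth_take.
by rewrite add1n nth_drop addSn addnC subnK.
Qed.

Lemma del_map phi (f : R[i] -> R[i]) u G : (forall x, f (- x) = - f x) ->
  \sum_(p <- del phi u) f p.1 * G p.2 = \sum_(p <- del (f \o phi) u) p.1 * G p.2.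
Proof.
move=> fN; elim: u G => [|x u ih] G; first by rewrite !big_nil.
rewrite /= !big_cons !big_map; congr (_ + _).
under eq_bigr do rewrite fN mulNr.
by under [RHS]eq_bigr do rewrite mulNr; rewrite !sumrN (ih (fun u' => G (x :: u'))).
Qed.

End Laplace.

Section Fock.
Context {R : realType} (H : hilbert R) (F : fock H).
Local Notation wd := (wedge F).

Lemma wedge_ip f g : '[wd f, wd g] = gdet (fun x y => '[x, y]) f g.
Proof. exact: wedgeE. Qed.

Lemma wedge_totalP : total_fam wd.
Proof. by apply/totalP; exact: wedge_total. Qed.

(** The vector that annihilation of [h] will produce from the wedge of [u], available before the
    operator itself. *)
Let Y h u := lsum wd (del (fun x => '[x, h]) u).

Lemma wedge_ann h s u : '[wd (h :: s), wd u] = '[wd s, Y h u].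
Proof.
rewrite wedge_ip gdet_cons /Y /lsum ip_sumr.
under [RHS]eq_bigr do rewrite ipZr wedge_ip.
rewrite (del_map _ _ (gdet (fun x y => '[x, y]) s)); last by move=> x; rewrite rmorphN.
by congr (\sum_(p <- del _ _) _); apply/funext => x /=; rewrite ipC.
Qed.

Lemma Y_cons h u t : Y h (u :: t) = '[u, h] *: wd t -
  lsum (fun s => wd (u :: s)) (del (fun x => '[x, h]) t).
Proof.
rewrite /Y /lsum /= big_cons big_map -sumrN; congr (_ + _).
by apply: eq_bigr => p _; rewrite scaleNr.
Qed.

(** Laplace expansion says that the Gram matrices of the vectors with [h] added and of those with
    [h] annihilated sum to [|h|^2] times that of the wedges: the anticommutation relation before the
    operators exist, which gives the bound. *)
Lemma creation_exists h : exists2 X : F -> F, bdd X & forall s, X (wd s) = wd (h :: s).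
Proof.
apply: (@extension_gram _ _ _ _ _ wd (fun s => wd (h :: s)) (Y h) (complex.Re '[h, h])
  wedge_totalP) => s t.
have -> : real_complex R (complex.Re '[h, h]) = '[h, h] by rewrite ipxx.
rewrite wedge_ann Y_cons ipBr ipZr -ipC.
rewrite [X in _ - X + _](_ : _ = '[Y h s, Y h t]) ?subrK //.
rewrite {2}/Y /lsum !ip_sumr; apply: eq_bigr => p _; rewrite !ipZr; congr (_ * _).
by rewrite ipC wedge_ann -ipC.
Qed.

Lemma creationP h : bdd (creation F h) /\ forall s, creation F h (wd s) = wd (h :: s).
Proof.
have [X bX hX] := creation_exists h.
have : exists x, [set X | bounded F X /\ forall s, X (wd s) = wd (h :: s)] x.
  by exists X; split=> //; exact/bounded_bdd.
by move/getPex => -[/bounded_bdd b e]; split.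
Qed.

Lemma creation_bdd h : bdd (creation F h). Proof. by case: (creationP h). Qed.
Lemma creationE h s : creation F h (wd s) = wd (h :: s). Proof. by case: (creationP h). Qed.

Lemma adj_creationE h u : adj (creation F h) (wd u) = Y h u.
Proof.
apply: (total_ip wedge_totalP) => s.
by rewrite -adjE ?creationE ?wedge_ann //; exact: creation_bdd.
Qed.

Lemma creation_adj f g v : creation F f (adj (creation F g) v) =
  - adj (creation F g) (creation F f v) + '[f, g] *: v.
Proof.
have bf := creation_bdd f; have bg := adj_bdd (creation_bdd g).
suff e : creation F f \o adj (creation F g) = -1 *: (adj (creation F g) \o creation F f) +
    ('[f, g] *: idfun + (fun=> 0)).
  rewrite -[LHS]/((_ \o _) v) e.
  change (-1 *: adj (creation F g) (creation F f v) + ('[f, g] *: v + 0) =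
    - adj (creation F g) (creation F f v) + '[f, g] *: v).
  by rewrite scaleN1r addr0.
apply: (total_eq wedge_totalP); first exact: bdd_comp.
  apply: bdd_add; first exact: bdd_comp.
  by apply: bdd_add; [exact: bdd_id|exact: bdd_zero].
move=> s.
change (creation F f (adj (creation F g) (wd s)) = -1 *: adj (creation F g) (creation F f (wd s)) +
  ('[f, g] *: wd s + 0)).
rewrite creationE !adj_creationE Y_cons scaleN1r addr0 opprB subrK /Y (bdd_lsum _ _ bf).
by congr (lsum _ _); apply/funext => t /=; rewrite creationE.
Qed.

Lemma adj_creation f g v : adj (creation F g) (creation F f v) =
  '[f, g] *: v - creation F f (adj (creation F g) v).
Proof. by rewrite creation_adj opprD opprK addrCA subrr addr0. Qed.

(** Each vector of a wedge is moved across the inner product as an annihilator until only the vacuum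
    is left. Linearity and antisymmetry of [creation] follow by applying this to the defect of each
    identity. *)
Lemma annihilators_eq0 X b : bdd X ->
  (forall h v, adj (creation F h) (X v) = sgn b *: X (adj (creation F h) v)) ->
  (forall s, '[X (wd s), wd [::]] = 0) -> forall v, X v = 0.
Proof.
move=> bX hX X0.
have key u : forall v, '[X v, wd u] = 0.
  elim: u => [|h u ih] v.
    suff : total_fam wd by move/(total_ind (Q := [set v | '[X v, wd [::]] = 0])); apply => //;
      have := closed_ortho (adj X (wd [::])); congr closed_sub; apply/funext => x /=; rewrite adjE.
    exact: wedge_totalP.
  by rewrite -creationE (adjEr _ _ (creation_bdd h)) hX ipZl ih mulr0.
move=> v; apply: ip_inj => z; rewrite ip0l ipC.
suff -> : X v = 0 by rewrite ip0r rmorph0.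
by apply: (total_ip0 wedge_totalP) => u; rewrite ipC key rmorph0.
Qed.

Lemma wedge0_ip h s : '[wd (h :: s), wd [::]] = 0.
Proof. by rewrite wedgeE. Qed.

Lemma creation_lin c f g v :
  creation F (c *: f + g) v = c *: creation F f v + creation F g v.
Proof.
pose X v := creation F (c *: f + g) v - (c *: creation F f v + creation F g v).
have bX : bdd X.
  have := bdd_add (-1) (bdd_add c (creation_bdd f) (creation_bdd g)) (creation_bdd (c *: f + g)).
  congr bdd; apply/funext => u; rewrite /X.
  change (-1 *: (c *: creation F f u + creation F g u) + creation F (c *: f + g) u =
    creation F (c *: f + g) u - (c *: creation F f u + creation F g u)).
  by rewrite scaleN1r addrC.
apply/eqP; rewrite -subr_eq0 -/(X v); apply/eqP; move: v.
apply: (annihilators_eq0 (b := true)) => // [h v|s]; last first.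
  by rewrite /X !creationE ipBl ipDl ipZl !wedge0_ip mulr0 !addr0 subr0.
have bh := adj_bdd (creation_bdd h).
rewrite /X scaleN1r (bddB _ _ bh) (bddD _ _ bh) (bddZ _ _ bh) !adj_creation.
rewrite ipDl ipZl; apply: ip_inj => z.
by rewrite !(ipDl, ipNl, ipZl); ring.
Qed.

Lemma creation_anti f g v :
  creation F f (creation F g v) = - creation F g (creation F f v).
Proof.
pose X v := creation F f (creation F g v) + creation F g (creation F f v).
have bf := creation_bdd f; have bg := creation_bdd g.
have bX : bdd X.
  have := bdd_add 1 (bdd_comp bf bg) (bdd_comp bg bf); congr bdd; apply/funext => u.
  by change (1 *: creation F f (creation F g u) + creation F g (creation F f u) = X u); rewrite scale1r.
apply/eqP; rewrite -addr_eq0 -/(X v); apply/eqP; move: v.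
apply: (annihilators_eq0 (b := false)) => // [h v|s]; last first.
  by rewrite /X !creationE ipDl !wedge0_ip addr0.
have bh := adj_bdd (creation_bdd h).
rewrite /X scale1r (bddD _ _ bh) !adj_creation (bddB _ _ bf) (bddB _ _ bg) (bddZ _ _ bf) (bddZ _ _ bg).
by apply: ip_inj => z; rewrite !(ipDl, ipNl, ipZl); ring.
Qed.

End Fock.

Section CARAlgebra.
Context {R : realType} (H : hilbert R) (F : fock H).
Local Notation A := (CAR_algebra F).

Lemma bounded_Cstar : Cstar_algebra (bounded F).
Proof.
split=> //; first by split=> //; exact/bounded_bdd/bdd_id.
- by move=> c x y /bounded_bdd bx /bounded_bdd by_; apply/bounded_bdd; exact: bdd_add.
- by move=> x y /bounded_bdd bx /bounded_bdd by_; apply/bounded_bdd; exact: bdd_comp.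
- by move=> x /bounded_bdd bx; apply/bounded_bdd; exact: adj_bdd.
Qed.

Lemma CAR_Cstar : Cstar_algebra A.
Proof.
have Ab : A `<=` bounded F.
  move=> x hx; apply: (hx (bounded F)); split; first exact: bounded_Cstar.
  by move=> _ [h _ <-]; exact/bounded_bdd/creation_bdd.
split; first by split=> // B [[[_ B1] _ _ _ _] _].
- by move=> c x y hx hy B hB; case: (hB) => -[_ h _ _ _] _; apply: h; [exact: hx|exact: hy].
- by move=> x y hx hy B hB; case: (hB) => -[_ _ h _ _] _; apply: h; [exact: hx|exact: hy].
- by move=> x hx B hB; case: (hB) => -[_ _ _ h _] _; apply: h; exact: hx.
- move=> x bx hx B hB; case: (hB) => -[_ _ _ _ h] _; apply: h => // e e0.
  by have [y Ay hy] := hx e e0; exists y => //; exact: Ay.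
Qed.

Lemma CAR_creation h : A (creation F h).
Proof. by move=> B [_]; apply; exists h. Qed.

Lemma CAR_ind (B : set (F -> F)) : Cstar_algebra B -> (forall h, B (creation F h)) -> A `<=` B.
Proof. by move=> cB hB x; apply; split=> // _ [h _ <-]. Qed.

End CARAlgebra.

(** * The GNS representation of a quasi-free state *)

Section QuasiFree.
Context {R : realType} (H : hilbert R) (T : H -> H) (F : fock H) (w : (F -> F) -> R[i]).
Context (L : hilbert R) (pi : (F -> F) -> (L -> L)) (Omega : L).
Hypothesis Tsa : forall x y, '[T x, y] = '[x, T y].
Hypothesis hw : quasi_free T w.
Hypothesis hpi : GNS (CAR_algebra F) w pi Omega.
Local Notation A := (CAR_algebra F).

(** The index type [unit] makes a single copy of the relations a one-species [CAR_system]. *)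
Definition gns_letter (_ : unit) f := pi (creation F f).
Local Notation a := gns_letter.

Let hom : star_hom A (bounded L) pi. Proof. by case: hpi. Qed.
Let cA : Cstar_algebra A := CAR_Cstar F.
Let Ac h : A (creation F h). Proof. exact: CAR_creation. Qed.
Let pA x : A x -> bdd (pi x). Proof. by move=> Ax; apply/bounded_bdd; exact: (shom_M hom Ax). Qed.
Let Aj x : A x -> A (adj x). Proof. by case: cA => _ _ _ h _; apply: h. Qed.
Let AM x y : A x -> A y -> A (x \o y). Proof. by case: cA => _ _ h _ _; apply: h. Qed.
Let A1 : A idfun. Proof. by case: cA => -[]. Qed.

Lemma gns_CAR : CAR_system a.
Proof.
rewrite /gns_letter; split=> [i f|i c f g v|i f g v|i f g v|[] [] //].
- exact: pA.
- rewrite -(shom_lin hom) //; congr (pi _ v); apply/funext => u; exact: creation_lin.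
- have e : creation F f \o creation F g = -1 *: (creation F g \o creation F f) + (fun=> 0).
    apply/funext => u; change (creation F f (creation F g u) =
      -1 *: creation F g (creation F f u) + 0); by rewrite addr0 scaleN1r creation_anti.
  have := congr1 (fun x => pi x v) e.
  rewrite (shom_lin hom _ _ (AM (Ac g) (Ac f)) (Cstar_0 cA)) (shom_0 hom A1).
  by rewrite (shom_comp hom (Ac f) (Ac g)) (shom_comp hom (Ac g) (Ac f)) /= addr0 scaleN1r.
- have e : creation F f \o adj (creation F g) = -1 *: (adj (creation F g) \o creation F f) +
      ('[f, g] *: idfun + (fun=> 0)).
    apply/funext => u; change (creation F f (adj (creation F g) u) =
      -1 *: adj (creation F g) (creation F f u) + ('[f, g] *: u + 0)).
    by rewrite addr0 scaleN1r creation_adj.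
  have := congr1 (fun x => pi x v) e.
  have Ag := Aj (Ac g); have A0 := Cstar_0 cA.
  have Al : A ('[f, g] *: idfun + (fun=> 0)) by case: cA => _ h _ _ _; apply: h.
  rewrite (shom_lin hom _ _ (AM Ag (Ac f)) Al) (shom_lin hom _ _ A1 A0) (shom_0 hom A1).
  rewrite (shom_id hom) (shom_comp hom (Ac f) Ag) (shom_comp hom Ag (Ac f)) (shom_adj hom (Ac g)) /=.
  by rewrite addr0 scaleN1r.
Qed.

Let hC := gns_CAR.
Let wb u : bdd (wop a u) := wop_bdd hC u.
Let ab i f : bdd (a i f) := a_bdd hC i f.

(** The algebra is a norm closure, while no continuity of [pi] is assumed; [shom_le] supplies it, so
    that norm limits keep commuting with the commutant of the words. *)
Lemma gns_bicommutant x : A x -> bicommutant (words a) (pi x).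
Proof.
have sW := words_star_closed hC.
move: x; suff : A `<=` [set x | A x /\ bicommutant (words a) (pi x)] by move=> h x /h[].
apply: CAR_ind => [|h]; last first.
  split=> //; apply: sub_bicommutant; first by case: sW.
  by exists [:: (tt, false, h)].
split=> [|c x y [Ax Mx] [Ay My]|x y [Ax Mx] [Ay My]|x [Ax Mx]|x bx hx].
- split=> [x [Ax _]|]; first by case: cA => -[h _] _ _ _ _; apply: h.
  by split=> //; rewrite (shom_id hom); apply: sub_bicommutant; [case: sW|exists [::]].
- split; first by case: cA => _ h _ _ _; apply: h.
  have -> : pi (c *: x + y) = c *: pi x + pi y by apply/funext => v; exact: (shom_lin hom).
  exact: bicommutant_lin.
- by split; [exact: AM|rewrite (shom_comp hom) //; exact: bicommutant_comp].
- by split; [exact: Aj|rewrite (shom_adj hom) //; exact: bicommutant_adj].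
have Ax : A x.
  case: cA => _ _ _ _; apply=> // e e0; have [y [Ay _] hy] := hx e e0; by exists y.
split=> //; apply/commutantE; split=> [|z hz]; first exact: pA.
have bz : bdd z by move/commutantE: hz => [].
apply/funext => v /=; apply/eqP; rewrite -subr_eq0; apply/eqP.
have [C C0 hz2] := bdd_near bz.
apply: (@nrm_eps _ _ _ (nrm (z v) + C * nrm v)) => e e0.
have [|y [Ay My] hy] := hx (real_complex R e); first by rewrite ltcR.
have Ad : A (-1 *: y + x) by case: cA => _ h _ _ _; apply: h.
have hd u : nrm (pi x u - pi y u) <= e * nrm u.
  have -> : pi x u - pi y u = pi (-1 *: y + x) u by rewrite (shom_lin hom) // scaleN1r addrC.
  apply: (shom_le cA hom Ad (ltW e0)) => u'.
  change (nrm (-1 *: y u' + x u') <= e * nrm u'); rewrite scaleN1r addrC.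
  by have := hy u'; rewrite !nrmE -rmorphM lecR.
have -> : z (pi x v) - pi x (z v) =
    (z (pi x v) - z (pi y v)) - (pi x (z v) - pi y (z v)).
  by rewrite (bicommutant_comm v My hz) opprB addrA subrK.
apply: le_trans (nrmD _ _) _; rewrite nrmN mulrDl addrC; apply: lerD.
  by apply: le_trans (hd _) _; rewrite mulrC.
apply: le_trans (hz2 _ _) _; rewrite -!mulrA ler_wpM2l ?(ltW C0) //.
by apply: le_trans (hd _) _; rewrite mulrC.
Qed.

Lemma gns_algebra : bicommutant (pi @` A) = bicommutant (words a).
Proof.
apply/seteqP; split=> x /commutantE[bx hx]; apply/commutantE; split=> // y /commutantE[b h].
  apply: hx; apply/commutantE; split=> // _ [z Az <-]; have /commutantE[_ hz] := gns_bicommutant Az.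
  by apply/esym/hz/commutantE.
apply: hx; apply/commutantE; split=> // _ [u _ <-]; apply: h.
suff [z Az <-] : exists2 z, A z & pi z = wop a u by exists z.
elim: u => [|[[[] s] f] u [z Az ez]]; first by exists idfun => //; exact: (shom_id hom).
rewrite /= -ez; case: s; last by exists (creation F f \o z); [exact: AM|exact: (shom_comp hom)].
exists (adj (creation F f) \o z); first by apply: AM => //; exact: Aj.
by rewrite (shom_comp hom (Aj (Ac f)) Az) (shom_adj hom (Ac f)).
Qed.

Lemma gns_total : total_fam (fun u => wop a u Omega).
Proof.
apply: (@cyclic_total _ _ (words a) Omega _ (wop a)); first exact: words_star_closed.
- by move=> u; exists u.
- by move=> x [u _ <-]; exists u.
move=> y hy; case: hpi => _ d _.
have : dense (lin_span [set pi x Omega | x in A]).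
  move=> O O0 oO; have [z [Oz hz]] := d O O0 oO; exists z; split=> //.
  exists 1%N, (fun=> 1), (fun=> z); split=> //; by rewrite big_ord1 scale1r.
have -> : [set pi x Omega | x in A] = range (fun x : {x | A x} => pi (sval x) Omega).
  apply/seteqP; split=> [_ [x Ax <-]|_ [[x Ax] _ <-]]; last by exists x.
  by exists (exist _ x Ax).
move/totalP => tot; apply: (total_ip0 tot) => -[x Ax] /=.
exact: hy (gns_bicommutant Ax).
Qed.

Definition cre (g : seq H) : L -> L := wop a [seq (tt, false, v) | v <- g].

Lemma cre_bdd g : bdd (cre g). Proof. exact: wb. Qed.

Lemma cre_cons f g v : cre (f :: g) v = a tt f (cre g v). Proof. by []. Qed.

Lemma gns_moments g f : '[cre g Omega, cre f Omega] = gdet (fun x y => '[x, T y]) g f.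
Proof.
have [_ hdet] := hw; have := hdet f g.
set p := opprod _ => hp.
have /= Ap : A p /\ pi p = adj (cre f) \o cre g.
  rewrite /p.
  have Acr : A (opprod [seq creation F v | v <- g]) /\
      pi (opprod [seq creation F v | v <- g]) = cre g.
    elim: {hp p} g => [|x g [Ag eg]]; first by split=> //; exact: (shom_id hom).
    by split; [exact: AM|rewrite /= (shom_comp hom) // eg].
  have hrev (s : seq (F -> F)) (t : seq (F -> F)) : opprod (s ++ t) = opprod s \o opprod t.
    by elim: s => //= y s ->.
  rewrite hrev; have [Ag eg] := Acr.
  suff [Af ef] : A (opprod [seq adj (creation F v) | v <- rev f]) /\
      pi (opprod [seq adj (creation F v) | v <- rev f]) = adj (cre f).
    by split; [exact: AM|rewrite (shom_comp hom) // eg ef].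
  elim: f {hp p} => [|x f [Af ef]]; first by split=> //; rewrite (shom_id hom) adj_id.
  rewrite rev_cons map_rcons -cats1 hrev; split; first by apply: AM => //; exact: Aj.
  rewrite (shom_comp hom) //; last exact: Aj.
  rewrite ef /= (shom_adj hom) // -[cre (x :: f)]/(a tt x \o cre f) adj_comp //.
  exact: cre_bdd.
case: Ap => Ap ep; case: hpi => _ _ hO; have := hO p Ap; rewrite hp ep /= => e.
rewrite (adjEr _ _ (cre_bdd f)) e /gdet eq_sym; case: eqP => // e'.
by rewrite e'.
Qed.

Lemma cre_annihilate h g z : adj (a tt h) (cre g z) =
  \sum_(p <- del (fun x => '[x, h]) g) p.1 *: cre p.2 z
  + sgn (odd (size g)) *: cre g (adj (a tt h) z).
Proof.
elim: g => [|x g ih]; first by rewrite /= big_nil add0r scale1r.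
have -> : adj (a tt h) (cre (x :: g) z) = '[x, h] *: cre g z - a tt x (adj (a tt h) (cre g z)).
  by rewrite cre_cons (a_car hC) opprD opprK addrCA subrr addr0.
rewrite ih (bddD _ _ (ab tt x)) (bdd_sum _ _ _ (ab tt x)) (bddZ _ _ (ab tt x)) opprD addrA.
rewrite /= big_cons big_map -sumrN; congr (_ + _ + _).
  by apply: eq_bigr => p _; rewrite (bddZ _ _ (ab tt x)) scaleNr.
by rewrite -scaleNr; congr (_ *: _); case: (odd _) => /=; rewrite /sgn ?opprK.
Qed.

Lemma cre_rcons g h z : cre g (a tt h z) = sgn (odd (size g)) *: cre (h :: g) z.
Proof.
elim: g => [|x g ih]; first by rewrite scale1r.
rewrite cre_cons ih (bddZ _ _ (ab tt x)) /= !cre_cons (a_anti hC) scalerN -scaleNr.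
by congr (_ *: _); case: (odd _) => /=; rewrite /sgn ?opprK.
Qed.

Lemma normal_word (u : seq (letter unit H)) : is_normal u ->
  exists f g, u = wstar [seq (tt, false, v) | v <- f] ++ [seq (tt, false, v) | v <- g].
Proof.
move=> [s [t [-> hs ht]]]; exists [seq l.2 | l : letter unit H <- rev s], [seq l.2 | l : letter unit H <- t].
rewrite /wstar -!map_rev revK -!map_comp; congr (_ ++ _).
  elim: s hs => //= -[[[] b] x] s ih /= /andP[-> /ih {1}->].
  by [].
by elim: t ht => //= -[[[] b] x] t ih /= /andP[/negPf -> /ih {1}->].
Qed.

Lemma cre_ip f g x y : '[wop a (wstar [seq (tt, false, v) | v <- f] ++ [seq (tt, false, v) | v <- g]) x, y] =
  '[cre g x, cre f y].
Proof. by rewrite wop_cat -(wop_star hC) -adjEr //; exact: cre_bdd. Qed.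

(** Both sides satisfy the exchange relation, so their difference is tested on normally ordered
    words. There it becomes an identity between two first-row expansions of determinants, with rows
    [f] and [T f]. *)
Lemma gns_kms f u : '[a tt (T f) (wop a u Omega), Omega] = '[wop a u (a tt (f - T f) Omega), Omega].
Proof.
pose phi u := '[wop a u Omega, adj (a tt (T f)) Omega] - '[wop a u (a tt (f - T f) Omega), Omega].
apply/eqP; rewrite -subr_eq0 (adjE _ _ (ab tt (T f))) -/(phi u); apply/eqP.
move: u; apply: normal_order => [u l m v|u /normal_word[s [g ->]]].
  rewrite /phi !(wop_swaps hC _ _ u l m v); ring.
rewrite /phi !cre_ip cre_rcons ipZl.
have -> : '[cre ((f - T f) :: g) Omega, cre s Omega] =
    gdet (fun x y => '[x, T y]) (f :: g) s - gdet (fun x y => '[x, T y]) (T f :: g) s.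
  by rewrite -!gns_moments -ipBl !cre_cons (aB hC).
have e1 : '[cre g Omega, cre s (adj (a tt (T f)) Omega)] = sgn (odd (size s)) *
    (gdet (fun x y => '[x, T y]) (T f :: g) s - gdet (fun x y => '[x, T y]) (f :: g) s).
  have := cre_annihilate (T f) s Omega; move/(congr1 (fun x => '[cre g Omega, x])).
  rewrite -(adjE _ _ (ab tt (T f))) -cre_cons gns_moments ipDr ipZr ip_sumr => ->.
  have -> : \sum_(p <- del (fun x => '[x, T f]) s) '[cre g Omega, p.1 *: cre p.2 Omega] =
      gdet (fun x y => '[x, T y]) (f :: g) s.
    rewrite gdet_cons; under eq_bigr do rewrite ipZr gns_moments.
    rewrite (del_map _ _ (gdet (fun x y => '[x, T y]) g)); last by move=> x; rewrite rmorphN.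
    by congr (\sum_(p <- del _ _) _); apply/funext => x /=; rewrite -ipC Tsa.
  by rewrite sgn_conj [X in _ * (X - _)]addrC addrK mulrA sgn_sq mul1r.
rewrite {}e1.
have [e|ne] := eqVneq (size s) (size g).+1; last first.
  by rewrite /gdet /= eq_sym (negPf ne) subrr !mulr0 subrr.
by rewrite e /=; case: (odd _); rewrite /sgn /=; ring.
Qed.

Let tot := gns_total.

(** Vacuum expectations are determined by inner products and [T], both respected by [V]; hence the
    map on word vectors preserves the Gram matrix. *)
Lemma gns_quantise V : bdd V -> (forall x y, '[V x, V y] = '[x, y]) ->
  (forall x, T (V x) = V (T x)) -> exists Lam, quantises a Omega (fun=> V) Lam.
Proof.
move=> bV iV TV; pose vw (u : seq (letter unit H)) := [seq (l.1.1, l.1.2, V l.2) | l <- u].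
have key u : '[wop a (vw u) Omega, Omega] = '[wop a u Omega, Omega].
  apply/eqP; rewrite -subr_eq0; apply/eqP; move: u; apply: normal_order => [u l m v|u /normal_word[s [g ->]]].
    rewrite /vw !map_cat /= (wop_swaps hC _ _ (vw u) (l.1.1, l.1.2, V l.2) (m.1.1, m.1.2, V m.2) (vw v)).
    have -> : cc (l.1.1, l.1.2, V l.2) (m.1.1, m.1.2, V m.2) = cc l m by rewrite /cc /same /= !iV.
    rewrite (wop_swaps hC _ _ u l m v) /vw /same /=; ring.
  have -> : vw (wstar [seq (tt, false, v) | v <- s] ++ [seq (tt, false, v) | v <- g]) =
      wstar [seq (tt, false, v) | v <- map V s] ++ [seq (tt, false, v) | v <- map V g].
    by rewrite /vw map_cat /wstar map_rev -!map_comp.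
  rewrite !cre_ip !gns_moments /gdet !size_map; case: eqP => [e|_]; last exact: subrr.
  apply/eqP; rewrite subr_eq0; apply/eqP; congr (\det _); apply/matrixP => i j; rewrite !mxE.
  by rewrite !(nth_map 0) ?TV ?iV // -?e.
have [|Lam bL [LE Li]] := @extension_isometry _ _ _ _ (fun u => wop a u Omega) (fun u => wop a (vw u) Omega) tot.
  have wip u s : '[wop a u Omega, wop a s Omega] = '[wop a (wstar s ++ u) Omega, Omega].
    by rewrite wop_cat -(wop_star hC) -adjEr.
  move=> u s; rewrite !wip -[RHS]key; congr ('[wop a _ Omega, _]).
  by rewrite /vw map_cat; congr (_ ++ _); rewrite /wstar map_rev -!map_comp.
exists Lam; split=> // [|i f v|i f v]; first exact: (LE [::]).
  have bl := ab i f; have bl' := ab i (V f).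
  apply: (congr1 (@^~ v) (_ : Lam \o a i f = a i (V f) \o Lam)).
  apply: (total_eq tot) => [||u] /=; [exact: bdd_comp|exact: bdd_comp|].
  by rewrite LE; exact: (LE ((i, false, f) :: u)).
have bl := adj_bdd (ab i f); have bl' := adj_bdd (ab i (V f)).
apply: (congr1 (@^~ v) (_ : Lam \o adj (a i f) = adj (a i (V f)) \o Lam)).
apply: (total_eq tot) => [||u] /=; [exact: bdd_comp|exact: bdd_comp|].
by rewrite LE; exact: (LE ((i, true, f) :: u)).
Qed.

Lemma gns_unit : '[Omega, Omega] = 1.
Proof.
by case: hpi => _ _ h; have := h _ A1; rewrite (shom_id hom) => ->; case: hw => -[_ _ ->].
Qed.

End QuasiFree.

(** * Operators on tensor powers *)

Section PowerTrick.
Context {R : realType}.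

(** Iterating the square inequality bounds [f 1 / f 0] by the [2^n]-th root of [f (2^n) / f 0], and
    growth of order [C^m] leaves only [C] in the limit. *)
Lemma power_trick (f : nat -> R) (K C : R) : (forall m, 0 <= f m) ->
  (forall m, f m ^+ 2 <= f (m + m)%N * f 0%N) -> (forall m, f m <= K * C ^+ m) -> 0 < C ->
  f 1%N <= C * f 0%N.
Proof.
move=> f0 hf hK C0; rewrite leNgt; apply/negP => lt.
have p0 : 0 < f 0%N.
  rewrite lt_neqAle f0 andbT eq_sym; apply/eqP => e.
  have := hf 1%N; rewrite e mulr0 real_exprn_even_le0 ?num_real //= => /eqP e1.
  by rewrite e1 e mulr0 ltxx in lt.
have p1 : 0 < f 1%N by apply: le_lt_trans lt; rewrite mulr_ge0 // ltW.
pose r := f 1%N / f 0%N.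
have r0 : 0 < r by rewrite divr_gt0.
have Cr : C < r by rewrite ltr_pdivlMr.
have low n : f 0%N * r ^+ (2 ^ n) <= f (2 ^ n)%N.
  elim: n => [|n ih]; first by rewrite expn0 expr1 /r mulrC divfK ?gt_eqF.
  rewrite expnS mul2n -addnn exprD -(ler_pM2r p0); apply: le_trans (hf _).
  apply: le_trans (_ : (f 0%N * r ^+ (2 ^ n)) ^+ 2 <= _).
    by rewrite le_eqVlt; apply/orP; left; apply/eqP; ring.
  by rewrite ler_pXn2r ?nnegrE ?mulr_ge0 ?exprn_ge0 // ltW.
have K0 : 0 <= K by have := hK 0%N; rewrite expr0 mulr1; apply: le_trans.
have q1 : `|C / r| < 1 by rewrite ger0_norm ?divr_ge0 ?ltW // ltr_pdivrMr // mul1r.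
have q0 : 0 <= C / r by rewrite divr_ge0 ?ltW.
have K1 : 0 < K + 1 by lra.
have /cvgrPdist_lt /(_ _ (divr_gt0 p0 K1)) [n _ hn] := cvg_expr q1.
have := hn n (leqnn n); rewrite /= sub0r normrN ger0_norm ?exprn_ge0 // ltr_pdivlMr //.
apply/negP; rewrite -leNgt; apply: le_trans (_ : K * (C / r) ^+ (2 ^ n) <= _).
  by rewrite expr_div_n mulrA ler_pdivlMr ?exprn_gt0 //; apply: le_trans (low n) (hK _).
have : (C / r) ^+ (2 ^ n) <= (C / r) ^+ n.
  have q1' : C / r <= 1 by apply: ltW; rewrite -(ger0_norm q0).
  exact: (ler_wiXn2l q0 q1' (ltnW (ltn_expl n (ltnSn 1)))).
have := exprn_ge0 n q0; have := exprn_ge0 (2 ^ n) q0.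
move: (_ ^+ n) (_ ^+ (2 ^ n)) => x y y0 x0 yx.
by rewrite mulrDr mulr1 [x * K]mulrC; apply: le_trans (ler_wpM2l K0 yx) _; rewrite lerDl.
Qed.

End PowerTrick.

Section TensorOp.
Context {R : realType} (L : hilbert R) (k : nat) (P : tensor_power L k).
Local Notation ten := (tensor P).
Implicit Types (x y : 'I_k -> L -> L) (v : 'I_k -> L).

Lemma tensor_totalP : total_fam ten.
Proof. by apply/totalP; exact: tensor_total. Qed.

Lemma nrm_tensor v : nrm (ten v) = \prod_i nrm (v i).
Proof.
apply/eqP; rewrite -(@eqrXn2 _ 2) ?prodr_ge0 //.
have : real_complex R (nrm (ten v) ^+ 2) = real_complex R ((\prod_i nrm (v i)) ^+ 2).
  rewrite -ipxx tensorE -prodrXl rmorph_prod; apply: eq_bigr => i _; exact: ipxx.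
by case=> /eqP.
Qed.

Let X x (v : 'I_k -> L) := ten (fun i => x i (v i)).

Lemma X_ip x y z l l' : (forall i p q, '[x i p, y i q] = '[z i p, q]) ->
  '[lsum (X x) l, lsum (X y) l'] = '[lsum (X z) l, lsum ten l'].
Proof.
move=> h; rewrite !lsum_ip; apply: eq_bigr => p _; apply: eq_bigr => q _; congr (_ * _).
by rewrite !tensorE; apply: eq_bigr.
Qed.

(* The bound on elementary tensors is promoted to linear combinations by the power trick:
   with h = x^* x, the norms of (h^m)^{(x) k} l grow at most like C^m. *)
Lemma tensor_op_exists x : (forall i, bdd (x i)) ->
  exists2 Y : P -> P, bdd Y & forall v, Y (ten v) = ten (fun i => x i (v i)).
Proof.
move=> bx; pose h i := adj (x i) \o x i.
have bh i : bdd (h i) by apply: bdd_comp (adj_bdd _) _; exact: bx.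
have /choice[c hc] : forall i, exists c, 0 <= c /\ forall u, nrm (h i u) <= c * nrm u.
  by move=> i; have [_ [c c0 hc]] := bh i; exists c.
pose C := \prod_i (c i + 1).
have c1 i : 0 <= c i + 1 by have [] := hc i; lra.
have C0 : 0 < C by apply: prodr_gt0 => i _; have [] := hc i; lra.
have hsa i m p q : '[iter m (h i) p, q] = '[p, iter m (h i) q].
  elim: m p q => // m ih p q; rewrite iterS [in RHS]iterSr -ih.
  by rewrite /h /= (adjE _ _ (adj_bdd (bx i))) (adjK (bx i)) -(adjE _ _ (bx i)).
have growth m i u : nrm (iter m (h i) u) <= (c i + 1) ^+ m * nrm u.
  elim: m => [|m ih]; first by rewrite mul1r.
  rewrite iterS exprS -mulrA; have [c0 hc'] := hc i.
  apply: le_trans (hc' _) _; apply: ler_pM => //; lra.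
(* The squared norm is bounded by [C] times that of the argument; [C + 1] avoids a square root,
   since [C <= (C + 1)^2]. *)
apply: (@extension _ _ _ _ _ _ (C + 1) tensor_totalP) => l.
pose f m := nrm (lsum (X (fun i => iter m (h i))) l).
have f0 : f 0%N = nrm (lsum ten l) by [].
have fx : nrm (lsum (X x) l) ^+ 2 <= f 1%N * f 0%N.
  rewrite -Re_ipxx (@X_ip _ _ (fun i => iter 1 (h i))) => [|i p q]; last first.
    by rewrite /h /= adjEr // (adjE _ _ (adj_bdd (bx i))) (adjK (bx i)).
  exact: le_trans (Re_le_normc _) (cauchy_schwarz _ _).
have ff m : f m ^+ 2 <= f (m + m)%N * f 0%N.
  rewrite -Re_ipxx (@X_ip _ _ (fun i => iter (m + m) (h i))) => [|i p q].
    exact: le_trans (Re_le_normc _) (cauchy_schwarz _ _).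
  by rewrite iterD [RHS]hsa.
pose K := \sum_(p <- l) normc p.1 * nrm (ten p.2).
have fK m : f m <= K * C ^+ m.
  apply: le_trans (nrm_sum _ _ _) _; rewrite mulr_suml; apply: ler_sum => p _.
  rewrite nrmZ -mulrA ler_wpM2l // /X !nrm_tensor mulrC -prodrXl -big_split.
  by apply: ler_prod => i _; rewrite nrm_ge0 growth.
have := @power_trick _ f K C (fun m => nrm_ge0 _) ff fK C0; rewrite f0 => h1.
rewrite -(@ler_pXn2r _ 2) ?nnegrE ?mulr_ge0 //; last by lra.
apply: le_trans fx _; rewrite f0 exprMn.
apply: le_trans (_ : C * nrm (lsum ten l) ^+ 2 <= _).
  by rewrite expr2 mulrA ler_wpM2r.
by rewrite ler_wpM2r ?sqr_ge0 //; nra.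
Qed.

Lemma tensor_opP x : (forall i, bdd (x i)) ->
  bdd (tensor_op P x) /\ forall v, tensor_op P x (ten v) = ten (fun i => x i (v i)).
Proof.
move=> /tensor_op_exists[Y bY hY].
have : exists Z, [set Z | bounded P Z /\ forall v, Z (ten v) = ten (fun i => x i (v i))] Z.
  by exists Y; split=> //; exact/bounded_bdd.
by move/getPex => -[/bounded_bdd b e]; split.
Qed.

Lemma tensor_op_bdd x : (forall i, bdd (x i)) -> bdd (tensor_op P x).
Proof. by move/tensor_opP => []. Qed.
Lemma tensor_opE x v : (forall i, bdd (x i)) -> tensor_op P x (ten v) = ten (fun i => x i (v i)).
Proof. by move/tensor_opP => []. Qed.

Lemma tensor_op_uniq x (Y : P -> P) : (forall i, bdd (x i)) -> bdd Y ->
  (forall v, Y (ten v) = ten (fun i => x i (v i))) -> tensor_op P x = Y.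
Proof.
move=> bx bY h; apply: (total_eq tensor_totalP) => // [|v]; first exact: tensor_op_bdd.
by rewrite tensor_opE.
Qed.

Lemma tensor_op_comp x y : (forall i, bdd (x i)) -> (forall i, bdd (y i)) ->
  tensor_op P x \o tensor_op P y = tensor_op P (fun i => x i \o y i).
Proof.
move=> bx by_; apply/esym/tensor_op_uniq => [i||v]; first exact: bdd_comp.
  by apply: bdd_comp; exact: tensor_op_bdd.
by rewrite /= !tensor_opE.
Qed.

Lemma tensor_op_adj x : (forall i, bdd (x i)) ->
  adj (tensor_op P x) = tensor_op P (fun i => adj (x i)).
Proof.
move=> bx; have bx' i : bdd (adj (x i)) by apply: adj_bdd.
apply/esym/tensor_op_uniq => // [|v]; first exact/adj_bdd/tensor_op_bdd.
apply: (total_ip tensor_totalP) => u.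
rewrite -adjE ?tensor_opE ?tensorE //; last exact: tensor_op_bdd.
by apply: eq_bigr => i _; rewrite adjE.
Qed.

Lemma tensor_op_id : tensor_op P (fun=> idfun) = idfun.
Proof. by apply: tensor_op_uniq => // *; exact: bdd_id. Qed.

Lemma tensor_op_isometry x : (forall i, bdd (x i)) ->
  (forall i p q, '[x i p, x i q] = '[p, q]) ->
  forall p q, '[tensor_op P x p, tensor_op P x q] = '[p, q].
Proof.
move=> bx ix; have [|Y bY [YE Yi]] := @extension_isometry _ _ _ _ ten (X x) tensor_totalP.
  by move=> s t; rewrite !tensorE; apply: eq_bigr.
by have -> : tensor_op P x = Y by exact: tensor_op_uniq.
Qed.

Definition upd v i z : 'I_k -> L := fun j => if j == i then z else v j.

Lemma upd_tensor_ip v i (z : L) u :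
  '[ten u, ten (upd v i z)] = '[u i, z] * \prod_(j < k | j != i) '[u j, v j].
Proof.
rewrite tensorE (bigD1 i) //= /upd eqxx; congr (_ * _).
by apply: eq_bigr => j /negPf ->.
Qed.

Lemma upd_tensor_bdd v i : bdd (fun z : L => ten (upd v i z)).
Proof.
split=> [c x y|].
  apply: (total_ip tensor_totalP) => u.
  by rewrite [RHS]ipDr ipZr !upd_tensor_ip ipDr ipZr mulrDl mulrA.
exists (\prod_(j < k | j != i) nrm (v j)) => [|z]; first by apply: prodr_ge0.
rewrite nrm_tensor (bigD1 i) //= /upd eqxx mulrC; apply: ler_wpM2r => //.
by rewrite le_eqVlt; apply/orP; left; apply/eqP; apply: eq_bigr => j /negPf ->.
Qed.

Definition slot (i : 'I_k) (x : L -> L) : P -> P :=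
  tensor_op P (fun j => if j == i then x else idfun).

Let sb (i : 'I_k) (x : L -> L) : bdd x -> forall j, bdd (if j == i then x else idfun).
Proof. by move=> bx j; case: ifP => // _; exact: bdd_id. Qed.

Lemma slot_bdd i (x : L -> L) : bdd x -> bdd (slot i x).
Proof. by move=> bx; apply: tensor_op_bdd; exact: sb. Qed.

Lemma slotE i (x : L -> L) v : bdd x -> slot i x (ten v) = ten (upd v i (x (v i))).
Proof.
move=> bx; rewrite /slot tensor_opE; last exact: sb.
by congr tensor; apply/funext => j; rewrite /upd; case: eqP => // ->.
Qed.

Lemma slot_upd i (x : L -> L) v (z : L) : bdd x -> slot i x (ten (upd v i z)) = ten (upd v i (x z)).
Proof.
move=> bx; rewrite slotE //; congr tensor; apply/funext => j; rewrite /upd eqxx.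
by case: eqP.
Qed.

Lemma slot_comp i (x y : L -> L) : bdd x -> bdd y -> slot i (x \o y) = slot i x \o slot i y.
Proof.
move=> bx by_; rewrite /slot tensor_op_comp; [|exact: sb|exact: sb].
by congr tensor_op; apply/funext => j; case: eqP.
Qed.

Lemma slot_adj i (x : L -> L) : bdd x -> adj (slot i x) = slot i (adj x).
Proof.
move=> bx; rewrite /slot tensor_op_adj; last exact: sb.
by congr tensor_op; apply/funext => j; case: eqP => // _; exact: adj_id.
Qed.

Lemma slot_commute i j (x y : L -> L) : bdd x -> bdd y -> i != j ->
  slot i x \o slot j y = slot j y \o slot i x.
Proof.
move=> bx by_ ij; rewrite /slot !tensor_op_comp; do ?exact: sb.
congr tensor_op; apply/funext => m; case: (eqVneq m i) => [->|_].
  by rewrite (negPf ij).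
by case: eqP.
Qed.

Lemma slot_lin i c (x y : L -> L) p : bdd x -> bdd y ->
  slot i (c *: x + y) p = c *: slot i x p + slot i y p.
Proof.
move=> bx by_; have bxy := bdd_add c bx by_.
apply: (congr1 (@^~ p) (_ : slot i (c *: x + y) = c *: slot i x + slot i y)).
apply: (total_eq tensor_totalP) => [||v]; first exact: slot_bdd.
  by apply: bdd_add; exact: slot_bdd.
change (slot i (c *: x + y) (ten v) = c *: slot i x (ten v) + slot i y (ten v)).
rewrite !slotE // -(bdd_lin _ _ _ (upd_tensor_bdd v i)).
by [].
Qed.

Lemma slot_id i : slot i idfun = idfun.
Proof.
rewrite /slot -[RHS]tensor_op_id; congr tensor_op; apply/funext => j; by case: ifP.
Qed.

End TensorOp.
Arguments slot {R L k} P i x.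
Arguments tensor_totalP {R L k} P.
Arguments upd_tensor_bdd {R L k} P v i.
Arguments tensor_op_bdd {R L k} P [x].
Arguments slot_bdd {R L k} P i [x].
Arguments slot_commute {R L k} P [i j x y].

(** * Tensor powers as fermionic systems *)

Section TensorFermi.
Context {R : realType} (H L : hilbert R) (a : unit -> H -> L -> L) (Om : L) (T : H -> H).
Hypothesis hC : CAR_system a.
Hypothesis tot : total_fam (fun u => wop a u Om).
Hypothesis hOm : '[Om, Om] = 1.
Hypothesis kms : forall f u, '[a tt (T f) (wop a u Om), Om] = '[wop a u (a tt (f - T f) Om), Om].
Hypothesis quant : forall V, bdd V -> (forall x y, '[V x, V y] = '[x, y]) ->
  (forall x, T (V x) = V (T x)) -> exists Lam, quantises a Om (fun=> V) Lam.
Context (k : nat) (P : tensor_power L k).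

Let ab i f : bdd (a i f) := a_bdd hC i f.
Let wb u : bdd (wop a u) := wop_bdd hC u.
Let lb l : bdd (lop a l) := lop_bdd hC l.

Definition tletter (i : 'I_k) f : P -> P := slot P i (a tt f).
Local Notation ak := tletter.
Definition tvac : P := tensor P (fun=> Om).

Definition species (j : 'I_k) (u : seq (letter 'I_k H)) : seq (letter unit H) :=
  [seq (tt, l.1.2, l.2) | l <- u & l.1.1 == j].

Lemma slot_0 i p : slot P i (fun=> 0) p = 0.
Proof.
have -> : (fun=> 0) = -1 *: @idfun L + idfun.
  by apply/funext => u; change (0 = -1 *: u + u); rewrite scaleN1r addNr.
have b1 := @bdd_id R L.
by rewrite slot_lin // slot_id scaleN1r addNr.
Qed.

Lemma tletter_bdd i f : bdd (ak i f). Proof. exact: slot_bdd. Qed.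

Lemma tletter_lop i s f : lop ak (i, s, f) = slot P i (lop a (tt, s, f)).
Proof. by case: s => //; rewrite /lop /= -slot_adj. Qed.

Lemma tletter_CAR : CAR_system ak.
Proof.
have z := @bdd_zero R L L.
split=> [i f|i c f g v|i f g v|i f g v|i j f g v ij].
- exact: tletter_bdd.
- rewrite /ak -slot_lin //; congr (slot P i _ v); apply/funext => u; exact: a_lin.
- have e : a tt f \o a tt g = -1 *: (a tt g \o a tt f) + (fun=> 0).
    apply/funext => u; change (a tt f (a tt g u) = -1 *: a tt g (a tt f u) + 0).
    by rewrite addr0 scaleN1r a_anti.
  have bfg := bdd_comp (ab tt g) (ab tt f).
  have := congr1 (fun x => slot P i x v) e; rewrite slot_comp // slot_lin // slot_0 slot_comp //.
  by rewrite addr0 scaleN1r.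
- have bg := adj_bdd (ab tt g).
  have e : a tt f \o adj (a tt g) = -1 *: (adj (a tt g) \o a tt f) + ('[f, g] *: idfun + (fun=> 0)).
    apply/funext => u; change (a tt f (adj (a tt g) u) =
      -1 *: adj (a tt g) (a tt f u) + ('[f, g] *: u + 0)).
    by rewrite addr0 scaleN1r a_car.
  have b1 := @bdd_id R L.
  have bfg := bdd_comp bg (ab tt f); have b2 := bdd_add '[f, g] b1 z.
  have := congr1 (fun x => slot P i x v) e; rewrite slot_comp // !slot_lin // slot_0 slot_comp //.
  by rewrite slot_id addr0 scaleN1r /ak slot_adj.
have bg := adj_bdd (ab tt g); rewrite /ak (slot_adj _ _ (ab tt g)).
split; first exact: (congr1 (@^~ v) (slot_commute P (ab tt f) (ab tt g) ij)).
exact: (congr1 (@^~ v) (slot_commute P (ab tt f) bg ij)).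
Qed.

Let hCk := tletter_CAR.

(** Species sit in different slots, so a word factorises into the subwords of its species, each
    keeping its order. Totality, KMS and the description of the algebra reduce to one factor through
    this. *)
Lemma wop_tensor u : wop ak u = tensor_op P (fun j => wop a (species j u)).
Proof.
elim: u => [|[[i s] f] u ih]; first by rewrite /= tensor_op_id.
rewrite /= ih tletter_lop /slot tensor_op_comp => [|j|j]; last exact: wb.
  by congr tensor_op; apply/funext => j; rewrite /species /= eq_sym; case: eqP.
by case: eqP => // _; exact: bdd_id.
Qed.

Lemma wop_tvac u : wop ak u tvac = tensor P (fun j => wop a (species j u) Om).
Proof. by rewrite wop_tensor tensor_opE. Qed.

(* The vacuum is replaced by arbitrary vectors one slot at a time. *)
Lemma tvac_total : total_fam (fun u => wop ak u tvac).
Proof.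
apply: total_of_ortho => y hy.
have key (s : seq 'I_k) : forall u v, (forall j, j \notin s -> v j = Om) ->
    '[wop ak u (tensor P v), y] = 0.
  elim: s => [|i s ih] u v hv.
    by rewrite (_ : v = fun=> Om) ?hy //; apply/funext => j; exact: hv.
  have bw := wop_bdd hCk u.
  have -> : v = upd v i (v i) by apply/funext => j; rewrite /upd; case: eqP => // ->.
  have bz := bdd_comp bw (upd_tensor_bdd P v i).
  apply: (total_ind tot (Q := [set z | '[wop ak u (tensor P (upd v i z)), y] = 0])).
    have [q0 ql qc] := closed_ortho y; split=> [|c p q /= hp hq|p hp] /=.
    - by have := bdd0 bz => /= ->; rewrite ip0l.
    - by have := bdd_lin c p q bz => /= ->; apply: ql.
    - apply: qc => e e0; have [C C0 hC'] := bdd_near bz.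
      have [q hq pq] := hp _ (divr_gt0 e0 C0).
      exists (wop ak u (tensor P (upd v i q))) => //.
      by apply: le_lt_trans (hC' p q) _; rewrite mulrC -ltr_pdivlMr.
  move=> t /=.
  pose t' : seq (letter 'I_k H) := [seq (i, l.1.2, l.2) | l : letter unit H <- t].
  have -> : tensor P (upd v i (wop a t Om)) = wop ak t' (tensor P (upd v i Om)).
    rewrite /t'; elim: t {t'} => //= -[[[] b] f] t iht.
    by rewrite /= -iht tletter_lop slot_upd.
  rewrite -wop_cat; apply: ih => j js; rewrite /upd; case: eqP => // /eqP ji.
  by apply: hv; rewrite in_cons negb_or ji.
apply: (total_ip0 (tensor_totalP P)) => v.
by have := key (enum 'I_k) [::] v; apply=> j; rewrite mem_enum.
Qed.

Lemma tvac_unit : '[tvac, tvac] = 1.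
Proof. by rewrite tensorE big1. Qed.

Lemma tletter_kms i f u :
  '[ak i (T f) (wop ak u tvac), tvac] = '[wop ak u (ak i (f - T f) tvac), tvac].
Proof.
have e1 : ak i (T f) (wop ak u tvac) = wop ak ((i, false, T f) :: u) tvac by [].
have e2 : wop ak u (ak i (f - T f) tvac) = wop ak (rcons u (i, false, f - T f)) tvac.
  by rewrite -cats1 wop_cat.
rewrite e1 e2 !wop_tvac !tensorE; apply: eq_bigr => j _.
rewrite /species filter_rcons /= eq_sym; case: eqP => // _.
rewrite map_rcons -cats1 wop_cat /=; exact: kms.
Qed.

Lemma tletter_quantise (V : 'I_k -> H -> H) : (forall i, bdd (V i)) ->
  (forall i x y, '[V i x, V i y] = '[x, y]) -> (forall i x, T (V i x) = V i (T x)) ->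
  exists Lam, quantises ak tvac V Lam.
Proof.
move=> bV iV TV; have /choice[G hG] : forall i, exists G, quantises a Om (fun=> V i) G.
  by move=> i; exact: quant.
have bG i : bdd (G i) by case: (hG i).
have bGk := tensor_op_bdd P bG.
have inter i s f v : tensor_op P G (lop ak (i, s, f) v) = lop ak (i, s, V i f) (tensor_op P G v).
  have bf := lb (tt, s, f); have bf' := lb (tt, s, V i f).
  rewrite !tletter_lop.
  apply: (congr1 (@^~ v) (_ : tensor_op P G \o slot P i (lop a (tt, s, f)) =
    slot P i (lop a (tt, s, V i f)) \o tensor_op P G)).
  apply: (total_eq (tensor_totalP P)) => [||{}v]; first exact: bdd_comp (slot_bdd _ _ bf).
    exact: bdd_comp (slot_bdd _ _ bf') _.
  rewrite /= slotE // !tensor_opE // slotE //; congr tensor; apply/funext => j; rewrite /upd.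
  case: eqP => // ->; have [_ _ _ h h'] := hG i; rewrite /lop /=; by case: s {bf bf'}.
exists (tensor_op P G); split=> // [x y||i f v|i f v].
- by apply: tensor_op_isometry => // i p q; case: (hG i).
- by rewrite tensor_opE //; congr tensor; apply/funext => i; case: (hG i).
- exact: (inter i false f v).
- exact: (inter i true f v).
Qed.

Lemma tletter_fermi Ti T1i S : bdd T -> (forall x y, '[T x, y] = '[x, T y]) ->
  bdd Ti -> (forall x, T (Ti x) = x) -> (forall x, Ti (T x) = x) ->
  bdd T1i -> (forall x, T1i x - T (T1i x) = x) -> (forall x, T1i (x - T x) = x) ->
  bdd S -> (forall x y, '[S x, S y] = '[x, y]) -> (forall x, T (S x) = S (T x)) ->
  fermi_system ak tvac T Ti T1i S.
Proof.
move=> *; split=> //; [exact: tvac_unit|exact: tvac_total|exact: tletter_kms|exact: tletter_quantise].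
Qed.

(* An operator y commuting with the words is compressed to the operators
   p, q |-> <y (v with p in slot i), w with q in slot i>, which commute with the words of L. *)
Lemma slot_bicommutant i x : bicommutant (words a) x -> bicommutant (words ak) (slot P i x).
Proof.
move=> Mx; have bx := bicommutant_bdd Mx; have bs := slot_bdd P i bx.
apply/commutantE; split=> // y hy; have by_ : bdd y by move/commutantE: hy => [].
suff h v w : '[y (slot P i x (tensor P v)), tensor P w] = '[slot P i x (y (tensor P v)), tensor P w].
  apply: (total_eq (tensor_totalP P)) => [||v]; [exact: bdd_comp|exact: bdd_comp|].
  by apply: (total_ip (tensor_totalP P)) => w /=; rewrite ipC h -ipC.
pose Jv z := tensor P (upd v i z); pose Jw z := tensor P (upd w i z).
have bJv : bdd Jv := upd_tensor_bdd P v i; have bJw : bdd Jw := upd_tensor_bdd P w i.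
have [Jw' bJw' hJw] := adjoint_exists bJw.
pose Y := Jw' \o y \o Jv; have bY : bdd Y by apply: bdd_comp => //; exact: bdd_comp.
have YE p q : '[Y p, q] = '[y (Jv p), Jw q] by rewrite ipC -hJw -ipC.
have cY : commutant (words a) Y.
  apply: words_commutant => // -[] f z; apply: ip_inj => q.
    have bf := ab tt f; rewrite (adjE _ _ bf) !YE.
    have -> : Jw (adj (a tt f) q) = adj (ak i f) (Jw q).
      by rewrite /ak slot_adj // /Jw slot_upd //; exact: adj_bdd.
    rewrite -(adjE _ _ (tletter_bdd i f)) -[ak i f (y _)]/(lop ak (i, false, f) (y _)).
    by rewrite commutant_lop // /lop /= /ak /Jv slot_upd.
  have bf := adj_bdd (ab tt f); rewrite (adjE _ _ bf) (adjK (ab tt f)) !YE.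
  have -> : Jw (a tt f q) = ak i f (Jw q) by rewrite /ak /Jw slot_upd.
  rewrite (adjEr _ _ (tletter_bdd i f)) -[adj (ak i f) (y _)]/(lop ak (i, true, f) (y _)).
  by rewrite commutant_lop // /lop /= /ak slot_adj // /Jv slot_upd.
have updE u : tensor P u = tensor P (upd u i (u i)).
  by congr tensor; apply/funext => j; rewrite /upd; case: eqP => // ->.
rewrite (adjE _ _ bs) (updE v) (updE w) slot_upd // slot_adj // slot_upd; last exact: adj_bdd.
rewrite -/(Jv _) -/(Jv _) -/(Jw _) -/(Jw _) -!YE -(adjE _ _ bx).
by rewrite (bicommutant_comm _ Mx cY).
Qed.

(** Words are elementary tensors of words, and an elementary tensor is a finite product of slot
    operators, each in the bicommutant of the words by [slot_bicommutant]; so both sets have the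
    same commutant. *)
Lemma tensor_words_algebra : tensor_algebra (bicommutant (words a)) P = bicommutant (words ak).
Proof.
rewrite /tensor_algebra; set M := bicommutant (words a).
set G := [set tensor_op P x | x in _].
have GM : G `<=` bicommutant (words ak).
  move=> _ [x Mx <-]; have bx i : bdd (x i) := bicommutant_bdd (Mx i).
  have key s : uniq s -> bicommutant (words ak)
      (tensor_op P (fun j => if j \in s then x j else idfun)).
    elim: s => [_|i s ih /= /andP[js us]].
      rewrite tensor_op_id; apply: sub_bicommutant; last by exists [::].
      by have [] := words_star_closed hCk.
    have := bicommutant_comp (slot_bicommutant i (Mx i)) (ih us).
    rewrite /slot tensor_op_comp => [|j|j]; last 2 first.
    - by case: eqP => // _; exact: bdd_id.
    - by case: ifP => // _; exact: bdd_id.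
    congr (bicommutant _ (tensor_op P _)); apply/funext => j; rewrite in_cons.
    by case: eqP => //= ->; rewrite (negPf js).
  have := key (enum 'I_k) (enum_uniq _); congr (bicommutant _ (tensor_op P _)).
  by apply/funext => j; rewrite mem_enum.
have WG : words ak `<=` G.
  move=> _ [u _ <-]; rewrite wop_tensor; exists (fun j => wop a (species j u)) => // j.
  apply: sub_bicommutant; last by exists (species j u).
  by have [] := words_star_closed hC.
apply/seteqP; split=> x /commutantE[bx hx]; apply/commutantE; split=> // y hy; apply: hx.
  move/commutantE: hy => [b h]; apply/commutantE; split=> // g Gg.
  have /commutantE[_ hg] := GM _ Gg; apply/esym/hg; exact/commutantE.
move/commutantE: hy => [b h]; apply/commutantE; split=> // g Wg; exact: h (WG _ Wg).
Qed.

Lemma tensor_semigroup_tletter alpha alphak S : alpha 1 idfun = idfun ->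
  (forall f, alpha 1 (a tt f) = a tt (S f)) ->
  tensor_semigroup (bicommutant (words a)) alpha alphak ->
  forall i f, alphak 1 (ak i f) = ak i (S f).
Proof.
move=> a1 aS [_ h] i f; rewrite /ak /slot h ?ler01 // => [|j].
  by congr tensor_op; apply/funext => j; case: eqP.
have [wb' _ _ _] := words_star_closed hC.
by apply: sub_bicommutant => //; case: eqP => _; [exists [:: (tt, false, f)]|exists [::]].
Qed.

End TensorFermi.
Arguments tletter {R H L} a {k} P i f.
Arguments tvac {R L} Om {k} P.

(** * The shift semigroup *)

Section Translation.
Context {R : realType} (t : R).
Hypothesis t0 : 0 < t.
Local Notation mu := (@lebesgue_measure R).
Local Notation half := (@half_line R).
Local Notation sub_t := (fun s : R => s - t).

Let msub (D : set R) : measurable_fun D sub_t.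
Proof. by apply: measurable_funTS; apply: measurable_funB. Qed.

Lemma measurable_half_line : measurable half.
Proof. exact: measurable_itv. Qed.

Let nu : {measure set (measurableTypeR R) -> \bar R} :=
  @measure_function_pushforward__canonical__measure_function_Measure _ _ (measurableTypeR R)
    (measurableTypeR R) R mu sub_t (@msub setT).

Lemma lebesgue_translation (A : set R) : measurable A -> mu A = pushforward mu sub_t A.
Proof.
move=> mA; apply: (@lebesgue_measure_unique R nu) => // X [[a b] _ <-] /=.
rewrite /pushforward (_ : _ @^-1` _ = `]a + t, b + t]%classic); last first.
  by apply/seteqP; split=> s /=; rewrite !in_itv /= ltrBrDr lerBlDr.
rewrite !lebesgue_measure_itv /= !lte_fin ltrD2r; case: ifP => // _.
by rewrite -!EFinD; congr EFin; ring.
Qed.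

Definition esh (u : R -> \bar R) : R -> \bar R := fun s => if s < t then 0%E else u (s - t).

Lemma esh_measurable u : measurable_fun half u -> measurable_fun half (esh u).
Proof.
move=> mfu; apply: measurable_fun_if => //; first exact: measurable_half_line.
- by apply: measurable_funTS; apply: measurable_fun_ltr.
have -> : half `&` (fun s : R => s < t) @^-1` [set false] = `[t, +oo[%classic.
  apply/seteqP; split=> s /=; rewrite /half_line /= !in_itv /= !andbT ?ltNge.
    by move=> [_ /negbFE].
  by move=> ts; rewrite ts; split=> //; rewrite -ltNge; apply: lt_le_trans ts.
apply/emeasurable_fun_itv_obnd_cbndP.
apply: (measurable_comp measurable_half_line) mfu (@msub _).
by move=> _ [s + <-] /=; rewrite /half_line /= !in_itv /= !andbT subr_gt0.
Qed.

Lemma ge0_integral_esh u : measurable_fun half u -> (forall s, (0 <= u s)%E) ->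
  (\int[mu]_(s in half) esh u s = \int[mu]_(s in half) u s)%E.
Proof.
move=> mfu u0; have mh := measurable_half_line.
have -> : (\int[mu]_(s in half) u s = \int[nu]_(s in half) u s)%E.
  by apply: eq_measure_integral => A mA _; exact: lebesgue_translation.
rewrite (@ge0_integral_pushforward _ _ (measurableTypeR R) (measurableTypeR R) R sub_t (@msub setT) mu) //.
have -> : sub_t @^-1` half = `]t, +oo[%classic.
  by apply/seteqP; split=> s; rewrite /half_line /= !in_itv /= !andbT subr_gt0.
(* The translate of the open half line omits [t], whereas [esh] is unrestricted from [t] on; a
   single point has measure 0. *)
rewrite [RHS]integral_itv_obnd_cbnd; last first.
  apply: (measurable_comp mh) mfu (@msub _).
  by move=> _ [s + <-] /=; rewrite /half_line /= !in_itv /= !andbT subr_gt0.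
have -> : `[t, +oo[%classic = half `&` `[t, +oo[%classic.
  apply/seteqP; split=> s /=; rewrite /half_line /= !in_itv /= !andbT; last by case.
  by move=> ts; split=> //; apply: lt_le_trans ts.
rewrite integral_mkcondr; apply: eq_integral => s _; rewrite /esh patchE.
case: ifPn => [st|]; first by rewrite memNset //= in_itv /= andbT leNgt st.
by rewrite -leNgt => ts; rewrite mem_set //= in_itv /= andbT.
Qed.

Lemma integral_esh u : measurable_fun half u ->
  (\int[mu]_(s in half) esh u s = \int[mu]_(s in half) u s)%E.
Proof.
move=> mfu; rewrite [LHS]integralE [RHS]integralE; congr (_ - _)%E.
- rewrite -[RHS]ge0_integral_esh //; last exact: measurable_funepos.
  apply: eq_integral => s _; rewrite /esh !funeposE; case: ifP => //= _; by rewrite maxxx.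
- rewrite -[RHS]ge0_integral_esh //; last exact: measurable_funeneg.
  apply: eq_integral => s _; rewrite /esh !funenegE; case: ifP => //= _; by rewrite ?oppe0 ?oppr0 maxxx.
Qed.

End Translation.

Section Shift.
Context {R : realType} (K : hilbert R) (H : L2_tensor K).
Local Notation mu := (@lebesgue_measure R).
Local Notation half := (@half_line R).

Definition creal_measurable (f : R -> R[i]) :=
  measurable_fun half (fun s => complex.Re (f s)) /\ measurable_fun half (fun s => complex.Im (f s)).

Let mEFin (f : R -> R) : measurable_fun half f -> measurable_fun half (fun s => (f s)%:E).
Proof. by move/measurable_EFinP. Qed.

Lemma cintegral_shift (t : R) f : 0 < t -> creal_measurable f ->
  cintegral (shift_fun t f) = cintegral f.
Proof.
move=> t0 [mr mi]; rewrite /cintegral /Rintegral; congr ((fine _) +i* (fine _))%C.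
  rewrite -[RHS](integral_esh t0); last exact: (mEFin mr).
  by apply: eq_integral => s _; rewrite /esh /shift_fun; case: ifP.
rewrite -[RHS](integral_esh t0); last exact: (mEFin mi).
by apply: eq_integral => s _; rewrite /esh /shift_fun; case: ifP.
Qed.

Lemma creal_measurable_mul f g : creal_measurable f -> creal_measurable g ->
  creal_measurable (fun s => f s * (g s)^*).
Proof.
move=> [fr fi] [gr_ gi]; split.
  apply: (eq_measurable_fun (fun s => complex.Re (f s) * complex.Re (g s) +
      complex.Im (f s) * complex.Im (g s))).
    by move=> s _; case: (f s) (g s) => a b [c d] /=; ring.
  by apply: measurable_funD; apply: measurable_funM.
apply: (eq_measurable_fun (fun s => complex.Im (f s) * complex.Re (g s) -
    complex.Re (f s) * complex.Im (g s))).
  by move=> s _; case: (f s) (g s) => a b [c d] /=; ring.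
by apply: measurable_funB; apply: measurable_funM.
Qed.

Lemma square_integrable_measurable (f : R -> R[i]) : square_integrable f -> creal_measurable f.
Proof. by case. Qed.

Lemma square_integrable_shift (t : R) f : 0 < t -> square_integrable f ->
  square_integrable (shift_fun t f).
Proof.
move=> t0 [mr mi int].
have sh (F : R[i] -> R) : F 0 = 0 -> measurable_fun half (fun s => F (f s)) ->
    measurable_fun half (fun s => F (shift_fun t f s)).
  move=> F0 mF; apply/measurable_EFinP.
  apply: (eq_measurable_fun (esh t (fun s => (F (f s))%:E))).
    by move=> s _; rewrite /esh /shift_fun /=; case: ifP; rewrite ?F0.
  by apply: esh_measurable => //; exact: mEFin.
have [mn fin] := (integrableP _ _ _ int).
have F0 : complex.Re `|0 : R[i]| ^+ 2 = 0 by rewrite normr0 /= expr0n.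
split; [exact: (sh (@complex.Re R))|exact: (sh (@complex.Im R))|apply/integrableP; split].
  by apply: mEFin; apply: (sh (fun z => complex.Re `|z| ^+ 2)) => //; exact/measurable_EFinP.
apply: le_lt_trans fin.
rewrite -[leRHS](ge0_integral_esh t0) //; last by apply: measurableT_comp.
rewrite le_eqVlt; apply/orP; left; apply/eqP; apply: eq_integral => s _.
by rewrite /esh /shift_fun; case: ifP => // _; rewrite F0 /= normr0.
Qed.

Let E (p : {f : R -> R[i] | square_integrable f} * K) : H := tens H (sval p.1) p.2.

Lemma tens_totalP : total_fam E.
Proof.
apply/totalP; have := @tens_total _ _ H; congr (dense (lin_span _)); apply/seteqP; split.
  by move=> _ [f hf [x _ <-]]; exists (exist _ f hf, x).
by move=> _ [[[f hf] x] _ <-] /=; exists f => //; exists x.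
Qed.

Lemma shift_op_exists (t : R) : 0 < t -> exists2 S : H -> H, bdd S &
  (forall f x, square_integrable f -> S (tens H f x) = tens H (shift_fun t f) x) /\
  forall u v, '[S u, S v] = '[u, v].
Proof.
move=> t0.
have [|S bS [SE Si]] := @extension_isometry _ _ _ _ E
    (fun p => tens H (shift_fun t (sval p.1)) p.2) tens_totalP.
  move=> [[f hf] x] [[g hg] y]; rewrite /E /=.
  rewrite !tensE //; try exact: square_integrable_shift.
  congr (_ * _); rewrite -[RHS](cintegral_shift t0).
    congr cintegral; apply/funext => s; rewrite /shift_fun; case: ifP => // _.
    by rewrite mul0r.
  by apply: creal_measurable_mul; exact: square_integrable_measurable.
exists S => //; split=> // f x hf; exact: (SE (exist _ f hf, x)).
Qed.

Lemma shift_opP (t : R) : 0 < t -> [/\ bdd (shift_op H t),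
  forall f x, square_integrable f -> shift_op H t (tens H f x) = tens H (shift_fun t f) x
  & forall u v, '[shift_op H t u, shift_op H t v] = '[u, v]].
Proof.
move=> t0; have [S bS [SE Si]] := shift_op_exists t0.
have : exists S, [set S | bounded H S /\ forall f x, square_integrable f ->
    S (tens H f x) = tens H (shift_fun t f) x] S by exists S; split=> //; exact/bounded_bdd.
move/getPex; rewrite -/(shift_op H t) => -[/bounded_bdd b e]; split=> //.
have -> // : shift_op H t = S.
by apply: (total_eq tens_totalP) => // -[[f hf] x]; rewrite /E /= e // SE.
Qed.

(** Indicators of disjoint intervals inside []0, 1[], where functions shifted by time 1 vanish: they
    give infinitely many orthogonal directions in the cokernel. *)
Definition ind (n : nat) (s : R) : R[i] := if n.+2%:R^-1 <= s < n.+1%:R^-1 then 1 else 0.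

Let I_ (n : nat) : set R := `[n.+2%:R^-1, n.+1%:R^-1[%classic.

Lemma indE n s : ind n s = real_complex R (\1_(I_ n) s).
Proof.
rewrite /ind indicE /I_; case: ifP => h.
  by rewrite mem_set //= in_itv.
by rewrite memNset //= in_itv /= h.
Qed.

Lemma I_half n : I_ n `<=` half.
Proof.
move=> s; rewrite /I_ /half_line /= !in_itv /= andbT => /andP[h _].
by apply: lt_le_trans h; rewrite invr_gt0 ltr0n.
Qed.

Lemma mu_I n : mu (I_ n) = (n.+1%:R^-1 - n.+2%:R^-1)%:E.
Proof. by rewrite /I_ lebesgue_measure_itv /= lte_fin ltf_pV2 ?posrE ?ltr0n // ltr_nat ltnSn EFinB. Qed.

Lemma ind_square_integrable n : square_integrable (ind n).
Proof.
have mI : measurable (I_ n) by exact: measurable_itv.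
have e : (fun s => complex.Re (ind n s)) = \1_(I_ n) by apply/funext => s; rewrite indE.
split.
- by rewrite e; exact: measurable_indic.
- rewrite (_ : (fun s => _) = cst 0); first exact: measurable_cst.
  by apply/funext => s; rewrite indE.
rewrite (_ : (fun s => _) = (fun s => (\1_(I_ n) s)%:E)); last first.
  apply/funext => s; rewrite indE normc_def /= expr0n addr0 sqrtr_sqr indicE.
  by case: (_ \in _); rewrite /= ?normr1 ?normr0 ?expr1n ?expr0n.
apply/integrableP; split; first by apply: mEFin; exact: measurable_indic.
under eq_integral do rewrite gee0_abs ?lee_fin //.
rewrite integral_indic //; last exact: measurable_half_line.
rewrite (setIidl (@I_half n)) -[X in (X < _)%E]/(mu (I_ n)) mu_I; exact: ltry.
Qed.

Lemma cintegral_ind n : cintegral (fun s => ind n s * (ind n s)^*) =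
  real_complex R (n.+1%:R^-1 - n.+2%:R^-1).
Proof.
have mI : measurable (I_ n) by exact: measurable_itv.
rewrite /cintegral (_ : (fun s => complex.Re _) = \1_(I_ n)); last first.
  apply/funext => s; rewrite indE /= mul0r subr0 indicE.
  by case: (_ \in _); rewrite /= ?mulr1 ?mulr0.
rewrite (_ : (fun s => complex.Im _) = cst 0); last first.
  by apply/funext => s; rewrite indE /= mul0r oppr0 mulr0 addr0.
rewrite {1}/Rintegral integral_indic //; last exact: measurable_half_line.
rewrite (setIidl (@I_half n)) -[X in fine X]/(mu (I_ n)) mu_I /=; congr (_ +i* _)%C.
by rewrite Rintegral_cst ?mul0r //; exact: measurable_half_line.
Qed.

Lemma cintegral0 : cintegral (fun=> 0 : R[i]) = 0.
Proof.
by rewrite /cintegral /= !Rintegral_cst ?mul0r //; exact: measurable_half_line.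
Qed.

Lemma ind_disjoint n m s : n != m -> ind n s * (ind m s)^* = 0.
Proof.
move=> nm; suff : ind n s = 0 \/ ind m s = 0.
  by case=> ->; rewrite ?mul0r // rmorph0 mulr0.
wlog lt : n m nm / (n < m)%N.
  move=> h; have [lt|lt|e] := ltngtP n m; [exact: h| |by rewrite e eqxx in nm].
  by have [] := h m n _ lt; rewrite 1?eq_sym //; [right|left].
rewrite /ind; case: ifP => [/andP[h _]|]; last by left.
case: ifP => [/andP[_ h']|]; last by right.
have h2 : m.+1%:R^-1 <= n.+2%:R^-1 :> R by rewrite lef_pV2 ?posrE ?ltr0n // ler_nat.
by have := lt_le_trans (le_lt_trans h h') h2; rewrite ltxx.
Qed.

Lemma shift_kernel_sequence (x0 : K) : x0 <> 0 -> exists en : nat -> H,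
  [/\ forall n, adj (shift_op H 1) (en n) = 0, forall n, nrm (en n) = 1 &
      forall n m, n != m -> '[en n, en m] = 0].
Proof.
move=> x0n; have [bS SE Si] := shift_opP (ltr01 : 0 < (1 : R)).
pose v n := tens H (ind n) x0; have si := ind_square_integrable.
have vv n : '[v n, v n] = real_complex R ((n.+1%:R^-1 - n.+2%:R^-1) * nrm x0 ^+ 2).
  by rewrite /v tensE // cintegral_ind ipxx -rmorphM.
have vp n : nrm (v n) != 0.
  apply/eqP => e; have := vv n; rewrite ipxx e expr0n => -[] /esym/eqP.
  rewrite mulf_eq0 subr_eq0 expf_eq0 /=; apply/negP; rewrite negb_or; apply/andP; split.
    by rewrite gt_eqF // ltf_pV2 ?posrE ?ltr0n // ltr_nat.
  by apply/eqP => /nrm_eq0.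
exists (fun n => real_complex R (nrm (v n))^-1 *: v n); split=> [n|n|n m nm].
- have ba := adj_bdd bS; rewrite (bddZ _ _ ba) (_ : adj _ (v n) = 0) ?scaler0 //.
  apply: (total_ip0 tens_totalP) => -[[g hg] y]; rewrite -adjE // /E /= SE // ipC /v tensE //.
    rewrite (_ : (fun s => _) = fun=> 0) ?cintegral0 ?mul0r ?rmorph0 //.
    apply/funext => s; rewrite /ind /shift_fun; case: ifP => [/andP[_ s1]|]; last by rewrite mul0r.
    have -> : s < 1 by apply: lt_le_trans s1 _; rewrite invf_le1 ?ltr0n // ler1n.
    by rewrite rmorph0 mulr0.
  exact: square_integrable_shift.
- by rewrite nrmZ normcR ger0_norm ?invr_ge0 // mulVf.
- rewrite ipZl ipZr /v tensE // (_ : (fun s => _) = fun=> 0) ?cintegral0 ?mul0r ?mulr0 //.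
  by apply/funext => s; exact: ind_disjoint.
Qed.

End Shift.

(** Bessel's inequality makes the squared coefficients of [g] summable. *)
Lemma orthonormal_wnull {R : realType} (H : hilbert R) (en : nat -> H) :
  (forall n, nrm (en n) = 1) -> (forall n m, n != m -> '[en n, en m] = 0) -> wnull en.
Proof.
move=> e1 eo; split; first by exists 1 => n; rewrite e1.
move=> g; pose c n := normc '[en n, g] ^+ 2.
have bessel n : \sum_(i < n) c i <= nrm g ^+ 2.
  pose p := \sum_(i < n) '[g, en i] *: en i.
  have gp : '[g, p] = real_complex R (\sum_(i < n) c i).
    rewrite ip_sumr rmorph_sum; apply: eq_bigr => i _.
    by rewrite ipZr mulrC mulcJr /c -normcJr -ipC.
  have pp : '[p, p] = real_complex R (\sum_(i < n) c i).
    rewrite {1}/p ip_suml rmorph_sum; apply: eq_bigr => i _.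
    rewrite ipZl ip_sumr (bigD1 i) //= big1 ?addr0 => [|j ji].
      by rewrite ipZr ipxx e1 expr1n mulr1 mulcJr /c -normcJr -ipC.
    by rewrite ipZr eo ?mulr0 // eq_sym.
  have := sqr_ge0 (nrm (g - p)); rewrite nrmB_sq gp -(Re_ipxx p) pp /=; lra.
have cvg_c : cvgn (series c).
  apply: nondecreasing_is_cvgn.
    by apply: nondecreasing_series => n _ _; exact: sqr_ge0.
  by exists (nrm g ^+ 2) => _ [n _ <-]; rewrite /series /= big_mkord.
have := cvg_series_cvg_0 cvg_c => /cvgrPdist_lt hc e e0.
have [N _ hN] := hc _ (exprn_gt0 2 e0); exists N => n Nn; rewrite subr0.
have := hN n Nn; rewrite /= sub0r normrN ger0_norm ?sqr_ge0 //.
by rewrite ltr_pXn2r ?nnegrE // ltW.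
Qed.

(** * Comparison of tensor powers *)

(** The defect form [B] vanishes on the diagonal, a positive quadratic form being real; polarisation
    with [x + y] and [x + i y] removes it. *)
Lemma positive_self_adjoint {R : realType} (H : hilbert R) (T : H -> H) : bdd T -> positive T ->
  forall x y, '[T x, y] = '[x, T y].
Proof.
move=> bT pT; pose B x y := '[T x, y] - '[x, T y].
have Bxx x : B x x = 0.
  have := pT x; rewrite /B (ipC x) -/(inner H (T x) x).
  by case: '[T x, x] => a b; rewrite lecE /= => /andP[/eqP -> _]; rewrite oppr0 subrr.
have BD x y x' y' : B (x + x') (y + y') = B x y + B x y' + B x' y + B x' y'.
  by rewrite /B !(bddD _ _ bT) !ipDl !ipDr; ring.
have BZr c x y : B x (c *: y) = conjc c * B x y by rewrite /B !(bddZ _ _ bT) !ipZr mulrBr.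
have BZl c x y : B (c *: x) y = c * B x y by rewrite /B !(bddZ _ _ bT) !ipZl mulrBr.
move=> x y; apply/eqP; rewrite -subr_eq0 -/(B x y).
have e1 : B x y + B y x = 0 by have := Bxx (x + y); rewrite BD !Bxx add0r addr0.
have e2 : conjc 'i%C * B x y + 'i%C * B y x = 0.
  by have := Bxx (x + 'i%C *: y); rewrite BD !Bxx add0r addr0 BZr BZl.
have e3 : 'i%C * (B x y *+ 2) = 0.
  have c : B y x = - B x y by apply/eqP; rewrite -addr_eq0 addrC e1.
  have ci : conjc 'i%C = - 'i%C :> R[i] by apply/eqP; rewrite eq_complex /= oppr0 !eqxx.
  apply/eqP; rewrite -oppr_eq0 -e2 c ci; apply/eqP; ring.
move/eqP: e3; rewrite mulf_eq0 -mulr_natr mulf_eq0 pnatr_eq0 orbF; case/orP => //.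
by rewrite eq_complex /= oner_eq0 andbF.
Qed.

Lemma shom_trans {R : realType} (P1 P2 P3 : hilbert R) (M1 : set (P1 -> P1)) (M2 : set (P2 -> P2))
    (M3 : set (P3 -> P3)) f g : star_hom M1 M2 f -> star_hom M2 M3 g -> star_hom M1 M3 (g \o f).
Proof.
move=> [f1 f2 f3 f4 f5] [g1 g2 g3 g4 g5]; split=> [x Mx||c x y Mx My|x y Mx My|x Mx] /=.
- by apply/g1/f1.
- by rewrite f2.
- by rewrite f3 // g3 //; apply: f1.
- by rewrite f4 // g4 //; apply: f1.
- by rewrite f5 // g5 //; apply: f1.
Qed.

Lemma siso_trans {R : realType} (P1 P2 P3 : hilbert R) (M1 : set (P1 -> P1)) (M2 : set (P2 -> P2))
    (M3 : set (P3 -> P3)) f f' g g' : star_iso M1 M2 f f' -> star_iso M2 M3 g g' ->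
  star_iso M1 M3 (g \o f) (f' \o g').
Proof.
move=> [hf hf' ff' f'f] [hg hg' gg' g'g]; split=> [||x Mx|y My] /=.
- exact: shom_trans hf hg.
- exact: shom_trans hg' hf'.
- by rewrite gg' ?ff' //; exact: (shom_M hf).
- by rewrite f'f ?g'g //; exact: (shom_M hg').
Qed.

Lemma siso_sym {R : realType} (P1 P2 : hilbert R) (M1 : set (P1 -> P1)) (M2 : set (P2 -> P2)) f f' :
  star_iso M1 M2 f f' -> star_iso M2 M1 f' f.
Proof. by case. Qed.

Lemma conj_shom {R : realType} (P : hilbert R) (A : set (P -> P)) (V : P -> P) : star_closed A ->
  bicommutant A V -> (forall v, V (adj V v) = v) -> (forall v, adj V (V v) = v) ->
  star_hom (bicommutant A) (bicommutant A) (fun y => adj V \o y \o V).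
Proof.
move=> sA MV V1 V2; have MV' := bicommutant_adj sA MV; have bV := bicommutant_bdd MV.
have bV' := adj_bdd bV.
split=> [y My||c x y Mx My|x y Mx My|x Mx].
- by apply: bicommutant_comp => //; exact: bicommutant_comp.
- by apply/funext => v; exact: V2.
- apply/funext => v; exact: bdd_lin.
- by apply/funext => v /=; rewrite V1.
- have bx := bicommutant_bdd Mx.
  by rewrite (adj_comp (bdd_comp bV' bx) bV) (adj_comp bV' bx) adjK.
Qed.

Lemma conj_siso {R : realType} (P : hilbert R) (A : set (P -> P)) (V : P -> P) : star_closed A ->
  bicommutant A V -> (forall v, V (adj V v) = v) -> (forall v, adj V (V v) = v) ->
  star_iso (bicommutant A) (bicommutant A) (fun y => adj V \o y \o V) (fun y => V \o y \o adj V).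
Proof.
move=> sA MV V1 V2; have MV' := bicommutant_adj sA MV; have bV := bicommutant_bdd MV.
have e : adj (adj V) = V by exact: adjK.
split; first exact: conj_shom.
- by have := @conj_shom _ _ A (adj V) sA MV'; rewrite e; apply.
- by move=> y _; apply/funext => v /=; rewrite !V1.
- by move=> y _; apply/funext => v /=; rewrite !V2.
Qed.

Theorem corollary5p12 (R : realType) (K : hilbert R) (hK : separable K)
  (H : L2_tensor K) (T : H -> H)
  (hT : bounded H T)
  (hT0 : positive T)
  (hT1 : positive (idfun - T))
  (hTinv : invertible T)
  (hTinv1 : invertible (idfun - T))
  (htrace : forall t : R, 0 <= t ->
     trace (range (shift_op H t)) (T - (T \o T)) = +oo%E)
  (hinv : forall t : R, 0 <= t -> adj (shift_op H t) \o T \o shift_op H t = T)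
  (hsub : forall t : R, 0 <= t ->
     T @` range (shift_op H t) `<=` range (shift_op H t))
  (F : fock H) (w : (F -> F) -> R[i]) (hw : quasi_free T w)
  (L : hilbert R) (pi : (F -> F) -> (L -> L)) (Omega : L)
  (hpi : GNS (CAR_algebra F) w pi Omega)
  (M : set (L -> L)) (hM : M = bicommutant (pi @` CAR_algebra F))
  (alpha : R -> (L -> L) -> (L -> L)) (halpha : CAR_flow pi M alpha)
  (k l : nat) (hk : (0 < k)%N) (hl : (0 < l)%N) (hkl : k <> l)
  (betak betal : R -> (L -> L) -> (L -> L))
  (hbetak : tensor_semigroup_on M alpha k betak)
  (hbetal : tensor_semigroup_on M alpha l betal) :
  ~ cocycle_conjugate M betak betal.
Proof.
move=> [gamma [gamma' [U [hgamma hU hconj]]]].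
have bT : bdd T by exact/bounded_bdd.
have Tsa := positive_self_adjoint bT hT0.
have [Ti /bounded_bdd bTi [TiT TTi]] := hTinv.
have [T1i /bounded_bdd bT1i [T1iT T1T1i]] := hTinv1.
have t1 : 0 < (1 : R) := ltr01.
have [bS SE Si] := shift_opP H t1; set S := shift_op H 1 in bS SE Si.
(* Invariance of the range writes [T (S x)] as [S z], and the relation between [adj S], [T] and [S]
   identifies [z] with [T x]. *)
have ST x : T (S x) = S (T x).
  have [|z _ ez] := hsub 1 ler01 (T (S x)); first by exists (S x) => //; exists x.
  have := congr1 (@^~ x) (hinv 1 ler01); rewrite /= -/S -ez => <-; congr (S _).
  by apply: ip_inj => y; rewrite (adjE _ _ (adj_bdd bS)) (adjK bS) Si.
(* The infinite trace at time 0 forces [K] to be nonzero: over the zero space the trace is 0. *)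
have [x0 hx0] : exists x0 : K, x0 <> 0.
  apply: contrapT => h; have K0 (x : K) : x = 0 by apply: contrapT => hx; apply: h; exists x.
  have H0 (x : H) : x = 0.
    apply: (total_ip0 (@tens_totalP _ _ H)) => -[[f hf] y] /=.
    have -> : tens H f y = 0 by apply: nrm_eq0; apply/eqP; rewrite -sqrf_eq0 -Re_ipxx tensE //
      (K0 y) ip0l mulr0.
    exact: ip0l.
  have := htrace 0 (lexx 0); rewrite /trace esum1 // => e _.
  by rewrite (H0 e) ip0r.
have [en [e0 e1 eo]] := shift_kernel_sequence H hx0.
have enull := orthonormal_wnull e1 eo.
pose a := gns_letter (F := F) pi.
have hC : CAR_system a := gns_CAR hpi.
have sW := words_star_closed hC.
have MW : M = bicommutant (words a) by rewrite hM (gns_algebra hpi).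
have [E0a aS] := halpha.
have [_ a1 _ _ _] := E0_hom E0a ler01.
have flow m (P : tensor_power L m) alpham : tensor_semigroup M alpha alpham ->
    tensor_algebra M P = bicommutant (words (tletter a P)) /\
    flow_system (tletter a P) (tvac Omega P) T Ti T1i S (alpham 1) en.
  move=> hs; have eA : tensor_algebra M P = bicommutant (words (tletter a P)).
    by rewrite MW; exact: tensor_words_algebra.
  have [E0m _] := hs; split; first exact: eA.
  have hom := E0_hom E0m ler01; have nor := E0_normal E0m ler01; rewrite eA in hom nor.
  have T1 x : T (Ti x) = x by have := congr1 (@^~ x) TTi.
  have T2 x : Ti (T x) = x by have := congr1 (@^~ x) TiT.
  have T3 x : T1i x - T (T1i x) = x by have := congr1 (@^~ x) T1T1i.
  have T4 x : T1i (x - T x) = x by have := congr1 (@^~ x) T1iT.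
  have hf := tletter_fermi hC (gns_total hpi) (gns_unit hw hpi) (gns_kms Tsa hw hpi)
    (gns_quantise hw hpi) P bT Tsa bTi T1 T2 bT1i T3 T4 bS Si ST.
  have aS1 f : alpha 1 (a tt f) = a tt (S f) by exact: aS.
  rewrite MW in hs.
  exact: (FlowSystem hf hom nor (tensor_semigroup_tletter hC a1 aS1 hs) e0 e1 enull).
have [Pk [alk [thk [thk' [sk isok ek]]]]] := hbetak.
have [Pl [all [thl [thl' [sl isol el]]]]] := hbetal.
have [Ak fk] := flow _ _ _ sk; have [Al fl] := flow _ _ _ sl.
have [MU [bU U2 U1]] := cocycle_unitary hU ler01.
rewrite Ak in isok; rewrite Al in isol.
have sl' : star_closed (words (tletter a Pl)) := words_star_closed (f_car (fl_fermi fl)).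
have [homl homl' thK thK'] := isol; have [homk homk' thkK thkK'] := isok.
have [homg homg' gK gK'] := hgamma.
(* The cocycle unitary at time 1, carried to the [l]-th tensor power. *)
pose V := thl' (U 1).
have MU' : M (adj (U 1)) by rewrite MW; apply: bicommutant_adj => //; rewrite -MW.
have MV := shom_M homl' MU; rewrite -/V in MV.
have V1 v : V (adj V v) = v.
  rewrite /V -(shom_adj homl' MU) -[LHS]/((thl' (U 1) \o thl' (adj (U 1))) v) -(shom_comp homl' MU MU') U1.
  by rewrite (shom_id homl').
have V2 v : adj V (V v) = v.
  rewrite /V -(shom_adj homl' MU) -[LHS]/((thl' (adj (U 1)) \o thl' (U 1)) v) -(shom_comp homl' MU' MU) U2.
  by rewrite (shom_id homl').
pose Psi0 := thl' \o gamma \o thk; pose Psi0' := thk' \o gamma' \o thl.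
have iso0 : star_iso (bicommutant (words (tletter a Pk))) (bicommutant (words (tletter a Pl))) Psi0 Psi0'.
  have := siso_trans isok (siso_trans hgamma (siso_sym isol)); congr star_iso.
have iso := siso_trans iso0 (conj_siso sl' MV V1 V2).
set Psi := (X in star_iso _ _ X _) in iso; set Psi' := (X in star_iso _ _ _ X) in iso.
have [hom0 hom0' PK0 PK0'] := iso0; have [hom hom' PK PK'] := iso.
have aMk x := alpha_M (x := x) (fl_hom fk); have aMl x := alpha_M (x := x) (fl_hom fl).
(* Following [Psi0] by conjugation with [adj V] cancels the cocycle, so [Psi] maps the image of one
   flow at time 1 onto the image of the other; the element changes from [X] to [Psi0 X], which
   suffices for matching images. *)
have key X : bicommutant (words (tletter a Pk)) X -> Psi (alk 1 X) = all 1 (Psi0 X).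
  move=> MX; have MtX := shom_M homk MX; have MgX := shom_M homg MtX.
  have MlX := shom_M homl' MgX.
  have := hconj 1 _ ler01 MgX; rewrite ek el gK // thkK // => e.
  rewrite /Psi /= /Psi0 /= e.
  have Mal := shom_M homl (aMl _ MlX).
  rewrite (shom_comp homl' _ MU'); last by rewrite MW; apply: bicommutant_comp; rewrite -MW.
  rewrite (shom_comp homl' MU Mal) (shom_adj homl' MU) -/V thK ?V2; last exact: aMl.
  by apply/funext => v /=; rewrite !V2.
(* [no_iso_lt] excludes the case where the target has fewer species; for [k < l] it is applied to
   the inverse isomorphism. *)
have [lt|lt|e] := ltngtP k l; last exact: hkl.
- apply: (no_iso_lt fl fk (siso_sym iso) _ _ lt) => [Y MY|X MX].
    exists (Psi0' Y); first exact: (shom_M hom0').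
    have MX := shom_M hom0' MY; rewrite -{1}(PK0' _ MY) -key // PK //; exact: aMk.
  exists (Psi0 X); first exact: (shom_M hom0).
  by rewrite -key // PK //; exact: aMk.
- apply: (no_iso_lt fk fl iso _ _ lt) => [X MX|Y MY].
    by exists (Psi0 X); [exact: (shom_M hom0)|exact: key].
  have MX := shom_M hom0' MY; exists (Psi0' Y) => //.
  by rewrite key // PK0'.
Qed.
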